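(* Let $s,t$ be positive integers with $t\geqslant 4$ and put $n=2^{s+t+1}+2^{s+1}-3$. Then $$\dim k\otimes_{G(4)}\mathscr{P}_A((P_4)_{n}^{*})=\begin{cases}1 & \text{if } s=1,2,\\ 2 & \text{if } s\geqslant 3.\end{cases}$$ Moreover, $$k\otimes_{G(4)}\mathscr{P}_A((P_4)_{n}^{*})=\begin{cases}\langle[a_2^{(2^{s+1}-1)}a_3^{(2^{s+t}-1)}a_4^{(2^{s+t}-1)}]\rangle & \text{if } s=1,2,\\ \langle[a_2^{(2^{s+1}-1)}a_3^{(2^{s+t}-1)}a_4^{(2^{s+t}-1)}],\ [a_1^{(0)}a_2^{(2^{s}-1)}a_3^{(2^{s}-1)}a_4^{(2^{s+t+1}-1)}]\rangle & \text{if } s\geqslant 3.\end{cases}$$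
   Context: $k=\mathbb{Z}/2$, $A$ is the mod 2 Steenrod algebra and $G(4)=GL_4(k)$. $P_4=k[x_1,\dots,x_4]$, $\deg x_i=1$, with the usual $A$-action and $G(4)$ acting by linear substitution. $(P_4)^*$ is the divided power algebra on $a_1^{(1)},\dots,a_4^{(1)}$ (dual to $x_1,\dots,x_4$), with basis $a_1^{(j_1)}\cdots a_4^{(j_4)}$ dual to the monomials $x_1^{j_1}\cdots x_4^{j_4}$ ($a_i^{(0)}=1$), with the dual right $A$-action. $\mathscr{P}_A((P_4)_n^* )$ is the subspace of $(P_4)_n^*$ annihilated by all $Sq^i$, $i>0$; $k\otimes_{G(4)}\mathscr{P}_A((P_4)_n^* )$ denotes its $G(4)$-coinvariants and $[\cdot]$ classes there. *)

(* Defs.v *)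
From HB Require Import structures.
From mathcomp Require Import all_boot all_order all_algebra.
From mathcomp Require Import mpoly.
Set Implicit Arguments. Unset Strict Implicit. Unset Printing Implicit Defensive.
Import GRing.Theory.
Local Open Scope ring_scope.

(* k = Z/2, P_4 = k[x_1,..,x_4] as {mpoly 'F_2[4]} (x_{i+1} is 'X_i). *)
Notation k := 'F_2.
Notation P4 := {mpoly k[4]}.

(* Total Steenrod square: the ring endomorphism x_i |-> x_i + x_i^2.
   Sq^i p is the homogeneous component of degree deg p + i of Sq p. *)
Definition Sq (p : P4) : P4 := p \mPo [tuple ('X_i + 'X_i ^+ 2 : P4) | i < 4].

Definition gsub (g : 'M[k]_4) (p : P4) : P4 :=
  p \mPo [tuple (\sum_(j < 4) g i j *: 'X_j : P4) | i < 4].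

Definition mon (n : nat) := {m : 'X_{1..4 < n.+1} | mdeg m == n}.
Definition monv n (m : mon n) : 'X_{1..4} := val (val m).

(* (P_4)_n^* : row vectors of coordinates w.r.t. the basis dual to the monomials
   of degree n; coordinate enum_rank m is the value of the functional on x^m. *)
Definition Nmon n := #|{: mon n}|.
Definition dualP n := 'rV[k]_(Nmon n).

(* Dual basis element a_1^{(e_1)}...a_4^{(e_4)} (e of degree n). *)
Definition dualmon n (e : 'X_{1..4}) : dualP n :=
  \row_j (if monv (enum_val j) == e then 1 else 0).

Definition bmv n (b : 'X_{1..4 < n}) : 'X_{1..4} := val b.

(* Matrix of the dual (right) action of all Sq^i, i>0, on (P_4)_n^*:
   column b (a monomial of degree < n, i = n - deg b > 0) records
   phi |-> <phi, Sq^i x^b>. *)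
Definition SqMx n : 'M[k]_(Nmon n, #|{: 'X_{1..4 < n}}|) :=
  \matrix_(i, j) (Sq 'X_[bmv (enum_val j)])@_(monv (enum_val i)).

Definition PrimMx n := kermx (SqMx n).

(* Matrix of the dual action of g on (P_4)_n^*:  phi.g = phi o g. *)
Definition GMx n (g : 'M[k]_4) : 'M[k]_(Nmon n) :=
  \matrix_(i, j) (gsub g 'X_[monv (enum_val j)])@_(monv (enum_val i)).

Definition CoinvKer n :=
  (\sum_(g : 'M[k]_4 | g \in unitmx) <<PrimMx n *m (GMx n g - 1%:M)>>)%MS.

(* dim k (x)_{G(4)} P_A((P_4)_n^* ) = dim P_A - dim (augmentation submodule). *)
Definition coinv_dim n := (\rank (PrimMx n) - \rank (CoinvKer n))%N.

Definition mono4 (a b c d : nat) : 'X_{1..4} :=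
  [multinom (nth 0%N [:: a; b; c; d] i) | i < 4].

(* Main.v *)
Require Import Defs.
From HB Require Import structures.
From mathcomp Require Import all_boot all_order all_algebra.
From mathcomp Require Import mpoly.
From mathcomp Require Import zify ring.

(** A primitive element is a homogeneous functional [th] on the polynomial ring
    with [th (Sq p) = th p].  Testing this identity on products [q * g ^+ 2] with
    [q] squarefree shows that the slices [g |-> th (q * g ^+ 2)] are nearly
    primitive in about half the degree, and gives linear relations between them.
    In the degrees considered the slices by single variables vanish, and [th] is
    determined by its values on two kinds of words: [c1] on [s] factors [T i]
    (products of three variables) followed by variables, and [c2] on [s + 1]
    factors [T i] followed by products of two variables, the successive factors
    being raised to the powers 1, 2, 4, and so on.

    The relations force a word value to depend only on the sets of letters, and
    finite linear algebra then identifies [c1] with a combination of evaluations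
    at the flags (point on a plane) of [F_2^4] and, once [c1] vanishes, [c2] with
    a combination of evaluations at the flags (line on a plane).  The translates
    of [beta] and [alpha] by [g] are exactly the evaluations at the flags of [g],
    so the primitives are spanned by translates of [alpha] and [beta].

    For [s <= 2] a monomial of degree [s] sums to zero over the seven planes
    through a point, which makes [beta] a multiple of [alpha] in the coinvariants.
    Conversely the constant 1 is a combination of word monomials on each family
    of flags; for [alpha], and for [beta] when [3 <= s], this yields an invariant
    functional on the primitives which detects one and kills the other. *)

Set Implicit Arguments. Unset Strict Implicit. Unset Printing Implicit Defensive.
Import GRing.Theory.
Local Open Scope ring_scope.

Lemma F2_case (a : k) : a = 0 \/ a = 1.
Proof. by case: a => [[|[|m]] lt_m] //; [left|right]; apply: val_inj. Qed.

Lemma P4_addpp (p : P4) : p + p = 0.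
Proof. by rewrite -[p]scale1r -scalerDl (_ : 1 + 1 = 0 :> k) ?scale0r //; apply: val_inj. Qed.

Lemma P4_sqrD (p q : P4) : (p + q) ^+ 2 = p ^+ 2 + q ^+ 2.
Proof. by rewrite sqrrD mulr2n P4_addpp addr0. Qed.

Definition px (i : nat) : P4 := 'X_(inord i).
Lemma pxE (i : 'I_4) : px i = 'X_i. Proof. by rewrite /px inord_val. Qed.
Definition pT (i : nat) : P4 := \prod_(j <- iota 0 4 | j != i) px j.
Definition q4 (i j k l : nat) := perm_eq [:: i; j; k; l] (iota 0 4).

Lemma q4P i j k l : q4 i j k l -> [:: i; j; k; l] \in permutations (iota 0 4).
Proof. by rewrite mem_permutations. Qed.

Lemma q4_ind (P : nat -> nat -> nat -> nat -> Prop) :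
  P 0 1 2 3 -> P 0 1 3 2 -> P 0 2 1 3 -> P 0 2 3 1 -> P 0 3 1 2 -> P 0 3 2 1 ->
  P 1 0 2 3 -> P 1 0 3 2 -> P 1 2 0 3 -> P 1 2 3 0 -> P 1 3 0 2 -> P 1 3 2 0 ->
  P 2 0 1 3 -> P 2 0 3 1 -> P 2 1 0 3 -> P 2 1 3 0 -> P 2 3 0 1 -> P 2 3 1 0 ->
  P 3 0 1 2 -> P 3 0 2 1 -> P 3 1 0 2 -> P 3 1 2 0 -> P 3 2 0 1 -> P 3 2 1 0 ->
  forall i j k l, q4 i j k l -> P i j k l.
Proof.
move=> *; match goal with H : is_true (q4 _ _ _ _) |- _ => move: (q4P H) end.
rewrite !inE => HH; repeat (move/orP: HH => [/eqP [-> -> -> ->] //|HH]).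
by move/eqP: HH => [-> -> -> ->].
Qed.

Lemma q4_12 i j k l : q4 i j k l -> q4 j i k l.
Proof. by elim/q4_ind: i j k l / . Qed.
Lemma q4_23 i j k l : q4 i j k l -> q4 i k j l.
Proof. by elim/q4_ind: i j k l / . Qed.
Lemma q4_34 i j k l : q4 i j k l -> q4 i j l k.
Proof. by elim/q4_ind: i j k l / . Qed.

Lemma pT_q4 i j k l : q4 i j k l -> pT i = px j * px k * px l.
Proof. by elim/q4_ind: i j k l /; rewrite /pT /= !big_cons big_nil /=; ring. Qed.

Lemma lt4_q4 i : (i < 4)%N -> exists j k l, q4 i j k l.
Proof.
by case: i => [|[|[|[|//]]]] _; [exists 1, 2, 3| exists 0, 2, 3| exists 0, 1, 3 | exists 0, 1, 2].
Qed.

Lemma phomog_x i : px i \is 1.-homog.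
Proof. by rewrite dhomogX /= mdeg1. Qed.

Lemma phomog_xx i j : px i * px j \is 2.-homog.
Proof. exact: (dhomogM (phomog_x i) (phomog_x j)). Qed.

Lemma phomog_xxx i j k : px i * px j * px k \is 3.-homog.
Proof. exact: (dhomogM (phomog_xx i j) (phomog_x k)). Qed.

Lemma phomog_x4 i j k l : px i * px j * px k * px l \is 4.-homog.
Proof. exact: (dhomogM (phomog_xxx i j k) (phomog_x l)). Qed.

Lemma phomog_T i : (i < 4)%N -> pT i \is 3.-homog.
Proof. by move=> /lt4_q4 [j [k [l /pT_q4 ->]]]; apply: phomog_xxx. Qed.

Lemma Sq0 : Sq 0 = 0. Proof. exact: comp_mpoly0. Qed.
Lemma Sq1 : Sq 1 = 1. Proof. exact: comp_mpoly1. Qed.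
Lemma SqD p q : Sq (p + q) = Sq p + Sq q. Proof. exact: comp_mpolyD. Qed.
Lemma SqM p q : Sq (p * q) = Sq p * Sq q. Proof. exact: rmorphM. Qed.
Lemma Sqxx (p : P4) : Sq (p ^+ 2) = Sq p ^+ 2. Proof. by rewrite !expr2 SqM. Qed.
Lemma Sqx i : Sq (px i) = px i + px i ^+ 2.
Proof. by rewrite /Sq /px comp_mpolyXU -tnth_nth tnth_mktuple. Qed.

(** * Homogeneous functionals and their slices *)

Definition phfun n (th : P4 -> bool) :=
  {morph th : p q / p + q >-> p (+) q} /\
  (forall m, mdeg m != n -> th 'X_[m] = false).

Definition pslice (q : P4) (th : P4 -> bool) : P4 -> bool := fun g => th (q * g ^+ 2).

Section Hfun.
Variables (n : nat) (th : P4 -> bool).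
Hypothesis hth : phfun n th.

Lemma phfunD p q : th (p + q) = th p (+) th q. Proof. exact: hth.1. Qed.

Lemma phfun0 : th 0 = false.
Proof. by have := phfunD 0 0; rewrite addr0; case: (th 0). Qed.

Lemma phfunZ (c : k) p : th (c *: p) = (c != 0) && th p.
Proof. by case: (F2_case c) => ->; rewrite ?scale0r ?scale1r ?phfun0. Qed.

Lemma phfun_sum (I : Type) (r : seq I) (P : pred I) (F : I -> P4) :
  th (\sum_(i <- r | P i) F i) = \big[addb/false]_(i <- r | P i) th (F i).
Proof. by apply: (big_morph th phfunD phfun0). Qed.

Lemma phfun_ext0 : (forall m, mdeg m = n -> th 'X_[m] = false) -> forall p, th p = false.
Proof.
move=> h p; rewrite (mpolyE p) phfun_sum big1 // => m _.
rewrite phfunZ; case: (altP (mdeg m =P n)) => [/h ->|/hth.2 ->]; exact: andbF.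
Qed.

Lemma phfun_deg d q : q \is d.-homog -> d != n -> th q = false.
Proof.
move=> /dhomogP hq ned; rewrite (mpolyE q) phfun_sum big_seq big1 // => m /hq hm.
by rewrite phfunZ hth.2 ?andbF // hm.
Qed.

Lemma phfun_slice d q n' : q \is d.-homog -> (n = d + n'.*2)%N -> phfun n' (pslice q th).
Proof.
move=> hq en; split=> [g h|m nm]; rewrite /pslice.
  by rewrite P4_sqrD mulrDr phfunD.
apply: (phfun_deg (d := d + mdeg m * 2)); first by rewrite dhomogM ?dhomogMn ?dhomogX.
by rewrite en; move: nm; lia.
Qed.

Lemma phfun_par d q g : q \is d.-homog -> odd d != odd n -> th (q * g ^+ 2) = false.
Proof.
move=> hq od; have add : phfun n (fun p => th (q * p ^+ 2)).
  split=> [p p'|m _]; first by rewrite P4_sqrD mulrDr phfunD.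
  apply: (phfun_deg (d := d + mdeg m * 2)); first by rewrite dhomogM ?dhomogMn ?dhomogX.
  by apply: contra od => /eqP <-; rewrite oddD oddM andbF addbF.
elim/mpolyind: g => [|c m p _ _ ih]; first by rewrite expr0n /= mulr0 phfun0.
rewrite add.1 ih addbF /= exprZn -scalerAr phfunZ.
rewrite (phfun_deg (d := d + mdeg m * 2)) ?andbF //; first by rewrite dhomogM ?dhomogMn ?dhomogX.
by apply: contra od => /eqP <-; rewrite oddD oddM andbF addbF.
Qed.

Lemma phfun_mul d q n' : q \is d.-homog -> (n = d + n')%N -> phfun n' (fun g => th (q * g)).
Proof.
move=> hq en; split=> [g h|m nm]; first by rewrite mulrDr phfunD.
apply: (phfun_deg (d := d + mdeg m)); first by rewrite dhomogM ?dhomogX.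
by rewrite en; move: nm; lia.
Qed.

End Hfun.

Lemma phfun_xor n th th' : phfun n th -> phfun n th' -> phfun n (fun p => th p (+) th' p).
Proof.
move=> [a h] [a' h']; split=> [p q|m nm]; last by rewrite h ?h'.
by rewrite a a'; case: (th p) (th q) (th' p) (th' q) => [] [] [] [].
Qed.

Lemma Sq_low (m m' : 'X_{1..4}) : (mdeg m' <= mdeg m)%N -> (Sq 'X_[m])@_m' = (m == m')%:R.
Proof.
move=> le.
have -> : Sq 'X_[m] = (\prod_(i < 4) (1 + 'X_i) ^+ m i) * 'X_[m].
  rewrite /Sq comp_mpolyX (mpolyXE_id _ m) mulrC -big_split /=.
  by apply: eq_bigr => i _; rewrite tnth_mktuple -exprMn; congr (_ ^+ _); ring.
case: (altP (m =P m')) => [<-|ne].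
  rewrite -[X in _@_X]addm0 mcoeffMX rmorph_prod big1 // => i _ /=.
  rewrite rmorphXn rmorphD rmorph1 /= mcoeffX (_ : (_ == _) = false) ?addr0 ?expr1n //.
  by apply/eqP => /(congr1 mdeg); rewrite mdeg1 mdeg0.
apply/eqP; rewrite mcoeff_eq0; apply/negP => /msuppM_le /allpairsP [[a b] /= [_]].
rewrite msuppX inE => /eqP -> e; move: ne le; rewrite e mdegD.
case: (altP (a =P 0%MM)) => [->|a0 _]; first by rewrite add0m eqxx.
by move: a0; rewrite -mdeg_eq0; lia.
Qed.

Lemma phfun_SqX n th m : phfun n th -> mdeg m = n -> th (Sq 'X_[m]) = th 'X_[m].
Proof.
move=> hth dm; suff : th (Sq 'X_[m] + 'X_[m]) = false.
  by rewrite (phfunD hth); do 2!case: (th _).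
set p := _ + _; rewrite (mpolyE p) (phfun_sum hth) big1 // => m' _; rewrite (phfunZ hth).
case: (altP (mdeg m' =P n)) => [e|/hth.2 ->]; last exact: andbF.
rewrite /p mcoeffD Sq_low ?e ?dm // mcoeffX.
by case: (m == m').
Qed.

Lemma phfun_Sq0 n th : phfun n th -> (forall g, th (Sq g) = false) -> forall g, th g = false.
Proof. by move=> hth h; apply: (phfun_ext0 hth) => m /(phfun_SqX hth) <-. Qed.

Lemma monomialE (m : 'X_{1..4}) : 'X_[m] = px 0 ^+ m (inord 0) * px 1 ^+ m (inord 1)
  * px 2 ^+ m (inord 2) * px 3 ^+ m (inord 3) :> P4.
Proof.
rewrite mpolyXE_id (eq_bigr (fun i : 'I_4 => px i ^+ m (inord i))); last first.
  by move=> i _; rewrite /px inord_val.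
rewrite -(big_mkord xpredT (fun i => px i ^+ m (inord i))).
rewrite /index_iota subn0 [iota 0 4]/= !big_cons big_nil.
move: (m (inord 0)) (m (inord 1)) (m (inord 2)) (m (inord 3)) => a b c d.
by move: (px 0) (px 1) (px 2) (px 3) => y0 y1 y2 y3; rewrite mulr1 !mulrA.
Qed.

Lemma monomial_split (m : 'X_{1..4}) :
  exists b0 b1 b2 b3 m', 'X_[m] = px 0 ^+ (b0 : bool) * px 1 ^+ (b1 : bool)
     * px 2 ^+ (b2 : bool) * px 3 ^+ (b3 : bool) * 'X_[m'] ^+ 2 :> P4.
Proof.
pose o (i : nat) := odd (m (inord i)).
exists (o 0), (o 1), (o 2), (o 3), [multinom (m i)./2 | i < 4].
rewrite !monomialE /o !mnmE.
move: (m (inord 0)) (m (inord 1)) (m (inord 2)) (m (inord 3)) => a b c d; move: (px 0) (px 1) (px 2) (px 3) => y0 y1 y2 y3.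
have e (y : P4) n : y ^+ n = y ^+ odd n * (y ^+ n./2) ^+ 2.
  by rewrite -{1}(odd_double_half n) -muln2 exprD exprM.
rewrite (e y0 a) (e y1 b) (e y2 c) (e y3 d); ring.
Qed.

Lemma phfun_odd0 n th : odd n -> phfun n th ->
  (forall i, (i < 4)%N -> forall g, th (px i * g ^+ 2) = false) ->
  (forall i, (i < 4)%N -> forall g, th (pT i * g ^+ 2) = false) ->
  forall g, th g = false.
Proof.
move=> on hth h1 h3; apply: (phfun_ext0 hth) => m _.
have p0 g : th (g ^+ 2) = false.
  by have := phfun_par hth g (dhomog1 _ _); rewrite mul1r on => ->.
have p2 i j g : th (px i * px j * g ^+ 2) = false.
  by apply: (phfun_par hth g (phomog_xx i j)); rewrite on.
have p4 g : th (px 0 * px 1 * px 2 * px 3 * g ^+ 2) = false.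
  by apply: (phfun_par hth g (phomog_x4 0 1 2 3)); rewrite on.
have [b0 [b1 [b2 [b3 [m' ->]]]]] := monomial_split m.
have h3' i j k l g : q4 i j k l -> th (px j * px k * px l * g ^+ 2) = false.
  by move=> q; rewrite -(pT_q4 q) h3 //; move: q; elim/q4_ind: i j k l / .
move: ('X_[m']) => g.
case: b0 b1 b2 b3 => [] [] [] [] /=; rewrite ?expr1 ?expr0 ?mul1r ?mulr1.
- exact: p4. - exact: (h3' 3 0 1 2). - exact: (h3' 2 0 1 3). - exact: p2.
- exact: (h3' 1 0 2 3). - exact: p2. - exact: p2. - exact: h1.
- exact: (h3' 0 1 2 3). - exact: p2. - exact: p2. - exact: h1.
- exact: p2. - exact: h1. - exact: h1. - exact: p0.
Qed.

Lemma phfun_even0 n th : ~~ odd n -> phfun n th ->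
  (forall g, th (g ^+ 2) = false) ->
  (forall i j k l, q4 i j k l -> forall g, th (px i * px j * g ^+ 2) = false) ->
  (forall g, th (px 0 * px 1 * px 2 * px 3 * g ^+ 2) = false) ->
  forall g, th g = false.
Proof.
move=> on hth h0 h2 h4; apply: (phfun_ext0 hth) => m _.
have p1 i g : th (px i * g ^+ 2) = false.
  by apply: (phfun_par hth g (phomog_x i)); rewrite (negPf on).
have p3 i j k g : th (px i * px j * px k * g ^+ 2) = false.
  by apply: (phfun_par hth g (phomog_xxx i j k)); rewrite (negPf on).
have [b0 [b1 [b2 [b3 [m' ->]]]]] := monomial_split m; move: ('X_[m']) => g.
case: b0 b1 b2 b3 => [] [] [] [] /=; rewrite ?expr1 ?expr0 ?mul1r ?mulr1.
- exact: h4. - exact: p3. - exact: p3. - exact: (h2 0 1 2 3).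
- exact: p3. - exact: (h2 0 2 1 3). - exact: (h2 0 3 1 2). - exact: p1.
- exact: p3. - exact: (h2 1 2 0 3). - exact: (h2 1 3 0 2). - exact: p1.
- exact: (h2 2 3 0 1). - exact: p1. - exact: p1. - exact: h0.
Qed.

Lemma phfun_mulx0 n th : phfun n.+1 th ->
  (forall i, (i < 4)%N -> forall g, th (px i * g) = false) -> forall g, th g = false.
Proof.
move=> hth h; apply: (phfun_ext0 hth) => m dm.
have [i mi]: exists i, m i != 0%N.
  apply/existsP; apply: contraT; rewrite negb_exists => /forallP m0.
  have m00 : m = 0%MM by apply/mnmP => i; rewrite mnm0E; apply/eqP; rewrite -[_ == _]negbK m0.
  by move: dm; rewrite m00 mdeg0.
have -> : m = (U_(i) + (m - U_(i)))%MM.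
  by rewrite addmC submK //; apply/mnm_lepP => j; rewrite mnm1E; case: eqP => // <-; lia.
by rewrite mpolyXD -pxE h.
Qed.

Lemma phfun_at1 th : phfun 0 th -> th 1 = false -> forall g, th g = false.
Proof.
move=> hth h1; apply: (phfun_ext0 hth) => m /eqP; rewrite mdeg_eq0 => /eqP ->.
by rewrite mpolyX0.
Qed.

(** * The polynomial ring as an opaque commutative ring *)

(* The slice relations below hold in any commutative ring; sealing the
   implementation of [{mpoly k[4]}] keeps unification from unfolding it. *)
Lemma PR_sealed : {R : comNzRingType | (P4 : comNzRingType) = R}.
Proof. by exists (P4 : comNzRingType). Qed.

Definition PR : comNzRingType := proj1_sig PR_sealed.
Definition ofP (p : P4) : PR :=
  eq_rect (P4 : comNzRingType) (fun R : comNzRingType => R) p PR (proj2_sig PR_sealed).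
Definition toP (p : PR) : P4 :=
  eq_rect PR (fun R : comNzRingType => R) p (P4 : comNzRingType) (esym (proj2_sig PR_sealed)).

Definition x (i : nat) : PR := ofP (px i).
Definition T (i : nat) : PR := ofP (pT i).
Definition St (p : PR) : PR := ofP (Sq (toP p)).
Definition hmg d (q : PR) : bool := toP q \is d.-homog.
Definition hfun n (th : PR -> bool) : Prop := phfun n (fun p => th (ofP p)).
Definition slice (q : PR) (th : PR -> bool) : PR -> bool := fun g => th (q * g ^+ 2).

Ltac unseal :=
  rewrite /x /T /St /hmg /hfun /slice /ofP /toP /PR; destruct PR_sealed as [? []]; cbn [proj1_sig proj2_sig eq_sym eq_rect].

Lemma ofPK p : toP (ofP p) = p. Proof. by move: p; unseal. Qed.
Lemma toPM p q : toP (p * q) = toP p * toP q. Proof. by move: p q; unseal. Qed.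
Lemma toP1 : toP 1 = 1. Proof. by unseal. Qed.

Lemma hmg1 : hmg 0 1. Proof. unseal; exact: dhomog1. Qed.
Lemma hmgM d e p q : hmg d p -> hmg e q -> hmg (d + e) (p * q).
Proof. move: p q; unseal=> p q; exact: dhomogM. Qed.
Lemma homog_x i : hmg 1 (x i). Proof. unseal; exact: phomog_x. Qed.
Lemma homog_xx i j : hmg 2 (x i * x j).
Proof. exact: (hmgM (homog_x i) (homog_x j)). Qed.
Lemma homog_xxx i j k : hmg 3 (x i * x j * x k).
Proof. exact: (hmgM (homog_xx i j) (homog_x k)). Qed.
Lemma homog_x4 i j k l : hmg 4 (x i * x j * x k * x l).
Proof. exact: (hmgM (homog_xxx i j k) (homog_x l)). Qed.
Lemma homog_T i : (i < 4)%N -> hmg 3 (T i). Proof. unseal; exact: phomog_T. Qed.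
Lemma T_q4 i j k l : q4 i j k l -> T i = x j * x k * x l. Proof. unseal; exact: pT_q4. Qed.

Lemma StM p q : St (p * q) = St p * St q. Proof. move: p q; unseal=> p q; exact: SqM. Qed.
Lemma Stxx p : St (p ^+ 2) = St p ^+ 2. Proof. move: p; unseal=> p; exact: Sqxx. Qed.
Lemma Stx i : St (x i) = x i + x i ^+ 2. Proof. unseal; exact: Sqx. Qed.

Lemma hfunD n th p q : hfun n th -> th (p + q) = th p (+) th q.
Proof. move: th p q; unseal=> th p q; move=> h; exact: (phfunD h). Qed.
Lemma hfun0 n th : hfun n th -> th 0 = false.
Proof. move: th; unseal=> th; exact: phfun0. Qed.
Lemma hfun_slice n th d q n' : hfun n th -> hmg d q -> (n = d + n'.*2)%N -> hfun n' (slice q th).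
Proof. move: th q; unseal=> th q; move=> h; exact: (phfun_slice h). Qed.
Lemma hfun_par n th d q g : hfun n th -> hmg d q -> odd d != odd n -> th (q * g ^+ 2) = false.
Proof. move: th q g; unseal=> th q g; move=> h; exact: (phfun_par h). Qed.
Lemma hfun_mul n th d q n' : hfun n th -> hmg d q -> (n = d + n')%N -> hfun n' (fun g => th (q * g)).
Proof. move: th q; unseal=> th q; move=> h; exact: (phfun_mul h). Qed.
Lemma hfun_mul0 n th d q : hfun n th -> hmg d q -> (n < d)%N -> forall g, th (q * g) = false.
Proof.
move: th q; unseal=> th q hth hq nd; apply: (@phfun_ext0 0) => [|m /eqP].
  split=> [g1 g2|m _]; first by rewrite mulrDr (phfunD hth).
  by apply: (phfun_deg hth (d := d + mdeg m)); rewrite ?dhomogM ?dhomogX //; lia.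
by rewrite mdeg_eq0 => /eqP ->; rewrite mpolyX0 mulr1; apply: (phfun_deg hth hq); lia.
Qed.
Lemma hfun_xor n th th' : hfun n th -> hfun n th' -> hfun n (fun p => th p (+) th' p).
Proof. move: th th'; unseal=> th th'; move=> h; exact: (phfun_xor h). Qed.
Lemma hfun_St0 n th : hfun n th -> (forall g, th (St g) = false) -> forall g, th g = false.
Proof. move: th; unseal=> th; move=> h; exact: (phfun_Sq0 h). Qed.
Lemma hfun_mulx0 n th : hfun n.+1 th ->
  (forall i, (i < 4)%N -> forall g, th (x i * g) = false) -> forall g, th g = false.
Proof. move: th; unseal=> th; move=> h; exact: (phfun_mulx0 h). Qed.
Lemma hfun_at1 th : hfun 0 th -> th 1 = false -> forall g, th g = false.
Proof. move: th; unseal=> th; move=> h; exact: (phfun_at1 h). Qed.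
Lemma hfun_odd0 n th : odd n -> hfun n th ->
  (forall i, (i < 4)%N -> forall g, th (x i * g ^+ 2) = false) ->
  (forall i, (i < 4)%N -> forall g, th (T i * g ^+ 2) = false) ->
  forall g, th g = false.
Proof. move: th; unseal=> th; move=> h; move=> h'; exact: (phfun_odd0 h h'). Qed.
Lemma hfun_even0 n th : ~~ odd n -> hfun n th ->
  (forall g, th (g ^+ 2) = false) ->
  (forall i j k l, q4 i j k l -> forall g, th (x i * x j * g ^+ 2) = false) ->
  (forall g, th (x 0 * x 1 * x 2 * x 3 * g ^+ 2) = false) ->
  forall g, th g = false.
Proof. move: th; unseal=> th; move=> h; move=> h'; exact: (phfun_even0 h h'). Qed.
Lemma hfun_eq n th th' : th =1 th' -> hfun n th -> hfun n th'.
Proof.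
by move=> e [h1 h2]; split=> [p q|m nm]; rewrite -!e ?h1 ?h2.
Qed.

Ltac bool_atom a :=
  lazymatch a with true => fail | false => fail | addb _ _ => fail | negb _ => fail | _ => idtac end.
Ltac case_atom a := let b := fresh "b" in generalize a; intros b; destruct b; simpl.
Ltac bool_cases :=
  repeat match goal with
  | |- context [addb ?a ?b] => first [bool_atom a; case_atom a | bool_atom b; case_atom b]
  | |- context [negb ?a] => bool_atom a; case_atom a
  | |- context [?a = false] => bool_atom a; case_atom a
  end; try done.

(** * Relations between the slices of a primitive functional *)

Definition prim n (th : PR -> bool) := hfun n th /\ forall p, th (St p) = th p.

Section SqRelations.
Variables (n : nat) (th : PR -> bool).
Hypothesis pth : prim n th.
Let hth := pth.1.
Let D p q := hfunD p q hth.

Lemma prim_sq1 i g : th (x i * g ^+ 2) =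
  th (x i * St g ^+ 2) (+) th ((x i * St g) ^+ 2).
Proof.
by rewrite -(pth.2 (x i * g ^+ 2)) StM Stxx Stx -D; congr th; ring.
Qed.

Lemma prim_sq2 i j g : th (x i * x j * g ^+ 2) =
  th (x i * x j * St g ^+ 2) (+) th (x j * (x i * St g) ^+ 2) (+)
  th (x i * (x j * St g) ^+ 2) (+) th ((x i * x j * St g) ^+ 2).
Proof.
rewrite -(pth.2 (x i * x j * g ^+ 2)) StM Stxx !StM !Stx -!D; congr th.
move: (x i) (x j) (St g) => a b G; ring.
Qed.

Lemma prim_sq3 i j k g : th (x i * x j * x k * g ^+ 2) =
  th (x i * x j * x k * St g ^+ 2) (+)
  (th (x j * x k * (x i * St g) ^+ 2) (+) th (x i * x k * (x j * St g) ^+ 2) (+)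
   th (x i * x j * (x k * St g) ^+ 2)) (+)
  (th (x i * (x j * x k * St g) ^+ 2) (+) th (x j * (x i * x k * St g) ^+ 2) (+)
   th (x k * (x i * x j * St g) ^+ 2)) (+)
  th ((x i * x j * x k * St g) ^+ 2).
Proof.
rewrite -(pth.2 (x i * x j * x k * g ^+ 2)) StM Stxx !StM !Stx -!D; congr th.
move: (x i) (x j) (x k) (St g) => a b c G; ring.
Qed.

Lemma prim_sq4 i j k l g : th (x i * x j * x k * x l * g ^+ 2) =
  th (x i * x j * x k * x l * St g ^+ 2) (+)
  (th (x j * x k * x l * (x i * St g) ^+ 2) (+) th (x i * x k * x l * (x j * St g) ^+ 2) (+)
   th (x i * x j * x l * (x k * St g) ^+ 2) (+) th (x i * x j * x k * (x l * St g) ^+ 2)) (+)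
  (th (x k * x l * (x i * x j * St g) ^+ 2) (+) th (x j * x l * (x i * x k * St g) ^+ 2) (+)
   th (x j * x k * (x i * x l * St g) ^+ 2) (+) th (x i * x l * (x j * x k * St g) ^+ 2) (+)
   th (x i * x k * (x j * x l * St g) ^+ 2) (+) th (x i * x j * (x k * x l * St g) ^+ 2)) (+)
  (th (x l * (x i * x j * x k * St g) ^+ 2) (+) th (x k * (x i * x j * x l * St g) ^+ 2) (+)
   th (x j * (x i * x k * x l * St g) ^+ 2) (+) th (x i * (x j * x k * x l * St g) ^+ 2)) (+)
  th ((x i * x j * x k * x l * St g) ^+ 2).
Proof.
rewrite -(pth.2 (x i * x j * x k * x l * g ^+ 2)) StM Stxx !StM !Stx -!D; congr th.
move: (x i) (x j) (x k) (x l) (St g) => a b c d G; ring.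
Qed.

Lemma par0 g : odd n -> th (g ^+ 2) = false.
Proof. by move=> on; have := hfun_par g hth (hmg1); rewrite mul1r on => ->. Qed.
Lemma par1 i g : ~~ odd n -> th (x i * g ^+ 2) = false.
Proof. by move=> on; apply: (hfun_par g hth (homog_x i)); rewrite (negPf on). Qed.
Lemma par2 i j g : odd n -> th (x i * x j * g ^+ 2) = false.
Proof. by move=> on; apply: (hfun_par g hth (homog_xx i j)); rewrite on. Qed.
Lemma par3 i j k g : ~~ odd n -> th (x i * x j * x k * g ^+ 2) = false.
Proof. by move=> on; apply: (hfun_par g hth (homog_xxx i j k)); rewrite (negPf on). Qed.
Lemma par4 i j k l g : odd n -> th (x i * x j * x k * x l * g ^+ 2) = false.
Proof. by move=> on; apply: (hfun_par g hth (homog_x4 i j k l)); rewrite on. Qed.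

End SqRelations.

Lemma prim_xor n th th' : prim n th -> prim n th' -> prim n (fun p => th p (+) th' p).
Proof. by move=> [h s] [h' s']; split; [exact: hfun_xor|move=> p; rewrite s s']. Qed.

Section OddPrim.
Variables (N : nat) (th : PR -> bool).
Hypothesis pth : prim N.*2.+1 th.
Let hth := pth.1.
Let on : odd N.*2.+1. Proof. by rewrite /= odd_double. Qed.

Lemma hfun_lin i : hfun N (slice (x i) th).
Proof. exact: (hfun_slice hth (homog_x i)). Qed.

Lemma prim_lin i : prim N (slice (x i) th).
Proof.
split; first exact: hfun_lin.
by move=> g; rewrite /slice (prim_sq1 pth i g) (par0 pth) ?addbF.
Qed.

Lemma lin_sym i j g : th (x i * (x j * g) ^+ 2) = th (x j * (x i * g) ^+ 2).
Proof.
have [N0|N0] := posnP N.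
  have e a b : th (x a * (x b * g) ^+ 2) = false.
    rewrite exprMn [x b ^+ 2]expr2 mulrA.
    apply: (hfun_mul0 hth (hmgM (homog_x a) (hmgM (homog_x b) (homog_x b)))).
    by rewrite N0.
  by rewrite !e.
have s a b : hfun N.-1 (fun g => th (x a * (x b * g) ^+ 2)).
  by apply: (hfun_mul (hfun_lin a) (homog_x b)); lia.
have h0 := hfun_St0 (hfun_xor (s i j) (s j i)) _ g.
suff : th (x i * (x j * g) ^+ 2) (+) th (x j * (x i * g) ^+ 2) = false by bool_cases.
apply: h0 => {}g; have := prim_sq2 pth i j g.
by rewrite !(par2 pth) ?(par0 pth) //; bool_cases.
Qed.

End OddPrim.

Section NoLin.
Variables (M : nat) (th : PR -> bool).
Hypothesis pth : prim (M.+1.*2 + 3) th.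
Hypothesis lin0 : forall i, (i < 4)%N -> forall g, th (x i * g ^+ 2) = false.
Let on : odd (M.+1.*2 + 3). Proof. by rewrite oddD odd_double. Qed.

Let q4lt i j k l : q4 i j k l -> [/\ i < 4, j < 4, k < 4 & l < 4]%N.
Proof. by elim/q4_ind: i j k l / . Qed.

Lemma prim_T i : (i < 4)%N -> prim M.+1 (slice (T i) th).
Proof.
move=> i4; split; first by apply: (hfun_slice pth.1 (homog_T i4)); rewrite addnC.
have [j [k [l q]]] := lt4_q4 i4; have [_ j4 k4 l4] := q4lt q.
move=> g; rewrite /slice (T_q4 q) (prim_sq3 pth j k l g).
by rewrite !(par2 pth) // !lin0 // !(par0 pth) // !addbF.
Qed.

Lemma T_sum i j k l g : q4 i j k l ->
  th (T i * (x i * g) ^+ 2) (+) th (T j * (x j * g) ^+ 2) (+)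
  th (T k * (x k * g) ^+ 2) (+) th (T l * (x l * g) ^+ 2) = false.
Proof.
move=> q; have [i4 j4 k4 l4] := q4lt q.
have s a : (a < 4)%N -> hfun M (fun g => th (T a * (x a * g) ^+ 2)).
  by move=> a4; apply: (hfun_mul (prim_T a4).1 (homog_x a)).
apply: (hfun_St0 (hfun_xor (hfun_xor (hfun_xor (s i i4) (s j j4)) (s k k4)) (s l l4))) => {}g.
have := prim_sq4 pth i j k l g; rewrite (T_q4 q) (T_q4 (q4_12 q)) (T_q4 (q4_12 (q4_23 q))).
rewrite (T_q4 (q4_12 (q4_23 (q4_34 q)))) !(par4 pth) // !(par2 pth) // !lin0 // !(par0 pth) //.
by bool_cases.
Qed.

End NoLin.

Section EvenPrim.
Variables (m : nat) (th : PR -> bool).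
Hypothesis pth : prim m.+1.*2 th.
Let hth := pth.1.
Let on : ~~ odd m.+1.*2. Proof. by rewrite odd_double. Qed.

Lemma even_sq0 g : th (g ^+ 2) = false.
Proof.
have h1 : hfun m.+1 (slice 1 th) by apply: (hfun_slice hth (hmg1)).
have := hfun_mulx0 h1 _ g; rewrite /slice mul1r; apply=> i _ {}g.
rewrite mul1r; apply: (hfun_St0 (th := fun g => th ((x i * g) ^+ 2)) (n := m)) => [|{}g].
  have := hfun_mul h1 (homog_x i) (erefl _); rewrite /slice => h.
  by split=> [p q|u]; [have := h.1 p q|have := h.2 u]; rewrite !mul1r.
by have := prim_sq1 pth i g; rewrite !(par1 pth).
Qed.

Lemma prim_pair i j : prim m (slice (x i * x j) th).
Proof.
split; first exact: (hfun_slice hth (homog_xx i j)).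
by move=> g; rewrite /slice (prim_sq2 pth i j g) !(par1 pth) // !even_sq0 !addbF.
Qed.

Lemma pair_cyc i j k g : (0 < m)%N ->
  th (x j * x k * (x i * g) ^+ 2) (+) th (x i * x k * (x j * g) ^+ 2) (+)
  th (x i * x j * (x k * g) ^+ 2) = false.
Proof.
move=> m0; have s a b c : hfun m.-1 (fun g => th (x a * x b * (x c * g) ^+ 2)).
  by apply: (hfun_mul (prim_pair a b).1 (homog_x c)); lia.
apply: (hfun_St0 (hfun_xor (hfun_xor (s j k i) (s i k j)) (s i j k))) => {}g.
have := prim_sq3 pth i j k g; rewrite !(par3 pth) // !(par1 pth) // !even_sq0.
by bool_cases.
Qed.

Lemma pair_six e i j k l g : m = e.+1.*2 ->
  th (x k * x l * (x i * x j * g ^+ 2) ^+ 2) (+) th (x j * x l * (x i * x k * g ^+ 2) ^+ 2) (+)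
  th (x j * x k * (x i * x l * g ^+ 2) ^+ 2) (+) th (x i * x l * (x j * x k * g ^+ 2) ^+ 2) (+)
  th (x i * x k * (x j * x l * g ^+ 2) ^+ 2) (+) th (x i * x j * (x k * x l * g ^+ 2) ^+ 2) = false.
Proof.
move=> em; have s a b c d : hfun e (fun g => th (x a * x b * (x c * x d * g ^+ 2) ^+ 2)).
  by apply: (hfun_slice (prim_pair a b).1 (homog_xx c d)); lia.
apply: (hfun_St0 (hfun_xor (hfun_xor (hfun_xor (hfun_xor (hfun_xor (s k l i j) (s j l i k))
  (s j k i l)) (s i l j k)) (s i k j l)) (s i j k l))) => {}g.
have h4 : hfun e.*2.+1 (slice (x i * x j * x k * x l) th).
  by apply: (hfun_slice hth (homog_x4 i j k l)); lia.
have z f : th (x i * x j * x k * x l * (f ^+ 2) ^+ 2) = false.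
  by have := hfun_par f h4 (hmg1); rewrite /slice mul1r; apply; rewrite /= odd_double.
have := prim_sq4 pth i j k l (g ^+ 2); rewrite Stxx !z !(par3 pth) // !(par1 pth) // !even_sq0.
by bool_cases.
Qed.

End EvenPrim.

Lemma q4_lt i j k l : q4 i j k l -> [/\ i < 4, j < 4, k < 4 & l < 4]%N.
Proof. by elim/q4_ind: i j k l / . Qed.

Lemma q4_X i j k l : q4 i j k l -> x i * x j * x k * x l = x 0 * x 1 * x 2 * x 3.
Proof. by elim/q4_ind: i j k l /; ring. Qed.

Lemma q4_mem i j k l a : q4 i j k l -> (a < 4)%N -> [\/ a = i, a = j, a = k | a = l].
Proof.
move=> q a4; have : a \in [:: i; j; k; l] by rewrite (perm_mem q) mem_iota.
by rewrite !inE => /or4P [] /eqP ->; [apply: Or41|apply: Or42|apply: Or43|apply: Or44].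
Qed.

Section LinVanish.
Variables (M : nat) (th : PR -> bool).
Hypothesis M0 : (0 < M)%N.
Hypothesis pth : prim M.+1.*2.*2.+1 th.

Let psi i := slice (x i) th.
Let ppsi i : prim M.+1.*2 (psi i). Proof. exact: (prim_lin pth). Qed.
Let sym i j g : psi i (x j * g) = psi j (x i * g). Proof. exact: (lin_sym pth). Qed.
Let sq0 i g : psi i (g ^+ 2) = false. Proof. exact: (even_sq0 (ppsi i)). Qed.

Let ii0 i j g : psi i (x i * x j * g ^+ 2) = false.
Proof.
by rewrite -mulrA mulrCA sym (_ : x i * _ = (x i * g) ^+ 2) ?sq0 //; ring.
Qed.

Let swap i j k g : psi i (x j * x k * g ^+ 2) = psi j (x i * x k * g ^+ 2).
Proof. by rewrite -2!mulrA sym. Qed.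

Let cyc i j k l g :
  psi i (x k * x l * (x j * g) ^+ 2) (+) psi i (x j * x l * (x k * g) ^+ 2) (+)
  psi i (x j * x k * (x l * g) ^+ 2) = false.
Proof. exact: (pair_cyc (ppsi i)). Qed.

Let inside i j k g : psi i (x j * x k * (x i * g) ^+ 2) = false.
Proof. by have := cyc i i j k g; rewrite !ii0; bool_cases. Qed.

Let A i j k l g := psi i (x j * x k * (x l * g) ^+ 2).
Let A12 i j k l g : A i j k l g = A j i k l g. Proof. exact: swap. Qed.
Let A23 i j k l g : A i j k l g = A i k j l g. Proof. by rewrite /A (mulrC (x j)). Qed.

Let outside i j k l g : A i j k l g = false.
Proof.
have := cyc i j k l g; have := cyc j i k l g; have := cyc k i j l g; have := cyc l i j k g.
rewrite -!/(A _ _ _ _ _).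
rewrite (A12 l j) (A23 j l k) (A12 l i k) (A23 i l k) (A12 l i j) (A23 i l j).
rewrite (A12 k j l) (A12 k i l) (A12 k i j) (A23 i k j) (A12 j i l) (A12 j i k).
by bool_cases.
Qed.

Let pair0 i j k l g : q4 i j k l -> psi i (x j * x k * g ^+ 2) = false.
Proof.
move=> q; have := (prim_pair (ppsi i) j k).1; rewrite -(prednK M0) => h.
apply: (hfun_mulx0 h) => m m4 {}g; case: (q4_mem q m4) => ->; rewrite /slice.
- exact: inside. - by rewrite swap inside. - by rewrite (mulrC (x j)) swap inside.
- exact: outside.
Qed.

Let x40 i j k l g : psi i (x i * x j * x k * x l * g ^+ 2) = false.
Proof.
have -> : x i * x j * x k * x l * g ^+ 2 = x l * (x i * x j * x k * g ^+ 2) by ring.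
rewrite sym (_ : _ * _ = x j * x k * (x i * g) ^+ 2); last by ring.
exact: outside.
Qed.

Lemma lin_vanish i g : (i < 4)%N -> th (x i * g ^+ 2) = false.
Proof.
move=> i4; apply: (hfun_even0 _ (ppsi i).1 (sq0 i)); first by rewrite odd_double.
  move=> a b c d q {}g; case: (q4_mem q i4) => ->.
  - exact: ii0. - by rewrite (mulrC (x a)) ii0.
  - by apply: (@pair0 c a b d); move/q4_23: q => /q4_12 .
  - by apply: (@pair0 d a b c); move/q4_34: q => /q4_23 /q4_12.
move=> {}g; have [j [k [l q]]] := lt4_q4 i4; rewrite -(q4_X q); exact: x40.
Qed.

End LinVanish.

Section LinVanishStep.
Variables (e : nat) (th : PR -> bool).
Hypothesis e0 : (0 < e)%N.
Hypothesis pth : prim (e.*2 + 3).*2.+1 th.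
Hypothesis linlin0 : forall i j, (i < 4)%N -> (j < 4)%N ->
  forall g, th (x i * (x j * g ^+ 2) ^+ 2) = false.

Let psi i := slice (x i) th.
Let ppsi i : prim (e.*2 + 3) (psi i). Proof. exact: (prim_lin pth). Qed.
Let sym i j g : psi i (x j * g) = psi j (x i * g). Proof. exact: (lin_sym pth). Qed.
Let on : odd (e.*2 + 3).*2.+1. Proof. by rewrite /= odd_double. Qed.
Let on' : odd (e.*2 + 3). Proof. by rewrite oddD odd_double. Qed.

Let tau0 i j k g : (j < 4)%N -> (k < 4)%N -> psi i (x i * x j * x k * g ^+ 2) = false.
Proof.
move=> j4 k4; have -> : x i * x j * x k * g ^+ 2 = x j * (x i * x k * g ^+ 2) by ring.
rewrite sym (_ : _ * _ = x k * (x i * g) ^+ 2); last by ring.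
exact: linlin0.
Qed.

Let tauE i j k l g : psi i (x j * x k * x l * g ^+ 2) = psi j (x i * x k * x l * g ^+ 2).
Proof. by rewrite -!mulrA sym. Qed.

(* [th (T_i -)] is not primitive; this is the resulting correction term. *)
Let phi j k l m g :
  th (x j * x k * x l * (x m * x m * g ^+ 2) ^+ 2) = psi l (x j * x k * x m * g ^+ 2).
Proof.
have hT : hfun e.+1.*2 (slice (x j * x k * x l) th).
  by apply: (hfun_slice pth.1 (homog_xxx j k l)); lia.
have h1 : hfun e (fun g => th (x j * x k * x l * (x m * x m * g ^+ 2) ^+ 2)).
  by apply: (hfun_slice hT (homog_xx m m)); lia.
have h2 : hfun e (fun g => psi l (x j * x k * x m * g ^+ 2)).
  by apply: (hfun_slice (ppsi l).1 (homog_xxx j k m)); lia.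
suff : th (x j * x k * x l * (x m * x m * g ^+ 2) ^+ 2) (+)
       psi l (x j * x k * x m * g ^+ 2) = false by bool_cases.
apply: (hfun_St0 (hfun_xor h1 h2)) => {}g.
have z f : th (x j * x k * x l * (x m * f ^+ 2) ^+ 2) = false.
  by apply: (hfun_par f hT (homog_x m)); rewrite odd_double.
have := prim_sq3 pth j k l (x m * g ^+ 2); rewrite z !(par2 pth) // (par0 pth) //.
rewrite StM Stxx Stx; set G := St g.
have -> : th (x j * x k * x l * ((x m + x m ^+ 2) * G ^+ 2) ^+ 2) =
          th (x j * x k * x l * (x m * x m * G ^+ 2) ^+ 2).
  rewrite mulrDl (hfunD _ _ hT : th (_ * (_ + _) ^+ 2) = _) /slice z /=.
  by rewrite expr2.
have e1 f : th (x j * (x k * x l * f) ^+ 2) = th (x l * (x j * x k * f) ^+ 2).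
  rewrite (_ : x k * x l * f = x l * (x k * f)); last by ring.
  by have := sym j l (x k * f); rewrite /psi /slice => ->; congr (th (_ * _ ^+ 2)); ring.
have e2 f : th (x k * (x j * x l * f) ^+ 2) = th (x l * (x j * x k * f) ^+ 2).
  rewrite (_ : x j * x l * f = x l * (x j * f)); last by ring.
  by have := sym k l (x j * f); rewrite /psi /slice => ->; congr (th (_ * _ ^+ 2)); ring.
rewrite e1 e2.
have -> : th (x l * (x j * x k * ((x m + x m ^+ 2) * G ^+ 2)) ^+ 2) =
          psi l (x j * x k * x m * G ^+ 2).
  rewrite (_ : x j * x k * _ = x j * x k * x m * G ^+ 2 + x j * x k * (x m * G) ^+ 2); last by ring.
  rewrite -/(slice (x l) th _) -/(psi l _) (hfunD _ _ (ppsi l).1).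
  by rewrite (par2 (ppsi l)) // addbF.
by bool_cases.
Qed.

Lemma lin_vanish_step i : (i < 4)%N -> forall g, th (x i * g ^+ 2) = false.
Proof.
have tau i' j k l g : q4 i' j k l -> psi i' (x j * x k * x l * g ^+ 2) = false.
  move=> q; have [i4 j4 k4 l4] := q4_lt q.
  have t1 a b c d f : q4 a b c d -> psi a (x b * x c * x d * (x b * f) ^+ 2) = false.
    move=> q'; have [a4 b4 c4 d4] := q4_lt q'.
    have -> : psi a (x b * x c * x d * (x b * f) ^+ 2) = psi d (x b * x c * x a * (x b * f) ^+ 2).
      rewrite (_ : x b * x c * x d * (x b * f) ^+ 2 = x d * (x b * x c * (x b * f) ^+ 2)); last by ring.
      by rewrite sym; congr psi; ring.
    rewrite -phi (_ : x a * x a * _ = x b * x b * (x a * f) ^+ 2); last by ring.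
    rewrite phi (_ : x b * x c * x b * _ = x c * (x b * x a * f) ^+ 2); last by ring.
    exact: linlin0.
  have h : hfun e (slice (x j * x k * x l) (psi i')).
    by apply: (hfun_slice (ppsi i').1 (homog_xxx j k l)); lia.
  move: h; rewrite -(prednK e0) => h; apply: (hfun_mulx0 h) => m m4 {}g.
  case: (q4_mem q m4) => ->; rewrite /slice.
  - by rewrite tauE t1 // q4_12.
  - exact: t1.
  - by rewrite (mulrC (x j)) t1 // q4_23.
  - rewrite (_ : x j * x k * x l = x l * x j * x k); last by ring.
    by apply: (t1 i' l j k); move/q4_34: q => /q4_23.
move=> i4; apply: (hfun_odd0 on' (ppsi i).1) => [j j4 g|j j4 g]; first exact: linlin0.
have [j' [k [l q]]] := lt4_q4 j4; rewrite (T_q4 q); have [_ j4' k4 l4] := q4_lt q.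
case: (q4_mem q i4) => ->.
- exact: tau. - exact: tau0.
- by rewrite (mulrC (x j')) tau0.
- by rewrite (_ : x j' * x k * x l = x l * x j' * x k) ?tau0 //; ring.
Qed.

End LinVanishStep.

(** * Words, and injectivity of the word coordinates *)

Fixpoint wp (ms : seq PR) : PR := if ms is m :: ms' then m * wp ms' ^+ 2 else 1.

Definition letters := all (fun i => i < 4)%N.
Definition pairs : seq (nat * nat) := [:: (0, 1); (0, 2); (0, 3); (1, 2); (1, 3); (2, 3)]%N.
Definition pr (i j : nat) : nat * nat := if (i < j)%N then (i, j) else (j, i).
Definition xp (p : nat * nat) : PR := x p.1 * x p.2.
Definition pletters (z : seq (nat * nat)) := all (mem pairs) z.

Lemma xp_pr i j : xp (pr i j) = x i * x j.
Proof. by rewrite /xp /pr; case: ifP => //= _; rewrite mulrC. Qed.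

Lemma pr_pairs i j k l : q4 i j k l -> pr i j \in pairs.
Proof. by elim/q4_ind: i j k l /. Qed.

(* Degrees of the words in the [x i], in the [xp p], and of [T]-words of
   length [s] followed by the latter. *)
Fixpoint dO r := if r is r'.+1 then (dO r').*2.+1 else 0%N.
Fixpoint dE b := if b is b'.+1 then (dE b').+1.*2 else 0%N.
Fixpoint dN b s := if s is s'.+1 then (dN b s').*2.+3 else (dE b).*2.+3.

Lemma dO_dE b : dO b.+2 = dN b 0.
Proof. by elim: b => //= b; lia. Qed.

Lemma dN_odd b s : exists2 y, (0 < y)%N & dN b s = y.*2.+1.
Proof. by case: s => [|s]; [exists (dE b).+1|exists (dN b s).+1]; rewrite //=; lia. Qed.

Section LinVanishBase.
Variable th : PR -> bool.
Hypothesis pth : prim 15 th.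
Hypothesis words0 : forall i j k l, (i < 4)%N -> (j < 4)%N -> (k < 4)%N -> (l < 4)%N ->
  th (x i * (x j * (x k * x l ^+ 2) ^+ 2) ^+ 2) = false.

Let B i j (g : PR) := th (x i * (x j * g ^+ 2) ^+ 2).
Let Bsym i j g : B i j g = B j i g. Proof. exact: (@lin_sym 7 th pth). Qed.
Let Bswap i j k g : B i j (x k * g) = B i k (x j * g).
Proof. exact: (@lin_sym 3 (slice (x i) th) (@prim_lin 7 th pth i)). Qed.

Let Z i j b c : (i < 4)%N -> (j < 4)%N -> (b < 4)%N -> (c < 4)%N -> B i j (x j * x b * x c) = false.
Proof.
move=> i4 j4 b4 c4; rewrite (_ : x j * x b * x c = x b * (x j * x c)); last by ring.
rewrite Bswap (_ : x j * (x j * x c) = x c * x j ^+ 2); last by ring.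
exact: words0.
Qed.

Let ZT i j l a b c : (i < 4)%N -> (j < 4)%N -> q4 l a b c -> B i j (x a * x b * x c) = false.
Proof.
have Z1 i' j' l' a' b' c' : (i' < 4)%N -> (j' < 4)%N -> q4 l' a' b' c' -> j' != l' ->
    B i' j' (x a' * x b' * x c') = false.
  move=> i4 j4 q; have [l4 a4 b4 c4] := q4_lt q.
  case: (q4_mem q j4) => -> => [/eqP//|_|_|_]; first by rewrite Z.
    by rewrite (mulrC (x a')) Z.
  by rewrite (_ : x a' * x b' * x c' = x c' * x a' * x b') ?Z //; ring.
move=> i4 j4 q; have [l4 a4 b4 c4] := q4_lt q.
have [ejl|] := altP (j =P l); last exact: (Z1 _ _ l).
have [eil|] := altP (i =P l); last by rewrite Bsym; apply: (Z1 _ _ l).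
rewrite ejl eil (_ : x a * x b * x c = x a * (x b * x c)); last by ring.
rewrite Bswap Bsym mulrA; apply: (Z1 a l a) => //; first exact: q4_12.
by move: q; rewrite /q4 => /perm_uniq /=; rewrite !inE; case: (l == a).
Qed.

Lemma linlin_vanish15 i j : (i < 4)%N -> (j < 4)%N -> forall g, B i j g = false.
Proof.
move=> i4 j4; have h3 : hfun 3 (B i j).
  exact: (@prim_lin 3 (slice (x i) th) (@prim_lin 7 th pth i) j).1.
apply: (hfun_odd0 _ h3) => // [k k4|l l4].
  have h1 : hfun 1 (slice (x k) (B i j)) by apply: (hfun_slice h3 (homog_x k)).
  apply: (hfun_mulx0 h1) => l l4; apply: (hfun_at1 (hfun_mul h1 (homog_x l) _)) => //.
  by rewrite mulr1; apply: words0.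
have h0 : hfun 0 (slice (T l) (B i j)) by apply: (hfun_slice h3 (homog_T l4)).
apply: (hfun_at1 h0); have [a [b [c q]]] := lt4_q4 l4.
by rewrite /slice expr1n mulr1 (T_q4 q) (ZT i4 j4 q).
Qed.

End LinVanishBase.

Lemma lin_vanish_words r th : (0 < r)%N -> prim (dO r.+3) th ->
  (forall z, size z = r.+3 -> letters z -> th (wp (map x z)) = false) ->
  forall i, (i < 4)%N -> forall g, th (x i * g ^+ 2) = false.
Proof.
elim: r th => // r IH th _ pth h; apply: (@lin_vanish_step (dO r.+1).*2) => [//||].
  by move: pth; congr (prim _ th); rewrite /=; lia.
move=> i j i4 j4; case: r IH pth h => [_|r IH] pth h.
  apply: (linlin_vanish15 pth) => // a b c d a4 b4 c4 d4.
  have := h [:: a; b; c; d]; rewrite /= a4 b4 c4 d4 expr1n mulr1; exact.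
move=> g; apply: (IH (slice (x i) th)) => // [|z sz lz].
  by have := (@prim_lin (dO r.+4) th pth i).
by apply: (h (i :: z)); rewrite /= ?sz ?i4.
Qed.

Lemma pair_vanish_words b th : prim (dE b.+1) th ->
  (forall z, size z = b.+1 -> pletters z -> th (wp (map xp z)) = false) ->
  forall i j k l, q4 i j k l -> forall g, th (x i * x j * g ^+ 2) = false.
Proof.
elim: b th => [|b IH] th pth h i j k l q.
  move=> g; have h0 : hfun 0 (slice (x i * x j) th) by exact: (@prim_pair 0 th pth i j).1.
  apply: (hfun_at1 h0 _ g); rewrite /slice expr1n mulr1.
  have := h [:: pr i j]; rewrite /= (pr_pairs q) xp_pr expr1n mulr1; exact.
change (prim (dE b.+1).+1.*2 th) in pth.
have p0 i' j' k' l' a b' c d g : q4 i' j' k' l' -> q4 a b' c d ->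
    th (x i' * x j' * (x a * x b' * g ^+ 2) ^+ 2) = false.
  move=> q1 q2; have := IH (slice (x i' * x j') th) (prim_pair pth i' j') _ _ _ _ _ q2 g.
  apply=> z sz lz; rewrite /slice -xp_pr; apply: (h (pr i' j' :: z)).
    by rewrite /= sz.
  by rewrite /= (pr_pairs q1).
apply: (hfun_even0 _ (prim_pair pth i j).1) => [|g|a b' c d q' g|g].
- by rewrite /= odd_double.
- exact: (even_sq0 (prim_pair pth i j)).
- exact: p0 q q'.
rewrite -(q4_X q) /slice.
have := pair_cyc pth i j k (x l * x i * x j * g ^+ 2) isT.
rewrite (_ : x i * (x l * x i * x j * g ^+ 2) = x l * x j * (x i * g) ^+ 2); last by ring.
rewrite (_ : x j * (x l * x i * x j * g ^+ 2) = x l * x i * (x j * g) ^+ 2); last by ring.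
rewrite (_ : x k * (x l * x i * x j * g ^+ 2) = x i * x j * x k * x l * g ^+ 2); last by ring.
have [q1 q2] : q4 j k i l /\ q4 i k j l by move: q; clear; elim/q4_ind: i j k l / .
have [q3 q4'] : q4 l j i k /\ q4 l i j k by move: q; clear; elim/q4_ind: i j k l / .
by rewrite (p0 _ _ _ _ _ _ _ _ _ q1 q3) (p0 _ _ _ _ _ _ _ _ _ q2 q4').
Qed.

Lemma base_vanish b th : prim (dN b.+1 0) th ->
  (forall i, (i < 4)%N -> forall g, th (x i * g ^+ 2) = false) ->
  (forall i z, (i < 4)%N -> size z = b.+1 -> pletters z -> th (wp (T i :: map xp z)) = false) ->
  forall g, th g = false.
Proof.
rewrite [dN _ _]/= -addn3 => pth lin0 h; apply: (hfun_odd0 _ pth.1) => // [|i i4].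
  by rewrite oddD odd_double.
have p0 i' a b' c d g : (i' < 4)%N -> q4 a b' c d -> th (T i' * (x a * x b' * g ^+ 2) ^+ 2) = false.
  move=> i4' q; have := @pair_vanish_words b (slice (T i') th) (prim_T pth lin0 i4') _ _ _ _ _ q g.
  by apply=> z sz lz; apply: (h i' z).
apply: (hfun_even0 _ (prim_T pth lin0 i4).1) => [|g|a b' c d q' g|g].
- by rewrite /= odd_double.
- exact: (even_sq0 (prim_T pth lin0 i4)).
- exact: (p0 _ _ _ _ _ _ i4 q').
have [j [k [l q]]] := lt4_q4 i4; rewrite -(q4_X q) /slice.
have := T_sum pth lin0 (x j * x k * x l * g ^+ 2) q; have [_ j4 k4 l4] := q4_lt q.
rewrite (_ : x i * (x j * x k * x l * g ^+ 2) = x i * x j * x k * x l * g ^+ 2); last by ring.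
rewrite (_ : x j * (x j * x k * x l * g ^+ 2) = x k * x l * (x j * g) ^+ 2); last by ring.
rewrite (_ : x k * (x j * x k * x l * g ^+ 2) = x j * x l * (x k * g) ^+ 2); last by ring.
rewrite (_ : x l * (x j * x k * x l * g ^+ 2) = x j * x k * (x l * g) ^+ 2); last by ring.
have [q1 [q2 q3]] : q4 k l i j /\ q4 j l i k /\ q4 j k i l.
  by move: q; clear; elim/q4_ind: i j k l / .
by rewrite (p0 _ _ _ _ _ _ j4 q1) (p0 _ _ _ _ _ _ k4 q2) (p0 _ _ _ _ _ _ l4 q3) !addbF.
Qed.

Lemma dN_lin_vanish b s th : prim (dN b s.+1) th ->
  forall i, (i < 4)%N -> forall g, th (x i * g ^+ 2) = false.
Proof.
move=> pth i i4 g; have [y y0 e] := dN_odd b s.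
apply: (@lin_vanish y) => //.
by move: pth; congr (prim _ th); rewrite /= e; lia.
Qed.

Lemma dN_prim_T b s th : prim (dN b s.+1) th ->
  forall i, (i < 4)%N -> prim (dN b s) (slice (T i) th).
Proof.
move=> pth i i4; have := dN_lin_vanish pth; have [y _ e] := dN_odd b s.
by move: pth; rewrite /= e -addn3 => pth /(prim_T pth); apply.
Qed.

Definition c1 (th : PR -> bool) w z := th (wp (map T w ++ map x z)).
Definition c2 (th : PR -> bool) w z := th (wp (map T w ++ map xp z)).

Lemma word_inj b s th : (1 < b)%N -> prim (dN b s) th ->
  (forall w z, size w = s -> letters w -> size z = b.+2 -> letters z -> c1 th w z = false) ->
  (forall w z, size w = s.+1 -> letters w -> size z = b -> pletters z -> c2 th w z = false) ->
  forall g, th g = false.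
Proof.
case: b => [|[|b]] // _; elim: s th => [|s IH] th pth h1 h2.
  apply: (base_vanish pth) => [|i z i4 sz lz]; last by apply: (h2 [:: i]); rewrite /= ?i4.
  apply: (@lin_vanish_words b.+1) => //; first by rewrite dO_dE.
  by move=> z sz lz; apply: (h1 [::]).
have [y _ e] := dN_odd b.+2 s.+1.
apply: (hfun_odd0 _ pth.1) => [||i i4]; first by rewrite e /= odd_double.
  exact: dN_lin_vanish pth.
apply: (IH (slice (T i) th)) => [|w z sw lw sz lz|w z sw lw sz lz].
- exact: dN_prim_T.
- by apply: (h1 (i :: w)); rewrite /= ?i4 ?sw.
- by apply: (h2 (i :: w)); rewrite /= ?i4 ?sw.
Qed.

(** * Relations between word coordinates *)

Definition wt (ms : seq PR) (g : PR) : PR := foldr (fun m p => m * p ^+ 2) g ms.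

Lemma wtE ms : wp ms = wt ms 1. Proof. by elim: ms => //= m ms ->. Qed.
Lemma wt_cat a b g : wt (a ++ b) g = wt a (wt b g). Proof. exact: foldr_cat. Qed.

Fixpoint lin_chain m (th : PR -> bool) : Prop :=
  if m is m'.+1 then
    [/\ exists M, prim (M.+1.*2 + 3) th,
        forall i, (i < 4)%N -> forall g, th (x i * g ^+ 2) = false
      & forall i, (i < 4)%N -> lin_chain m' (slice (T i) th)]
  else True.

Lemma q4_exists i j : (i < 4)%N -> (j < 4)%N -> i != j -> exists k l, q4 i j k l.
Proof.
move=> i4 j4 ij; exists (head 0%N [seq a <- iota 0 4 | (a != i) && (a != j)]),
  (last 0%N [seq a <- iota 0 4 | (a != i) && (a != j)]).
by case: i i4 ij => [|[|[|[|]]]] // _; case: j j4 => [|[|[|[|]]]].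
Qed.

Lemma T_mix m th g i j k l : lin_chain m.+1 th -> q4 i j k l ->
  th (T i * (x i * g) ^+ 2) (+) th (T j * (x j * g) ^+ 2) (+)
  th (T k * (x k * g) ^+ 2) (+) th (T l * (x l * g) ^+ 2) = false.
Proof. by move=> [[M pth] lin0 _]; apply: (T_sum pth lin0). Qed.

Lemma TT_swap m th i j g : lin_chain m.+2 th -> (i < 4)%N -> (j < 4)%N ->
  th (T i * (T j * g ^+ 2) ^+ 2) = th (T j * (T i * g ^+ 2) ^+ 2).
Proof.
move=> ch i4 j4; have [->//|/(q4_exists i4 j4) [k [l q]]] := altP (i =P j).
have [_ _ k4 l4] := q4_lt q; have [_ _ ch1] := ch.
have z a b f : (a < 4)%N -> (b < 4)%N -> th (T a * (x b * (x a * f) ^+ 2) ^+ 2) = false.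
  by move=> a4 b4; have [_ lin0 _] := ch1 a a4; apply: lin0.
have := T_mix (x k * x l * g ^+ 2) ch q.
rewrite (_ : x k * (x k * x l * g ^+ 2) = x l * (x k * g) ^+ 2); last by ring.
rewrite (_ : x l * (x k * x l * g ^+ 2) = x k * (x l * g) ^+ 2); last by ring.
rewrite (_ : x i * (x k * x l * g ^+ 2) = T j * g ^+ 2); last by rewrite (T_q4 (q4_12 q)); ring.
rewrite (_ : x j * (x k * x l * g ^+ 2) = T i * g ^+ 2); last by rewrite (T_q4 q); ring.
by rewrite (z k l) // (z l k) //; bool_cases.
Qed.

Lemma TT_sq m th g i j k l : lin_chain m.+1 th -> q4 i j k l ->
  th (T i * (T i * (x i * g) ^+ 2) ^+ 2) (+) th (T j * (T j * (x j * g) ^+ 2) ^+ 2) (+)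
  th (T k * (T k * (x k * g) ^+ 2) ^+ 2) (+) th (T l * (T l * (x l * g) ^+ 2) ^+ 2) = false.
Proof.
move=> ch q; have := T_mix (x i * x j * x k * x l * g ^+ 2) ch q.
have e a b c d : q4 a b c d -> x i * x j * x k * x l = x a * T a.
  by move=> q'; rewrite (q4_X q) -(q4_X q') (T_q4 q'); ring.
have e' a b c d : q4 a b c d -> x a * (x i * x j * x k * x l * g ^+ 2) = T a * (x a * g) ^+ 2.
  by move=> /e ->; ring.
by rewrite (e' _ _ _ _ q) (e' _ _ _ _ (q4_12 q)) (e' _ _ _ _ (q4_12 (q4_23 q)))
  (e' _ _ _ _ (q4_12 (q4_23 (q4_34 q)))).
Qed.

Lemma TT_idem m th i j g : lin_chain m.+3 th -> (i < 4)%N -> (j < 4)%N ->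
  th (T i * (T i * (T j * g ^+ 2) ^+ 2) ^+ 2) = th (T i * (T j * (T j * g ^+ 2) ^+ 2) ^+ 2).
Proof.
move=> ch i4 j4; have [->//|/(q4_exists i4 j4) [k [l q]]] := altP (i =P j).
have [_ _ k4 l4] := q4_lt q; have [_ _ ch1] := ch.
have z a b f : (a < 4)%N -> (b < 4)%N ->
    th (T a * (T a * (x b * (x a * f) ^+ 2) ^+ 2) ^+ 2) = false.
  move=> a4 b4; have [_ _ ch2] := ch1 a a4; have [_ lin0 _] := ch2 a a4; exact: lin0.
have := TT_sq (x k * x l * g ^+ 2) ch q.
rewrite (_ : x k * (x k * x l * g ^+ 2) = x l * (x k * g) ^+ 2); last by ring.
rewrite (_ : x l * (x k * x l * g ^+ 2) = x k * (x l * g) ^+ 2); last by ring.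
rewrite (_ : x i * (x k * x l * g ^+ 2) = T j * g ^+ 2); last by rewrite (T_q4 (q4_12 q)); ring.
rewrite (_ : x j * (x k * x l * g ^+ 2) = T i * g ^+ 2); last by rewrite (T_q4 q); ring.
have -> : th (T i * (T j * (T j * g ^+ 2) ^+ 2) ^+ 2) = th (T j * (T j * (T i * g ^+ 2) ^+ 2) ^+ 2).
  transitivity (th (T j * (T i * (T j * g ^+ 2) ^+ 2) ^+ 2)); first exact: TT_swap ch i4 j4.
  exact: (TT_swap g (ch1 j j4) i4 j4).
by rewrite (z k l) // (z l k) //; bool_cases.
Qed.

Lemma xx_swap N th i j g : prim N.*2.+1 th ->
  th (x i * (x j * g ^+ 2) ^+ 2) = th (x j * (x i * g ^+ 2) ^+ 2).
Proof. by move=> pth; apply: (lin_sym pth). Qed.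

Lemma xx_idem N th i j g : prim N.*2.*2.+3 th ->
  th (x i * (x i * (x j * g ^+ 2) ^+ 2) ^+ 2) = th (x i * (x j * (x j * g ^+ 2) ^+ 2) ^+ 2).
Proof.
move=> pth; have p1 : prim N.*2.+1.*2.+1 th by [].
rewrite (_ : x i * (x j * g ^+ 2) ^+ 2 = x j * (x i * x j * (g ^+ 2) ^+ 2)); last by ring.
rewrite (lin_sym p1) (_ : x i * (_ * _) = x j * (x i * g ^+ 2) ^+ 2); last by ring.
transitivity (th (x j * (x i * (x j * g ^+ 2) ^+ 2) ^+ 2)); last exact: xx_swap p1.
exact: (lin_sym (prim_lin p1 j)).
Qed.

Lemma PR_mulC (a b : PR) : a * b = b * a. Proof. exact: mulrC. Qed.

Section PairWords.
Variables (m : nat) (th : PR -> bool).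
Hypothesis pth : prim m.+1.*2 th.

Lemma pp_sq0 n i j g : m = n.+1.*2 -> th (x i * x j * (g ^+ 2) ^+ 2) = false.
Proof.
by move=> em; have := prim_pair pth i j; rewrite em => p; apply: (even_sq0 p).
Qed.

Hypothesis m_even : exists n, m = n.+1.*2.

Let sq0 i j g : th (x i * x j * (g ^+ 2) ^+ 2) = false.
Proof. by have [n] := m_even; apply: pp_sq0. Qed.
Let m0 : (0 < m)%N. Proof. by have [n ->] := m_even. Qed.

Lemma pp_share i j k g : th (x i * x j * (x i * x k * g ^+ 2) ^+ 2) =
  th (x i * x k * (x i * x j * g ^+ 2) ^+ 2).
Proof.
have := pair_cyc pth i j k (x i * g ^+ 2) m0.
rewrite (_ : x i * (x i * g ^+ 2) = (x i * g) ^+ 2); last by ring.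
rewrite sq0 (mulrCA (x j)) (mulrCA (x k)) !(mulrA (x i)).
by bool_cases.
Qed.

Lemma pp_match i j k l g :
  th (x j * x k * (x i * x l * g ^+ 2) ^+ 2) (+) th (x i * x k * (x j * x l * g ^+ 2) ^+ 2) (+)
  th (x i * x j * (x k * x l * g ^+ 2) ^+ 2) = false.
Proof. by have := pair_cyc pth i j k (x l * g ^+ 2) m0; rewrite !mulrA. Qed.

Lemma pp_disj i j k l g : th (x i * x j * (x k * x l * g ^+ 2) ^+ 2) =
  th (x k * x l * (x i * x j * g ^+ 2) ^+ 2).
Proof.
have [e em] := m_even; have := pair_six pth i j k l g em.
have := pp_match i j k l g; have := pp_match i j l k g; have := pp_match i k l j g.
have := pp_match j k l i g.
rewrite !(PR_mulC (x l) (x k)) !(PR_mulC (x l) (x i)) !(PR_mulC (x l) (x j)) !(PR_mulC (x k) (x j)).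
rewrite !(PR_mulC (x k) (x i)) !(PR_mulC (x j) (x i)).
by bool_cases.
Qed.

Lemma ppp_cyc i j k g :
  th (x j * x k * (x j * x k * (x i * g) ^+ 2) ^+ 2) (+)
  th (x i * x k * (x i * x k * (x j * g) ^+ 2) ^+ 2) (+)
  th (x i * x j * (x i * x j * (x k * g) ^+ 2) ^+ 2) = false.
Proof.
have := pair_cyc pth i j k (x i * x j * x k * g ^+ 2) m0.
rewrite (_ : x i * (x i * x j * x k * g ^+ 2) = x j * x k * (x i * g) ^+ 2); last by ring.
rewrite (_ : x j * (x i * x j * x k * g ^+ 2) = x i * x k * (x j * g) ^+ 2); last by ring.
by rewrite (_ : x k * (x i * x j * x k * g ^+ 2) = x i * x j * (x k * g) ^+ 2); last by ring.
Qed.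

Hypothesis m_even2 : exists n, m = n.+1.*2.+1.*2.

Let sq1 i j k l g : th (x i * x j * (x k * x l * (g ^+ 2) ^+ 2) ^+ 2) = false.
Proof.
have [n em] := m_even2; have := prim_pair pth i j; rewrite em => p.
exact: (even_sq0 (prim_pair p k l)).
Qed.

Lemma ppp_share i j k g :
  th (x i * x j * (x i * x j * (x i * x k * g ^+ 2) ^+ 2) ^+ 2) =
  th (x i * x k * (x i * x k * (x i * x j * g ^+ 2) ^+ 2) ^+ 2).
Proof.
have := ppp_cyc i j k (x i * g ^+ 2).
rewrite (_ : x i * (x i * g ^+ 2) = (x i * g) ^+ 2); last by ring.
rewrite sq1 (mulrCA (x j)) (mulrCA (x k)) !(mulrA (x i)).
by bool_cases.
Qed.

Lemma ppp_match i j k l g :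
  th (x j * x k * (x j * x k * (x i * x l * g ^+ 2) ^+ 2) ^+ 2) (+)
  th (x i * x k * (x i * x k * (x j * x l * g ^+ 2) ^+ 2) ^+ 2) (+)
  th (x i * x j * (x i * x j * (x k * x l * g ^+ 2) ^+ 2) ^+ 2) = false.
Proof. by have := ppp_cyc i j k (x l * g ^+ 2); rewrite !(mulrA _ (x l)). Qed.

End PairWords.

Fixpoint tp_chain m b (th : PR -> bool) : Prop :=
  if m is m'.+1 then
    [/\ exists M, prim (M.+1.*2 + 3) th,
        forall i, (i < 4)%N -> forall g, th (x i * g ^+ 2) = false
      & forall i, (i < 4)%N -> tp_chain m' b (slice (T i) th)]
  else prim (dE b) th.

Lemma tp_lin m b th : tp_chain m b th -> lin_chain m th.
Proof. by elim: m th => //= m IH th [h1 h2 h3]; split=> // i /h3/IH. Qed.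

Lemma T_pp_inc b th i j k l g : tp_chain 1 b.+1 th -> q4 i j k l ->
  th (T j * (x i * x j * g ^+ 2) ^+ 2) (+) th (T k * (x i * x k * g ^+ 2) ^+ 2) (+)
  th (T l * (x i * x l * g ^+ 2) ^+ 2) = false.
Proof.
move=> ch q; have [i4 j4 k4 l4] := q4_lt q; have := T_mix (x i * g ^+ 2) (tp_lin ch) q.
have [_ _ /(_ i i4) pth] := ch.
rewrite (_ : x i * (x i * g ^+ 2) = (x i * g) ^+ 2); last by ring.
rewrite (even_sq0 pth (x i * g) : th (T i * _) = false).
by rewrite !(mulrCA _ (x i)) !(mulrA (x i)) addFb.
Qed.

Lemma T_pp_inc2 b th i j k l g : tp_chain 2 b.+1 th -> q4 i j k l ->
  th (T j * (T j * (x i * x j * g ^+ 2) ^+ 2) ^+ 2) (+)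
  th (T k * (T k * (x i * x k * g ^+ 2) ^+ 2) ^+ 2) (+)
  th (T l * (T l * (x i * x l * g ^+ 2) ^+ 2) ^+ 2) = false.
Proof.
move=> ch q; have [i4 j4 k4 l4] := q4_lt q; have := TT_sq (x i * g ^+ 2) (tp_lin ch) q.
have [_ _ /(_ i i4) [_ _ /(_ i i4) pth]] := ch.
rewrite (_ : x i * (x i * g ^+ 2) = (x i * g) ^+ 2); last by ring.
rewrite (even_sq0 pth (x i * g) : th (T i * (T i * _) ^+ 2) = false).
by rewrite !(mulrCA _ (x i)) !(mulrA (x i)) addFb.
Qed.

(* Compare the two expressions for [th (T_i T_i^2 (x_1 x_2 x_3 x_4)^4 -)]. *)
Lemma T_pp_mixed b th i j k l g : tp_chain 2 b th -> q4 i j k l ->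
  th (T j * (T j * (x k * x l * (x i * x j * g ^+ 2) ^+ 2) ^+ 2) ^+ 2) (+)
  th (T k * (T k * (x j * x l * (x i * x k * g ^+ 2) ^+ 2) ^+ 2) ^+ 2) (+)
  th (T l * (T l * (x j * x k * (x i * x l * g ^+ 2) ^+ 2) ^+ 2) ^+ 2) =
  th (T i * (T j * (x k * x l * (x i * x j * g ^+ 2) ^+ 2) ^+ 2) ^+ 2) (+)
  th (T i * (T k * (x j * x l * (x i * x k * g ^+ 2) ^+ 2) ^+ 2) ^+ 2) (+)
  th (T i * (T l * (x j * x k * (x i * x l * g ^+ 2) ^+ 2) ^+ 2) ^+ 2).
Proof.
move=> ch q; have [i4 j4 k4 l4] := q4_lt q.
pose y := x j * x k * x l * (x i * g ^+ 2) ^+ 2.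
have := TT_sq y (tp_lin ch) q.
have ch1 : tp_chain 1 b (slice (T i) th) by have [_ _ /(_ i i4)] := ch.
have := T_mix y (tp_lin ch1) q; rewrite /slice /y.
rewrite (_ : x j * (x j * x k * x l * _) = x k * x l * (x i * x j * g ^+ 2) ^+ 2); last by ring.
rewrite (_ : x k * (x j * x k * x l * _) = x j * x l * (x i * x k * g ^+ 2) ^+ 2); last by ring.
rewrite (_ : x l * (x j * x k * x l * _) = x j * x k * (x i * x l * g ^+ 2) ^+ 2); last by ring.
by bool_cases.
Qed.

Section Words.
Variable (U : eqType) (n : nat) (L : seq U) (f : seq U -> bool).
Hypothesis f_swap : forall u i j w, size (u ++ i :: j :: w) = n ->
  all (mem L) (u ++ i :: j :: w) -> f (u ++ i :: j :: w) = f (u ++ j :: i :: w).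

Let f_front u t1 a t2 : size (u ++ t1 ++ a :: t2) = n -> all (mem L) (u ++ t1 ++ a :: t2) ->
  f (u ++ t1 ++ a :: t2) = f (u ++ a :: t1 ++ t2).
Proof.
elim/last_ind: t1 t2 => // t1 c IH t2; rewrite -!cats1 -!catA /= => sz al.
rewrite catA f_swap -?catA //; apply: IH; first by rewrite -sz !size_cat.
by move: al; rewrite !all_cat /= [(c \in _) && _]andbCA.
Qed.

Let f_perm_aux u s t : perm_eq s t -> size (u ++ t) = n -> all (mem L) (u ++ t) ->
  f (u ++ s) = f (u ++ t).
Proof.
elim: s u t => [|a s IH] u t pst sz al.
  by move: pst; rewrite perm_sym => /perm_nilP ->.
have at_ : a \in t by rewrite -(perm_mem pst) mem_head.
case/splitPr: at_ pst sz al => t1 t2 pst sz al; rewrite f_front //.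
have pst' : perm_eq s (t1 ++ t2).
  by move: pst; rewrite perm_sym -cat1s perm_catCA perm_cons perm_sym.
rewrite -!cat_rcons; apply: IH => //; first by rewrite -sz !size_cat size_rcons /=; lia.
by move: al; rewrite !all_cat all_rcons /= => /and4P [-> -> -> ->].
Qed.

Lemma word_perm s t : perm_eq s t -> size t = n -> all (mem L) t -> f s = f t.
Proof. exact: (@f_perm_aux [::]). Qed.

Lemma word_perm' s t : perm_eq s t -> size s = n -> all (mem L) s -> f s = f t.
Proof. by move=> p sz al; apply: word_perm; rewrite // -?(perm_size p) -?(perm_all _ p). Qed.

Hypothesis f_idem : forall i j w, size (i :: i :: j :: w) = n ->
  all (mem L) (i :: i :: j :: w) -> f (i :: i :: j :: w) = f (i :: j :: j :: w).

Let f_collect a s c r : size (nseq c.+1 a ++ s ++ r) = n -> all (mem L) (a :: s ++ r) ->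
  exists2 d, size (nseq d.+1 a ++ undup (filter (predC1 a) s) ++ r) = n
    & f (nseq c.+1 a ++ s ++ r) = f (nseq d.+1 a ++ undup (filter (predC1 a) s) ++ r).
Proof.
have La c' : a \in L -> all (mem L) (nseq c' a) by move=> aL; rewrite all_nseq /= aL orbT.
elim: s c r => [|y s IH] c r sz al; first by exists c.
have [aL [yL [sL rL]]] : a \in L /\ y \in L /\ all (mem L) s /\ all (mem L) r.
  by move: al; rewrite /= all_cat => /and3P [-> ->] /andP [-> ->].
have sz' : size (nseq c.+2 a ++ s ++ r) = n.
  by rewrite -sz !size_cat ?size_nseq /= ?size_cat; lia.
have al' : all (mem L) (a :: s ++ r) by rewrite /= all_cat aL sL rL.
have alc : all (mem L) (nseq c.+2 a ++ s ++ r) by rewrite all_cat La // all_cat sL rL.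
have [ya|nya] := eqVneq y a.
  rewrite (@word_perm _ (nseq c.+2 a ++ s ++ r)) //.
    by have [d sd e] := IH c.+1 r sz' al'; exists d; rewrite /= ya eqxx.
  apply/permP => Q; rewrite !count_cat /= ?count_cat ?count_nseq ya.
  by move: (nat_of_bool (Q a)) (count _ _) (count _ _) => *; clear; lia.
have [ys|nys] := boolP (y \in s).
  have cr Q := permP (perm_to_rem ys) Q.
  have s0 : (0 < size s)%N by case: (s) ys.
  have all_r : all (mem L) (rem y s) by apply/allP => z /mem_rem; apply: (allP sL).
  have e1 : f (nseq c.+1 a ++ (y :: s) ++ r) = f (y :: y :: a :: nseq c a ++ rem y s ++ r).
    apply: word_perm; first apply/permP => Q.
    - have := cr Q; rewrite !count_cat /= ?count_cat ?count_nseq => ->.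
      by move: (nat_of_bool (Q a)) (nat_of_bool (Q y)) (count _ _) (count _ _) => *; clear; lia.
    - by rewrite -sz' /= ?size_cat ?size_nseq size_rem //; move: s0; clear; lia.
    - by rewrite /= !all_cat La // all_r rL aL yL.
  have e2 : f (y :: a :: a :: nseq c a ++ rem y s ++ r) = f (nseq c.+2 a ++ s ++ r).
    apply: word_perm => //; apply/permP => Q.
    have := cr Q; rewrite !count_cat /= ?count_cat ?count_nseq => ->.
    by move: (nat_of_bool (Q a)) (nat_of_bool (Q y)) (count _ _) (count _ _) => *; clear; lia.
  have [d sd e] := IH c.+1 r sz' al'; exists d; rewrite /= nya /= mem_filter /= nya ys //.
  rewrite e1 f_idem ?e2 //; first last.
  - by rewrite /= !all_cat La // all_r rL aL yL.
  - by rewrite -sz' /= ?size_cat ?size_nseq size_rem //; move: s0; clear; lia.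
have p1 : perm_eq (nseq c.+1 a ++ (y :: s) ++ r) (nseq c.+1 a ++ s ++ y :: r).
  by rewrite perm_cat2l perm_sym -cat1s perm_catCA.
have [||d sd e] := IH c (y :: r).
- by rewrite -sz (perm_size p1).
- by rewrite /= all_cat /= aL sL yL rL.
have p2 : perm_eq (nseq d.+1 a ++ undup (filter (predC1 a) s) ++ y :: r)
    (nseq d.+1 a ++ undup (filter (predC1 a) (y :: s)) ++ r).
  rewrite /= nya /= mem_filter /= nya (negPf nys) /= -!cat_cons perm_cat2l -(cat1s y).
  by rewrite perm_catCA.
exists d; first by rewrite -sd (perm_size p2).
rewrite (word_perm' p1 sz) ?e ?(word_perm' p2 sd) //.
  rewrite all_cat La // all_cat /= yL rL !andbT; apply/allP => z.
  by rewrite mem_undup mem_filter => /andP [_ /(allP sL)].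
by rewrite all_cat La //= yL all_cat sL rL.
Qed.

Lemma word_set u v : size u = n -> size v = n -> all (mem L) u -> u =i v -> f u = f v.
Proof.
move=> su sv Lu uv; have Lv : all (mem L) v by apply/allP => z; rewrite -uv => /(allP Lu).
case: u su Lu uv => [|a u] su Lu uv.
  by case: v uv {sv Lv} => // b v /(_ b); rewrite mem_head.
have av : a \in v by rewrite -uv mem_head.
rewrite -[RHS](@word_perm (a :: rem a v) v) //; last by rewrite perm_sym perm_to_rem.
have col w : size (a :: w) = n -> all (mem L) (a :: w) ->
    exists2 d, size (nseq d.+1 a ++ undup (filter (predC1 a) w)) = n
      & f (a :: w) = f (nseq d.+1 a ++ undup (filter (predC1 a) w)).
  by move=> sw Lw; have := @f_collect a w 0 [::]; rewrite !cats0 => /(_ sw Lw).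
have [d sd ->] := col u su Lu.
have [||e se ->] := col (rem a v); first by rewrite -sv -(perm_size (perm_to_rem av)).
  by rewrite -(perm_all _ (perm_to_rem av)).
set t1 := undup (filter _ u) in sd *; set t2 := undup _ in se *.
have pt : perm_eq t1 t2.
  apply: uniq_perm; rewrite ?undup_uniq // => z; rewrite !mem_undup !mem_filter /=.
  case: eqVneq => //= nza; have := uv z; rewrite inE (negPf nza) /= => ->.
  by rewrite (perm_mem (perm_to_rem av)) inE (negPf nza).
have ed : d = e.
  by move: sd se; rewrite !size_cat ?size_nseq -/t1 -/t2 (perm_size pt); lia.
rewrite ed; apply: word_perm => //; first by rewrite perm_cat2l.
rewrite all_cat all_nseq (allP Lv a av) orbT; apply/allP => z.
by rewrite mem_undup mem_filter => /andP [_ /mem_rem /(allP Lv)].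
Qed.

End Words.

Notation L4 := (iota 0 4).

Lemma mem4 i : (i \in L4) = (i < 4)%N. Proof. by rewrite mem_iota. Qed.

Lemma letters4 w : letters w = all (mem L4) w.
Proof. by apply: eq_all => i; rewrite /= mem4. Qed.

Lemma Tword_swap th u i j w g : lin_chain (size (u ++ i :: j :: w)) th ->
  all (mem L4) (u ++ i :: j :: w) ->
  th (wt (map T (u ++ i :: j :: w)) g) = th (wt (map T (u ++ j :: i :: w)) g).
Proof.
elim: u th => [|a u IH] th /= ch; first by rewrite !mem4 => /and3P [i4 j4 _]; apply: TT_swap ch i4 j4.
by rewrite mem4 => /andP [a4]; case: ch => _ _ /(_ a a4) ch; apply: (IH (slice (T a) th)).
Qed.

Lemma Tword_idem th i j w g : lin_chain (size w).+3 th -> all (mem L4) (i :: i :: j :: w) ->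
  th (wt (map T (i :: i :: j :: w)) g) = th (wt (map T (i :: j :: j :: w)) g).
Proof. by move=> ch /=; rewrite !mem4 => /and4P [i4 _ j4 _]; apply: TT_idem ch i4 j4. Qed.

Lemma dN_chain b s th : prim (dN b s) th -> lin_chain s th.
Proof.
elim: s th => //= s IH th pth; split.
- have [y _ e] := dN_odd b s; exists y.*2; move: pth; rewrite e.
  by congr (prim _ th); lia.
- exact: (@dN_lin_vanish b s).
- by move=> i i4; apply/IH/(@dN_prim_T b s).
Qed.

Lemma dN_slices b th w : letters w -> forall m, prim (dN b (size w + m)) th ->
  prim (dN b m) (fun g => th (wt (map T w) g)).
Proof.
elim: w th => [|i w IH] th //= /andP [i4 lw] m pth.
exact: (IH (slice (T i) th) lw m (dN_prim_T pth i4)).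
Qed.

Lemma xword_swap th u i j z : prim (dO (size (u ++ i :: j :: z))) th ->
  th (wp (map x (u ++ i :: j :: z))) = th (wp (map x (u ++ j :: i :: z))).
Proof.
elim: u th => [|a u IH] th /= pth; first exact: xx_swap pth.
exact: (IH (slice (x a) th) (prim_lin pth a)).
Qed.

Lemma xword_idem th i j z : prim (dO (size z).+3) th ->
  th (wp (map x (i :: i :: j :: z))) = th (wp (map x (i :: j :: j :: z))).
Proof.
move=> pth; apply: (@xx_idem (dO (size z)).*2.+1).
by move: pth; congr (prim _ th); rewrite /=; lia.
Qed.

Lemma c1E th w z : c1 th w z = th (wt (map T w) (wp (map x z))).
Proof. by rewrite /c1 wtE wt_cat -wtE. Qed.
Lemma c2E th w z : c2 th w z = th (wt (map T w) (wp (map xp z))).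
Proof. by rewrite /c2 wtE wt_cat -wtE. Qed.

Section C1.
Variables (b s : nat) (th : PR -> bool).
Hypothesis pth : prim (dN b s) th.

Let pz w : size w = s -> letters w -> prim (dO b.+2) (fun g => th (wt (map T w) g)).
Proof. by move=> sw lw; rewrite dO_dE; apply: dN_slices => //; rewrite sw addn0. Qed.

Lemma c1_set w w' z z' : size w = s -> size w' = s -> all (mem L4) w -> w =i w' ->
  size z = b.+2 -> size z' = b.+2 -> all (mem L4) z -> z =i z' -> c1 th w z = c1 th w' z'.
Proof.
move=> sw sw' lw ew sz sz' lz ez; transitivity (c1 th w' z).
  apply: (@word_set _ s L4 (c1 th ^~ z)) => // [u i j v suv luv|i j v suv luv].
    by rewrite !c1E; apply: Tword_swap => //; rewrite suv; apply: dN_chain pth.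
  by rewrite !c1E; apply: Tword_idem => //; rewrite (suv : (size v).+3 = s); apply: dN_chain pth.
have lw' : letters w' by rewrite letters4; apply/allP => i; rewrite -ew; apply/allP.
have p' := pz sw' lw'.
apply: (@word_set _ b.+2 L4 (c1 th w')) => // [u i j v suv luv|i j v suv luv].
  by rewrite !c1E; apply: (@xword_swap (fun g => th (wt (map T w') g))); rewrite suv.
by rewrite !c1E; apply: (@xword_idem (fun g => th (wt (map T w') g))); rewrite (suv : (size v).+3 = _).
Qed.

End C1.

Lemma c1_mix_last b th w z i j k l : prim (dN b (size w).+1) th -> letters w -> q4 i j k l ->
  c1 th (rcons w i) (i :: z) (+) c1 th (rcons w j) (j :: z) (+)
  c1 th (rcons w k) (k :: z) (+) c1 th (rcons w l) (l :: z) = false.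
Proof.
move=> pth lw q; rewrite !c1E !map_rcons -!cats1 !wt_cat /=.
have p1 : prim (dN b 1) (fun g => th (wt (map T w) g)) by apply: dN_slices => //; rewrite addn1.
exact: (T_mix (m := 0) (wp (map x z) ^+ 2) (dN_chain p1) q).
Qed.

Lemma c1_mix b th w z i j k l : prim (dN b (size w).+1) th -> size z = b.+1 ->
  all (mem L4) w -> all (mem L4) z -> q4 i j k l ->
  c1 th (i :: w) (i :: z) (+) c1 th (j :: w) (j :: z) (+)
  c1 th (k :: w) (k :: z) (+) c1 th (l :: w) (l :: z) = false.
Proof.
move=> pth sz lw lz q; have [i4 j4 k4 l4] := q4_lt q.
have lw' : letters w by rewrite letters4.
have e a : (a < 4)%N -> c1 th (a :: w) (a :: z) = c1 th (rcons w a) (a :: z).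
  move=> a4; apply: (c1_set pth); rewrite ?size_rcons //= ?mem4 ?a4 ?sz // => c.
  by rewrite mem_rcons.
by rewrite !e // (c1_mix_last _ pth lw' q).
Qed.

Lemma tp_slices b th w : letters w -> forall m, tp_chain (size w + m) b th ->
  tp_chain m b (fun g => th (wt (map T w) g)).
Proof.
elim: w th => [|i w IH] th //= /andP [i4 lw] m [_ _ /(_ i i4)]; exact: (IH (slice (T i) th) lw m).
Qed.

Lemma share_ind (P : nat * nat -> nat * nat -> Prop) :
  (forall p, P p p) ->
  (forall i j k l, q4 i j k l -> P (pr i j) (pr i k)) ->
  (forall i j k l, q4 i j k l -> P (pr i j) (pr k l)) ->
  forall p q, p \in pairs -> q \in pairs -> P p q.
Proof.
move=> h0 h1 h2 p q; rewrite !inE.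
have S i j k l := h1 i j k l; have D i j k l := h2 i j k l.
case/or4P => [/eqP ->|/eqP ->|/eqP ->|/or3P [] /eqP ->];
  case/or4P => [/eqP ->|/eqP ->|/eqP ->|/or3P [] /eqP ->]; try exact: h0.
- exact: (S 0 1 2 3). - exact: (S 0 1 3 2). - exact: (S 1 0 2 3). - exact: (S 1 0 3 2). - exact: (D 0 1 2 3).
- exact: (S 0 2 1 3). - exact: (S 0 2 3 1). - exact: (S 2 0 1 3). - exact: (D 0 2 1 3). - exact: (S 2 0 3 1).
- exact: (S 0 3 1 2). - exact: (S 0 3 2 1). - exact: (D 0 3 1 2). - exact: (S 3 0 1 2). - exact: (S 3 0 2 1).
- exact: (S 1 2 0 3). - exact: (S 2 1 0 3). - exact: (D 1 2 0 3). - exact: (S 1 2 3 0). - exact: (S 2 1 3 0).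
- exact: (S 1 3 0 2). - exact: (D 1 3 0 2). - exact: (S 3 1 0 2). - exact: (S 1 3 2 0). - exact: (S 3 1 2 0).
- exact: (D 2 3 0 1). - exact: (S 2 3 0 1). - exact: (S 3 2 0 1). - exact: (S 2 3 1 0). - exact: (S 3 2 1 0).
Qed.

Lemma pword_swap th u p q z : prim (dE (size (u ++ p :: q :: z))) th ->
  pletters (u ++ p :: q :: z) ->
  th (wp (map xp (u ++ p :: q :: z))) = th (wp (map xp (u ++ q :: p :: z))).
Proof.
elim: u th => [|a u IH] th /= pth; last first.
  by case/andP=> _; apply: (IH (slice (xp a) th) (prim_pair pth a.1 a.2)).
case/and3P=> pp qp _; move: (wp _) => g; move: p q pp qp.
have ev : exists n, (dE (size z)).+1.*2 = n.+1.*2 by eexists.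
apply: share_ind => // i j k l q; rewrite !xp_pr; first exact: (pp_share pth ev).
exact: (pp_disj pth ev).
Qed.

Lemma rcons_perm (U : eqType) (i : U) w : perm_eq (i :: w) (rcons w i).
Proof. by rewrite perm_sym perm_rcons. Qed.

Section C2.
Variables (a b : nat) (th : PR -> bool).
Hypothesis ch : tp_chain a b th.

Lemma c2_perm w w' z z' : size w = a -> all (mem L4) w -> perm_eq w w' ->
  size z = b -> all (mem pairs) z -> perm_eq z z' -> c2 th w z = c2 th w' z'.
Proof.
move=> sw lw pw sz lz pz; transitivity (c2 th w' z).
  apply: (@word_perm' _ a L4 (c2 th ^~ z)) => // u i j v suv luv.
  by rewrite !c2E; apply: Tword_swap => //; rewrite suv; apply: tp_lin ch.
have lw' : letters w' by rewrite letters4 -(perm_all _ pw).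
have p' : tp_chain 0 b (fun g => th (wt (map T w') g)).
  by apply: tp_slices => //; rewrite -(perm_size pw) sw addn0.
apply: (@word_perm' _ b pairs (c2 th w')) => // u p q v suv luv.
by rewrite !c2E; apply: (@pword_swap (fun g => th (wt (map T w') g))); rewrite ?suv.
Qed.

Lemma c2_idemT i j w z : (size w).+3 = a -> all (mem L4) (i :: i :: j :: w) ->
  c2 th (i :: i :: j :: w) z = c2 th (i :: j :: j :: w) z.
Proof. by move=> sw lw; rewrite !c2E; apply: Tword_idem => //; rewrite sw; apply: tp_lin ch. Qed.

Let sl m w : letters w -> (size w + m = a)%N -> tp_chain m b (fun g => th (wt (map T w) g)).
Proof. by move=> lw e; apply: tp_slices; rewrite // e. Qed.

Let base w r : letters w -> size w = a -> r.+1 = b ->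
  prim (dE r).+1.*2 (fun g => th (wt (map T w) g)).
Proof. by move=> lw sw rb; have := sl lw (m := 0); rewrite addn0 -rb => /(_ sw). Qed.

Lemma c2_match i j k l w z : q4 i j k l -> size w = a -> all (mem L4) w -> (size z).+2 = b ->
  c2 th w (pr j k :: pr i l :: z) (+) c2 th w (pr i k :: pr j l :: z) (+)
  c2 th w (pr i j :: pr k l :: z) = false.
Proof.
rewrite -letters4 => q sw lw sz; have pth := base lw sw sz.
rewrite !c2E /= !xp_pr; apply: (pp_match pth _ i j k l (wp (map xp z))); by eexists.
Qed.

Lemma c2_share3 i j k l w z : q4 i j k l -> size w = a -> all (mem L4) w -> (size z).+3 = b ->
  c2 th w (pr i j :: pr i j :: pr i k :: z) = c2 th w (pr i k :: pr i k :: pr i j :: z).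
Proof.
rewrite -letters4 => q sw lw sz; have pth := base lw sw sz.
by rewrite !c2E /= !xp_pr; apply: (ppp_share pth); eexists.
Qed.

Lemma c2_match3 i j k l w z : q4 i j k l -> size w = a -> all (mem L4) w -> (size z).+3 = b ->
  c2 th w (pr j k :: pr j k :: pr i l :: z) (+) c2 th w (pr i k :: pr i k :: pr j l :: z) (+)
  c2 th w (pr i j :: pr i j :: pr k l :: z) = false.
Proof.
rewrite -letters4 => q sw lw sz; have pth := base lw sw sz.
by rewrite !c2E /= !xp_pr; apply: (ppp_match pth); eexists.
Qed.

Lemma c2_inc i j k l w z : q4 i j k l -> (size w).+1 = a -> all (mem L4) w ->
  (size z).+1 = b -> all (mem pairs) z ->
  c2 th (j :: w) (pr i j :: z) (+) c2 th (k :: w) (pr i k :: z) (+)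
  c2 th (l :: w) (pr i l :: z) = false.
Proof.
move=> q sw lw sz lz; have [i4 j4 k4 l4] := q4_lt q.
have [q1 q2] : q4 i k j l /\ q4 i l j k by move: q; clear; elim/q4_ind: i j k l / .
have e c p : (c < 4)%N -> p \in pairs -> c2 th (c :: w) (p :: z) = c2 th (rcons w c) (p :: z).
  by move=> c4 pp; apply: c2_perm; rewrite ?rcons_perm //= ?mem4 ?c4 ?pp.
rewrite !e ?(pr_pairs q) ?(pr_pairs q1) ?(pr_pairs q2) //.
rewrite !c2E !map_rcons -!cats1 !wt_cat /= !xp_pr.
have := sl (m := 1) (w := w); rewrite letters4 addn1 -sz => /(_ lw sw) ch1.
exact: (T_pp_inc (wp (map xp z)) ch1 q).
Qed.

Let rot2 c d w z : (c < 4)%N -> (d < 4)%N -> (size w).+2 = a -> all (mem L4) w ->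
  size z = b -> all (mem pairs) z ->
  c2 th (c :: d :: w) z = th (wt (map T w) (T c * (T d * wp (map xp z) ^+ 2) ^+ 2)).
Proof.
move=> c4 d4 sw lw sz lz; rewrite -[RHS]/(th (wt (map T w) (wt [:: T c; T d] (wp (map xp z))))).
rewrite -wt_cat -(map_cat T w [:: c; d]) -c2E; apply: c2_perm => //=; rewrite ?mem4 ?c4 ?d4 //.
by rewrite -[c :: d :: w]/([:: c; d] ++ w) perm_catC.
Qed.

Lemma c2_inc2 i j k l w z : q4 i j k l -> (size w).+2 = a -> all (mem L4) w ->
  (size z).+1 = b -> all (mem pairs) z ->
  c2 th (j :: j :: w) (pr i j :: z) (+) c2 th (k :: k :: w) (pr i k :: z) (+)
  c2 th (l :: l :: w) (pr i l :: z) = false.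
Proof.
move=> q sw lw sz lz; have [i4 j4 k4 l4] := q4_lt q.
have [q1 q2] : q4 i k j l /\ q4 i l j k by move: q; clear; elim/q4_ind: i j k l / .
rewrite !rot2 //= ?(pr_pairs q) ?(pr_pairs q1) ?(pr_pairs q2) // !xp_pr.
have := sl (m := 2) (w := w); rewrite letters4 addn2 -sz => /(_ lw sw) ch1.
exact: (T_pp_inc2 (wp (map xp z)) ch1 q).
Qed.

Lemma c2_mixed i j k l w z : q4 i j k l -> (size w).+2 = a -> all (mem L4) w ->
  (size z).+2 = b -> all (mem pairs) z ->
  c2 th (j :: j :: w) (pr k l :: pr i j :: z) (+) c2 th (k :: k :: w) (pr j l :: pr i k :: z) (+)
  c2 th (l :: l :: w) (pr j k :: pr i l :: z) =
  c2 th (i :: j :: w) (pr k l :: pr i j :: z) (+) c2 th (i :: k :: w) (pr j l :: pr i k :: z) (+)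
  c2 th (i :: l :: w) (pr j k :: pr i l :: z).
Proof.
move=> q sw lw sz lz; have [i4 j4 k4 l4] := q4_lt q.
have [q1 [q2 [q3 [q5 q6]]]] : q4 i k j l /\ q4 i l j k /\ q4 k l i j /\ q4 j l i k /\ q4 j k i l.
  by move: q; clear; elim/q4_ind: i j k l / .
rewrite !rot2 //= ?(pr_pairs q) ?(pr_pairs q1) ?(pr_pairs q2) ?(pr_pairs q3) ?(pr_pairs q5)
  ?(pr_pairs q6) // !xp_pr.
have := sl (m := 2) (w := w); rewrite letters4 addn2 => /(_ lw sw) ch1.
exact: (T_pp_mixed (wp (map xp z)) ch1 q).
Qed.

End C2.

(** * Span checking over bool *)

Section Span.
Variables (U : eqType) (F : U -> bool).

Definition xsum (r : seq U) : bool := \big[addb/false]_(p <- r) F p.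

Definition oddpart (r : seq U) := [seq p <- undup r | odd (count_mem p r)].

Lemma xsum_oddpart r : xsum r = xsum (oddpart r).
Proof.
rewrite /xsum big_filter -(big_undup_iterop_count _ _ xpredT) [RHS]big_mkcond /=.
apply: eq_bigr => p _; rewrite Monoid.iteropE; elim: (count_mem p r) => //= n ->.
by case: (odd n); case: (F p).
Qed.

Variable ps : seq U.
Hypothesis ps_uniq : uniq ps.

Definition vxor (v v' : seq bool) := [seq u.1 (+) u.2 | u <- zip v v'].
Definition ev (v : seq bool) := xsum (mask v ps).
Definition parity_vector (r : seq U) := [seq odd (count_mem p r) | p <- ps].

Lemma ev_parity_vector r : {subset r <= ps} -> ev (parity_vector r) = xsum r.
Proof.
move=> rps; rewrite /ev /parity_vector -filter_mask [RHS]xsum_oddpart /xsum; apply: perm_big.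
apply: uniq_perm => [||p]; [exact: filter_uniq|exact/filter_uniq/undup_uniq|].
rewrite !mem_filter mem_undup.
case: (boolP (odd _)) => //= od; apply/idP/idP => [_|/rps//].
by rewrite -has_pred1 has_count; case: (count _ _) od.
Qed.

Lemma ev_xor v v' : size v = size v' -> ev (vxor v v') = ev v (+) ev v'.
Proof.
rewrite /ev /vxor; elim: ps v v' => [|p q IH] v v'; first by rewrite !mask0 /xsum !big_nil.
case: v v' => [|b v] [|b' v'] //=; first by rewrite /xsum !big_nil.
case=> sz; have := IH v v' sz; rewrite /xsum; case: b; case: b' => /=; rewrite ?big_cons => ->;
  by case: (F p); do !case: (\big[_/_]_(_ <- _) _).
Qed.

End Span.

(* Echelon forms: entry [n] of [st] is, if any, the part after the leading [1]
   of a row whose leading [1] is in column [n]. *)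
Fixpoint insert_row (st : seq (option (seq bool))) (v : seq bool) :=
  match st, v with
  | Some r :: st', true :: v' => Some r :: insert_row st' (vxor v' r)
  | None :: st', true :: v' => Some v' :: st'
  | o :: st', false :: v' => o :: insert_row st' v'
  | _, _ => st
  end.

Fixpoint reduces (st : seq (option (seq bool))) (v : seq bool) :=
  match st, v with
  | Some r :: st', true :: v' => reduces st' (vxor v' r)
  | None :: _, true :: _ => false
  | _ :: st', false :: v' => reduces st' v'
  | _, _ => true
  end.

Definition echelon n rows := foldl insert_row (nseq n None) rows.

Section Echelon.
Variables (U : eqType) (F : U -> bool).

Fixpoint good (st : seq (option (seq bool))) (ps : seq U) : Prop :=
  match st, ps with
  | [::], [::] => True
  | o :: st', p :: ps' => good st' ps' /\
     (if o is Some r then size r = size ps' /\ ev F ps' r = F p else True)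
  | _, _ => False
  end.

Lemma ev_cons p (ps : seq U) b v : ev F (p :: ps) (b :: v) = (b && F p) (+) ev F ps v.
Proof. by rewrite /ev /xsum; case: b; rewrite /= ?big_cons. Qed.

Lemma insert_row_good st ps v : good st ps -> size v = size ps -> ev F ps v = false ->
  good (insert_row st v) ps.
Proof.
elim: st ps v => [|o st IH] [|p ps] [|b v] //=.
move=> [gst go] [sz]; rewrite ev_cons; case: b => /= e; last first.
  by case: o go => [r|] go /=; split=> //; apply: IH.
case: o go => [r [sr er]|_] /=; last by split=> //; split=> //; move: e; case: (F p); case: ev.
split=> //; apply: IH => //; first by rewrite size_map size_zip sz sr minnn.
by rewrite ev_xor ?sz ?sr // er; move: e; case: (F p); case: ev.
Qed.

Lemma reduces_ev st ps v : good st ps -> size v = size ps -> reduces st v -> ev F ps v = false.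
Proof.
elim: st ps v => [|o st IH] [|p ps] [|b v] //=; first by rewrite /ev /xsum big_nil.
move=> [gst go] [sz]; rewrite ev_cons; case: b => /=; last by case: o go => *; apply: IH.
case: o go => // r [sr er] red; have := IH ps (vxor v r) gst.
rewrite size_map size_zip sz sr minnn => /(_ erefl red).
by rewrite ev_xor ?sz ?sr // er; case: (F p); case: ev.
Qed.

Lemma echelonP ps rows v : (forall r, r \in rows -> size r = size ps /\ ev F ps r = false) ->
  size v = size ps -> reduces (echelon (size ps) rows) v -> ev F ps v = false.
Proof.
move=> gr; apply: reduces_ev; rewrite /echelon.
have: good (nseq (size ps) None) ps by elim: (ps) => //= p ps' ->.
elim: rows (nseq _ _) gr => //= r rows IH st gr gst; apply: IH => [r' h|].
  by apply: gr; rewrite inE h orbT.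
by have [s1 e1] := gr r (mem_head _ _); apply: insert_row_good.
Qed.

End Echelon.

(** * Idempotence for opposite pairs *)

Definition quads : seq (nat * nat * nat * nat) :=
  [:: (0, 1, 2, 3); (1, 0, 2, 3); (2, 0, 1, 3); (3, 0, 1, 2)]%N.
Definition quads12 := flatten [seq (let: (i, j, k, l) := q in
  [:: (i, j, k, l); (i, k, l, j); (i, l, j, k)]) | q <- quads].
Definition q4b (q : nat * nat * nat * nat) := let: (i, j, k, l) := q in q4 i j k l.
Definition words2 := [seq w <- [seq [:: i; j] | i <- L4, j <- L4] | sorted leq w].
Definition psorted (z : seq (nat * nat)) := sorted leq (map (index^~ pairs) z).
Definition pwords2 := [seq z <- [seq [:: p; q] | p <- pairs, q <- pairs] | psorted z].
Definition pwords3 := [seq z <- [seq p :: z | p <- pairs, z <- pwords2] | psorted z].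

Definition mono := (seq nat * seq (nat * nat))%type.

Definition normal1 (V : eqType) (L w : seq V) := flatten [seq nseq (count_mem i w) i | i <- L].
Definition normal (m : mono) : mono := (normal1 L4 m.1, normal1 pairs m.2).

Lemma normal1_perm (V : eqType) (L w : seq V) : uniq L -> all (mem L) w -> perm_eq (normal1 L w) w.
Proof.
move=> uL /allP wL; rewrite /perm_eq; apply/allP => y _ /=.
suff -> : count_mem y (normal1 L w) = ((y \in L) * count_mem y w)%N.
  by case: (boolP (y \in L)) => [|yL]; rewrite ?mul1n // eq_sym -leqn0 leqNgt -has_count has_pred1;
    apply: contra yL => /wL.
rewrite /normal1; elim: L uL {wL} => //= i L IH /andP [iL uL].
rewrite count_cat IH // count_nseq /= inE (eq_sym y); case: eqVneq => [<-|_].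
  by rewrite (negPf iL) !mul1n addn0.
by rewrite mul0n.
Qed.

Definition gen_share : seq (seq mono) := [seq (let: (i, j, k, l) := q in
   [:: (w, [:: pr i j; pr i j; pr i k]); (w, [:: pr i k; pr i k; pr i j])]) | w <- words2, q <- quads12].
Definition gen_match : seq (seq mono) := [seq (let: (i, j, k, l) := (0, 1, 2, 3)%N in
   [:: (w, [:: pr j k; pr i l; p]); (w, [:: pr i k; pr j l; p]); (w, [:: pr i j; pr k l; p])])
   | w <- words2, p <- pairs].
Definition gen_match3 : seq (seq mono) := [seq (let: (i, j, k, l) := q in
   [:: (w, [:: pr j k; pr j k; pr i l]); (w, [:: pr i k; pr i k; pr j l]);
       (w, [:: pr i j; pr i j; pr k l])]) | w <- words2, q <- [seq let: (i, j, k, l) := q in (j, k, l, i) | q <- quads]].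
Definition gen_inc : seq (seq mono) := [seq (let: (i, j, k, l) := q in
   [:: ([:: j; az.1], pr i j :: az.2); ([:: k; az.1], pr i k :: az.2);
       ([:: l; az.1], pr i l :: az.2)]) | q <- quads, az <- [seq (a, z) | a <- L4, z <- pwords2]].
Definition gen_inc2 : seq (seq mono) := [seq (let: (i, j, k, l) := q in
   [:: ([:: j; j], pr i j :: z); ([:: k; k], pr i k :: z);
       ([:: l; l], pr i l :: z)]) | q <- quads, z <- pwords2].
Definition gen_mixed : seq (seq mono) := [seq (let: (i, j, k, l) := q in
   [:: ([:: j; j], [:: pr k l; pr i j; p]); ([:: k; k], [:: pr j l; pr i k; p]);
       ([:: l; l], [:: pr j k; pr i l; p]); ([:: i; j], [:: pr k l; pr i j; p]);
       ([:: i; k], [:: pr j l; pr i k; p]); ([:: i; l], [:: pr j k; pr i l; p])])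
   | q <- quads, p <- pairs].
Definition gens := gen_share ++ gen_match ++ gen_match3 ++ gen_inc ++ gen_inc2 ++ gen_mixed.

Definition monos : seq mono := [seq (w, z) | w <- words2, z <- pwords3].
Definition goals : seq (seq mono) := [seq [:: (w, [:: pq.1; pq.1; pq.2]); (w, [:: pq.1; pq.2; pq.2])]
  | w <- words2, pq <- [seq (p, q) | p <- pairs, q <- pairs]].

Definition opposite_check :=
  let st := echelon (size monos) [seq parity_vector monos (map normal r) | r <- gens] in
  all (fun t => reduces st (parity_vector monos (map normal t))) goals.

Lemma opposite_checkP : opposite_check = true.
Proof. by vm_compute. Qed.

Lemma opposite_setup : [&& uniq words2, uniq pwords3,
  all (fun w => normal1 L4 w \in words2) [seq [:: i; j] | i <- L4, j <- L4],
  all (fun z => normal1 pairs z \in pwords3)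
    [seq p :: z | p <- pairs, z <- [seq [:: q; r] | q <- pairs, r <- pairs]] &
  all q4b (quads ++ quads12)].
Proof. by vm_compute. Qed.

Lemma uniq_monos : uniq monos.
Proof.
have /and3P [u2 u3 _] := opposite_setup.
by apply: allpairs_uniq => // -[u1 v1] [u2' v2] _ _ [-> ->].
Qed.

Section Opposite.
Variables (a b : nat) (th : PR -> bool) (w : seq nat) (z : seq (nat * nat)).
Hypothesis ch : tp_chain a b th.
Hypothesis sw : (size w).+2 = a.
Hypothesis sz : (size z).+3 = b.
Hypothesis lw : all (mem L4) w.
Hypothesis lz : all (mem pairs) z.

Let f (m : mono) := c2 th (m.1 ++ w) (m.2 ++ z).
Let valid (m : mono) := [&& size m.1 == 2, size m.2 == 3, all (mem L4) m.1 & all (mem pairs) m.2].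

Let f_normal m : valid m -> f (normal m) = f m.
Proof.
case: m => u v /and4P [/eqP /= su /eqP /= sv lu' lv'].
have lu : all (mem L4) u by []; have lv : all (mem pairs) v by [].
have pu := normal1_perm (iota_uniq 0 4) lu; have pv : perm_eq (normal1 pairs v) v.
  exact: normal1_perm.
change (c2 th (normal1 L4 u ++ w) (normal1 pairs v ++ z) = c2 th (u ++ w) (v ++ z)).
move: (normal1 L4 u) (normal1 pairs v) pu pv => u' v' pu pv.
by apply: (c2_perm ch); rewrite ?size_cat ?all_cat ?(perm_size pu) ?(perm_size pv) ?su ?sv
  ?perm_cat2r ?(perm_all _ pu) ?(perm_all _ pv) ?lu ?lv.
Qed.

Let normal_in m : valid m -> normal m \in monos.
Proof.
case: m => u v /and4P [/eqP /= su /eqP /= sv lu lv].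
have /and5P [_ _ /allP hw /allP hz _] := opposite_setup.
apply/allpairsP; exists (normal1 L4 u, normal1 pairs v); split => //.
  apply: hw; case: u su lu => [|i [|j [|]]] // _ /and3P [i4 j4 _].
  by apply/allpairsP; exists (i, j).
apply: hz; case: v sv lv => [|p [|q [|r [|]]]] // _ /and4P [pp qp rp _].
apply/allpairsP; exists (p, [:: q; r]); split => //.
by apply/allpairsP; exists (q, r).
Qed.

Let quad i j k l : (i, j, k, l) \in quads ++ quads12 -> q4 i j k l.
Proof. by have /and5P [_ _ _ _ /allP h] := opposite_setup => /h. Qed.

Let Wm u : u \in words2 -> exists i j, [/\ u = [:: i; j], i \in L4 & j \in L4].
Proof. by rewrite mem_filter => /andP [_ /allpairsP [[i j] /= [i4 j4 ->]]]; exists i, j. Qed.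

Let ok (r : seq mono) := all valid r /\ xsum f r = false.

Let x2 (u v : mono) : xsum f [:: u; v] = f u (+) f v.
Proof. by rewrite /xsum !big_cons big_nil addbF. Qed.
Let x3 (u v t : mono) : xsum f [:: u; v; t] = f u (+) f v (+) f t.
Proof. by rewrite /xsum !big_cons big_nil addbF addbA. Qed.

Let qpairs i j k l : q4 i j k l -> [/\ pr i j \in pairs, pr i k \in pairs, pr i l \in pairs &
  [/\ pr j k \in pairs, pr j l \in pairs & pr k l \in pairs]].
Proof. by elim/q4_ind: i j k l / . Qed.

Let all2w c d : c \in L4 -> d \in L4 -> all (mem L4) [:: c, d & w].
Proof. by move=> c4 d4; apply/and3P. Qed.

Let ok_share r : r \in gen_share -> ok r.
Proof.
case/allpairsP=> [[u [[[i j] k] l]] /= [/Wm [c [d [-> c4 d4]]] hq ->]].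
have q := quad (i := i) (j := j) (k := k) (l := l); rewrite mem_cat hq orbT in q.
have {}q := q isT; have [p1 p2 _ _] := qpairs q; rewrite /ok /= /valid /= p1 p2 c4 d4; split=> //.
by rewrite x2 /f /= (c2_share3 ch q (w := [:: c, d & w]) sw (all2w c4 d4) sz) addbb.
Qed.

Let ok_match r : r \in gen_match -> ok r.
Proof.
case/allpairsP=> [[u p] /= [/Wm [c [d [-> c4 d4]]] pp ->]].
have q : q4 0 1 2 3 by []; split; first by rewrite /= /valid /= c4 d4 pp.
by rewrite x3; apply: (@c2_match _ _ _ ch 0 1 2 3 [:: c, d & w] (p :: z) q sw (all2w c4 d4) sz).
Qed.

Let ok_match3 r : r \in gen_match3 -> ok r.
Proof.
case/allpairsP=> [[u [[[i j] k] l]] /= [/Wm [c [d [-> c4 d4]]] hq ->]].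
have q : q4 i j k l by move: hq; rewrite !inE => /or4P [] /eqP [-> -> -> ->].
have [p1 p2 p3 [p4 p5 p6]] := qpairs q.
rewrite /ok /= /valid /= p1 p2 p3 p4 p5 p6 c4 d4; split=> //.
by rewrite x3 /f /= (c2_match3 ch q (w := [:: c, d & w]) sw (all2w c4 d4) sz).
Qed.

Let pw2 v : v \in pwords2 -> exists p r, [/\ v = [:: p; r], p \in pairs & r \in pairs].
Proof. by rewrite mem_filter => /andP [_ /allpairsP [[p r] /= [pp rp ->]]]; exists p, r. Qed.

Let ok_inc r : r \in gen_inc -> ok r.
Proof.
case/allpairsP=> [[[[[i j] k] l] az] [hq' haz ->]].
case/allpairsP: haz => [[c v] [c4' hv' ->]].
have hq : (i, j, k, l) \in quads := hq'.
have c4 : c \in L4 := c4'; have {hv'} hv : v \in pwords2 := hv'.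
rewrite ![(_, _).1]/= ![(_, _).2]/= {hq' c4'}.
have [p [t [-> pp tp]]] := pw2 hv.
have q := quad (i := i) (j := j) (k := k) (l := l); rewrite mem_cat hq in q.
have {}q := q isT; have [p1 p2 p3 _] := qpairs q; have [i4 j4 k4 l4] := q4_lt q.
rewrite /ok /= /valid /= p1 p2 p3 pp tp c4 !mem4 j4 k4 l4; split=> //.
rewrite x3; apply: (c2_inc ch q (w := c :: w) (z := [:: p, t & z]) sw _ sz); first by apply/andP.
by apply/and3P.
Qed.

Let ok_inc2 r : r \in gen_inc2 -> ok r.
Proof.
case/allpairsP=> [[[[[i j] k] l] v] /= [hq hv ->]]; have [p [t [-> pp tp]]] := pw2 hv.
have q := quad (i := i) (j := j) (k := k) (l := l); rewrite mem_cat hq in q.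
have {}q := q isT; have [p1 p2 p3 _] := qpairs q; have [i4 j4 k4 l4] := q4_lt q.
rewrite /ok /= /valid /= p1 p2 p3 pp tp !mem4 j4 k4 l4; split=> //.
by rewrite x3; apply: (c2_inc2 ch q (w := w) (z := [:: p, t & z]) sw lw sz); apply/and3P.
Qed.

Let ok_mixed r : r \in gen_mixed -> ok r.
Proof.
case/allpairsP=> [[[[[i j] k] l] p] /= [hq pp ->]].
have q := quad (i := i) (j := j) (k := k) (l := l); rewrite mem_cat hq in q.
have {}q := q isT; have [p1 p2 p3 [p4 p5 p6]] := qpairs q; have [i4 j4 k4 l4] := q4_lt q.
rewrite /ok /= /valid /= p1 p2 p3 p4 p5 p6 pp !mem4 i4 j4 k4 l4; split=> //.
have lpz : all (mem pairs) (p :: z) by apply/andP.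
have := c2_mixed ch q (w := w) (z := p :: z) sw lw sz lpz.
rewrite /xsum !big_cons big_nil /f /= addbF => e.
by rewrite !addbA e -!addbA; move: (c2 _ _ _) (c2 _ _ _) (c2 _ _ _) => [] [] [].
Qed.

Let gens_ok r : r \in gens -> ok r.
Proof.
rewrite /gens (mem_cat r gen_share) => /orP [|]; first exact: ok_share.
rewrite (mem_cat r gen_match) => /orP [|]; first exact: ok_match.
rewrite (mem_cat r gen_match3) => /orP [|]; first exact: ok_match3.
rewrite (mem_cat r gen_inc) => /orP [|]; first exact: ok_inc.
rewrite (mem_cat r gen_inc2) => /orP [|]; first exact: ok_inc2.
exact: ok_mixed.
Qed.

Let ev_normal r : all valid r -> ev f monos (parity_vector monos (map normal r)) = xsum f r.
Proof.
move=> /allP vr; have sub : {subset map normal r <= monos}.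
  by move=> m /mapP [m' /vr vm' ->]; apply: normal_in.
rewrite (ev_parity_vector f uniq_monos sub) /xsum big_map.
by apply: eq_big_seq => m /vr vm; apply: f_normal.
Qed.

Lemma c2_idemP_le i j p q : i \in L4 -> j \in L4 -> p \in pairs -> q \in pairs -> (i <= j)%N ->
  c2 th [:: i, j & w] [:: p, p, q & z] = c2 th [:: i, j & w] [:: p, q, q & z].
Proof.
move=> i4 j4 pp qp ij.
pose r : seq mono := [:: ([:: i; j], [:: p; p; q]); ([:: i; j], [:: p; q; q])].
have vr : all valid r.
  have v1 p1 q1 r1 : p1 \in pairs -> q1 \in pairs -> r1 \in pairs -> valid ([:: i; j], [:: p1; q1; r1]).
    by move=> *; apply/and4P; split=> //; [apply/and3P|apply/and4P].
  by apply/and3P; split; [exact: v1|exact: v1|].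
have rg : r \in goals.
  apply/allpairsP; exists ([:: i; j], (p, q)); split; last by [].
    by rewrite mem_filter; apply/andP; split; [rewrite /= ij|apply/allpairsP; exists (i, j)].
  by apply/allpairsP; exists (p, q).
have chk := allP opposite_checkP r rg.
have h : ev f monos (parity_vector monos (map normal r)) = false.
  refine (@echelonP _ f monos _ _ _ _ chk); last by rewrite size_map.
  move=> v /mapP [g /gens_ok [vg eg] ->]; split; first by rewrite size_map.
  by rewrite (ev_normal vg).
by move: h; rewrite (ev_normal vr) x2 /f /=; do 2!case: (c2 _ _ _).
Qed.

End Opposite.

Lemma c2_idemP a b th w z i j p q : tp_chain a b th -> (size w).+2 = a -> (size z).+3 = b ->
  all (mem L4) w -> all (mem pairs) z -> i \in L4 -> j \in L4 -> p \in pairs -> q \in pairs ->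
  c2 th [:: i, j & w] [:: p, p, q & z] = c2 th [:: i, j & w] [:: p, q, q & z].
Proof.
move=> ch sw sz lw lz i4 j4 pp qp.
have [ij|/ltnW ji] := leqP i j; first exact: (c2_idemP_le ch sw sz lw lz i4 j4 pp qp ij).
have lij : all (mem L4) [:: i, j & w] by apply/and3P.
have e y : y \in pairs -> c2 th [:: i, j & w] [:: p, y, q & z] = c2 th [:: j, i & w] [:: p, y, q & z].
  move=> yp; have lv : all (mem pairs) [:: p, y, q & z] by apply/and4P.
  apply: (c2_perm (w := [:: i, j & w]) (z := [:: p, y, q & z]) ch sw lij _ sz lv (perm_refl _)).
  by rewrite -[[:: i, j & w]]/([:: i] ++ [:: j] ++ w) perm_catCA.
by rewrite (e p pp) (e q qp); apply: (c2_idemP_le ch sw sz lw lz j4 i4 pp qp ji).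
Qed.

Lemma c2_set a b th w w' z z' : tp_chain a b th -> (1 < a)%N -> (2 < b)%N ->
  size w = a -> size w' = a -> all (mem L4) w -> w =i w' ->
  size z = b -> size z' = b -> all (mem pairs) z -> z =i z' -> c2 th w z = c2 th w' z'.
Proof.
move=> ch a1 b2 sw sw' lw ew sz sz' lz ez; transitivity (c2 th w' z).
  apply: (@word_set _ a L4 (c2 th ^~ z)) => // [u i j v suv luv|i j v suv luv].
    by rewrite !c2E; apply: Tword_swap => //; rewrite suv; apply: tp_lin ch.
  exact: (c2_idemT ch).
have lw' : all (mem L4) w' by apply/allP => i; rewrite -ew; apply/allP.
apply: (@word_set _ b pairs (c2 th w')) => // [u i j v suv luv|p q v suv luv].
  apply: (c2_perm ch) => //; rewrite perm_cat2l.
  by rewrite -[[:: i, j & v]]/([:: i] ++ [:: j] ++ v) perm_catCA.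
case: w' sw' lw' {ew} => [|i [|j w0]] sw' lw'; [by rewrite -sw' in a1|by rewrite -sw' in a1|].
case/and3P: lw' => i4 j4 l0; case/and4P: luv => pp _ qp lv.
exact: (c2_idemP ch sw' suv l0 lv i4 j4 pp qp).
Qed.

(** * Functions of subsets as bit codes *)

Section Codes.
Variables (A B : eqType) (LA : seq A) (LB : seq B).

Definition code (w : seq A) (z : seq B) : seq bool :=
  [seq i \in w | i <- LA] ++ [seq p \in z | p <- LB].

Lemma code_eq w w' z z' : w =i w' -> z =i z' -> code w z = code w' z'.
Proof. by move=> e e'; congr (_ ++ _); apply: eq_map => i; rewrite ?e ?e'. Qed.

Definition pad (U : Type) n (w : seq U) := if w is i :: _ then w ++ nseq (n - size w) i else [::].

Lemma mem_pad (U : eqType) n (w : seq U) : pad n w =i w.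
Proof.
case: w => // i w j; rewrite mem_cat mem_nseq inE.
by case: (j == i); rewrite ?andbF ?orbF.
Qed.

Lemma size_pad (U : eqType) n (w : seq U) : (0 < size w)%N -> (size w <= n)%N -> size (pad n w) = n.
Proof. by case: w => // i w _ h; rewrite size_cat size_nseq subnKC. Qed.

Lemma all_pad (U : eqType) n (w : seq U) P : all P w -> all P (pad n w).
Proof. by move=> /allP h; apply/allP => i; rewrite mem_pad => /h. Qed.

Variables (a b : nat) (f : seq A -> seq B -> bool).
Hypothesis f_set : forall w w' z z', size w = a -> size w' = a -> all (mem LA) w -> w =i w' ->
  size z = b -> size z' = b -> all (mem LB) z -> z =i z' -> f w z = f w' z'.
Hypotheses (uLA : uniq LA) (uLB : uniq LB) (a0 : (0 < a)%N) (b0 : (0 < b)%N).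

Definition setfun (c : seq bool) : bool :=
  f (pad a (mask (take (size LA) c) LA)) (pad b (mask (drop (size LA) c) LB)).

Let filt (U : eqType) (L w : seq U) n : uniq L -> size w = n -> (0 < n)%N -> all (mem L) w ->
  [/\ filter (mem w) L =i w & size (pad n (filter (mem w) L)) = n].
Proof.
move=> uL sw n0 /allP wL; have e : filter (mem w) L =i w.
  by move=> i; rewrite mem_filter /=; case: (boolP (i \in w)) => //= /wL.
split=> //; apply: size_pad.
  rewrite lt0n size_eq0; apply/eqP => F0; move: e sw n0; rewrite F0; case: w {wL F0} => [_ <-//|i w].
  by move/(_ i); rewrite mem_head.
by rewrite -sw; apply: uniq_leq_size; [apply: filter_uniq|move=> i; rewrite e].
Qed.

Lemma setfun_code w z : size w = a -> size z = b -> all (mem LA) w -> all (mem LB) z ->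
  setfun (code w z) = f w z.
Proof.
move=> sw sz lw lz; rewrite /setfun /code.
rewrite take_size_cat ?size_map // drop_size_cat ?size_map // -!filter_mask.
have [e1 s1] := filt uLA sw a0 lw; have [e2 s2] := filt uLB sz b0 lz.
by symmetry; apply: f_set => // i; rewrite mem_pad ?e1 ?e2.
Qed.

End Codes.

Definition monoc (c p : seq bool) := all2 (fun x y => x ==> y) p c.

Fixpoint combs (U : Type) k (L : seq U) : seq (seq U) :=
  match k, L with
  | 0, _ => [:: [::]]
  | k'.+1, [::] => [::]
  | k'.+1, i :: L' => map (cons i) (combs k' L') ++ combs k L'
  end.

Definition subs (U : Type) lo hi (L : seq U) := flatten [seq combs k L | k <- iota lo (hi.+1 - lo)].

Lemma combsP (U : eqType) k (L s : seq U) : s \in combs k L -> size s = k /\ all (mem L) s.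
Proof.
elim: L k s => [|i L IH] [|k] s //=; rewrite ?inE; try by move/eqP ->.
rewrite mem_cat => /orP [/mapP [t /IH [<- lt] ->]|/IH [-> ls]] /=; split=> //.
  by rewrite inE eqxx /=; apply: sub_all lt => j /= jL; rewrite inE jL orbT.
by apply: sub_all ls => j /= jL; rewrite inE jL orbT.
Qed.

Lemma mem_combs (U : eqType) (L s : seq U) : subseq s L -> s \in combs (size s) L.
Proof.
elim: L s => [|i L IH] [|j s] //=.
case: eqP => [->|_] h; rewrite mem_cat; last by rewrite IH ?orbT.
by rewrite map_f // IH.
Qed.

Lemma subsP (U : eqType) lo hi (L s : seq U) : s \in subs lo hi L ->
  [/\ (lo <= size s)%N, (size s <= hi)%N & all (mem L) s].
Proof.
case/flattenP => cs /mapP [k]; rewrite mem_iota => hk -> /combsP [-> ->]; split=> //; lia.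
Qed.

Lemma mem_subs (U : eqType) lo hi (L s : seq U) : subseq s L -> (lo <= size s <= hi)%N ->
  s \in subs lo hi L.
Proof.
move=> sub hs; apply/flattenP; exists (combs (size s) L); last exact: mem_combs.
by apply: map_f; rewrite mem_iota; lia.
Qed.

(** * Propagation of zeros *)

Inductive trie := Leaf of bool | Node of trie & trie.

Fixpoint tget t (c : seq bool) :=
  match t, c with
  | Leaf b, _ => b
  | Node l r, x :: c' => tget (if x then r else l) c'
  | Node _ _, [::] => false
  end.

Fixpoint tput (c : seq bool) t :=
  if c is x :: c' then
    let: (l, r) := if t is Node l r then (l, r) else (t, t) in
    if x then Node l (tput c' r) else Node (tput c' l) r
  else Leaf true.

Lemma tget_put c d t : size c = size d -> tget (tput c t) d -> c = d \/ tget t d.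
Proof.
elim: c d t => [|x c IH] [|y d] t //=; first by left.
move=> [sz]; case: t => [b|l r]; case: x => /=; case: y => /=; try by right.
all: by case/(IH _ _ sz) => [->|h]; [left|right].
Qed.

Definition propagate1 (s : trie * seq (seq (seq bool))) (rel : seq (seq bool)) :=
  let: (t, rest) := s in
  match [seq p <- rel | ~~ tget t p] with
  | [::] => s
  | [:: p] => (tput p t, rest)
  | r => (t, r :: rest)
  end.

Fixpoint propagate n rels t :=
  if n is n'.+1 then
    let: (t', rest) := foldl propagate1 (t, [::]) rels in propagate n' rest t'
  else t.

Section Propagation.
Variables (N : nat) (V : seq bool -> bool).

Let known t := forall p, size p = N -> tget t p -> V p = false.
Let rel_ok r := all (fun p => size p == N) r /\ xsum V r = false.

Lemma known_put t p : known t -> size p = N -> V p = false -> known (tput p t).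
Proof. by move=> kt sp vp d sd /tget_put [|<-//|/kt]; [rewrite sp|apply]. Qed.

Lemma oddpart_ok r : rel_ok r -> rel_ok (oddpart r).
Proof.
move=> [/allP sr vr]; split; last by rewrite -xsum_oddpart.
by apply/allP => p; rewrite mem_filter mem_undup => /andP [_ /sr].
Qed.

Lemma propagate1_ok s r : known s.1 -> (forall r', r' \in s.2 -> rel_ok r') -> rel_ok r ->
  known (propagate1 s r).1 /\ (forall r', r' \in (propagate1 s r).2 -> rel_ok r').
Proof.
case: s => t rest /= kt okr [/allP sr vr].
have : rel_ok [seq p <- r | ~~ tget t p].
  split; first by apply/allP => p; rewrite mem_filter => /andP [_ /sr].
  rewrite -vr /xsum [RHS](bigID (tget t)) /= [X in X (+) _]big_seq_cond.
  rewrite [X in X (+) _]big1 ?big_filter // => p /andP [pr tp].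
  by apply: kt => //; apply/eqP/sr.
case: [seq _ <- _ | _] => [|p [|q u]] [/= su vu]; first by split.
  split=> //=; apply: known_put => //; first by apply/eqP; case/andP: su.
  by move: vu; rewrite /xsum big_seq1.
by split=> //= r'; rewrite inE => /orP [/eqP ->|/okr].
Qed.

Lemma propagate_known n rels t : known t -> (forall r, r \in rels -> rel_ok r) ->
  known (propagate n rels t).
Proof.
elim: n rels t => //= n IH rels t kt ok.
have: known (foldl propagate1 (t, [::]) rels).1 /\
      (forall r, r \in (foldl propagate1 (t, [::]) rels).2 -> rel_ok r); last first.
  by case: foldl => t' rest /= [kt' ok']; apply: IH.
have: forall r, r \in ((t, [::]) : trie * seq (seq (seq bool))).2 -> rel_ok r by [].
move: kt; rewrite -[t in known t]/((t, [::] : seq (seq (seq bool))).1).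
elim: rels (t, [::]) ok => //= r rels IHr s ok ks os.
have [k1 o1] := propagate1_ok ks os (ok r (mem_head _ _)).
by apply: IHr => // r' h; apply: ok; rewrite inE h orbT.
Qed.

End Propagation.

(* Gauss-Jordan on the matrix [monoc c p] with rows [p] and columns [c].
   It selects a maximal independent list of rows and, for each of them, a list
   of columns whose sum is dual to it; only the outcome is verified. *)
Definition gj_entry := (nat * seq bool * seq bool)%type.

Definition gj_step (flags : seq (seq bool)) (sb : seq gj_entry * seq (seq bool)) (p : seq bool) :=
  let: (st, basis) := sb in
  let u0 := [seq i == size basis | i <- iota 0 (size flags)] in
  let: (v, u) := foldl (fun (vu : seq bool * seq bool) (e : gj_entry) =>
      if nth false vu.1 e.1.1 then (vxor vu.1 e.1.2, vxor vu.2 e.2) else vu)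
    ([seq monoc c p | c <- flags], u0) st in
  if has id v then
    let col := find id v in
    (rcons [seq (if nth false e.1.2 col then (e.1.1, vxor e.1.2 v, vxor e.2 u) else e)
           | e <- st] (col, v, u), rcons basis p)
  else sb.

Definition duals flags ps : seq (seq bool * seq (seq bool)) :=
  let: (st, basis) := foldl (gj_step flags) ([::], [::]) ps in
  [seq (nth [::] basis n,
        [seq nth [::] flags e.1.1 | e <- [seq e <- st | nth false e.2 n]])
  | n <- iota 0 (size basis)].

Definition xfold (U : Type) (F : U -> bool) r := foldr (fun p acc => F p (+) acc) false r.

Lemma xfoldE (U : eqType) (F : U -> bool) r : xfold F r = xsum F r.
Proof. by elim: r => [|p r IH]; rewrite /xsum ?big_nil ?big_cons //= IH. Qed.

Definition dual_check (flags : seq (seq bool)) (ds : seq (seq bool * seq (seq bool))) :=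
  uniq (map fst ds) &&
  all (fun d => all (fun c => c \in flags) d.2 &&
        all (fun p => xfold (monoc^~ p.1) d.2 == (d.1 == p.1)) ds) ds.

Lemma dual_solve flags ds V : dual_check flags ds ->
  exists2 bl, {subset bl <= flags} & forall d, d \in ds -> V d.1 = xsum (monoc^~ d.1) bl.
Proof.
case/andP=> ud /allP chk; exists (flatten [seq d.2 | d <- [seq d <- ds | V d.1]]).
  move=> c /flattenP [s /mapP [d]]; rewrite mem_filter => /andP [_ /chk /andP [/allP h _]] -> /h.
  exact.
move=> p pds; rewrite /xsum big_flatten big_map big_filter.
transitivity (\big[addb/false]_(m <- map fst ds) (V m && (m == p.1))).
  rewrite (bigD1_seq p.1) ?map_f //= eqxx andbT big1 ?addbF // => m /negPf ->.
  exact: andbF.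
rewrite big_map [RHS]big_mkcond /= big_seq [RHS]big_seq; apply: eq_bigr => d /chk.
case/andP=> _ /allP /(_ p pds) /eqP <-; rewrite xfoldE.
by case: (V _).
Qed.

Section FlagSpan.
Variables (N : nat) (flags : seq (seq bool)) (ds : seq (seq bool * seq (seq bool))).
Variables (rels : seq (seq (seq bool))) (ps : seq (seq bool)).
Hypothesis dual_ok : dual_check flags ds.
Hypothesis flag_rels : forall c r, c \in flags -> r \in rels -> xsum (monoc c) r = false.

Definition span_check n := [&& all (all (fun p => size p == N)) rels,
   all (fun d => size d.1 == N) ds, all (fun p => size p == N) ps &
   all (tget (propagate n (map (@oddpart _) rels) (foldr tput (Leaf false) (map fst ds)))) ps].

Lemma flag_span n V : span_check n -> (forall r, r \in rels -> xsum V r = false) ->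
  exists2 bl, {subset bl <= flags} & forall p, p \in ps -> V p = xsum (monoc^~ p) bl.
Proof.
case/and4P=> sr sd /allP sp /allP prop relV.
have [bl blf blV] := dual_solve V dual_ok; exists bl => // p pps.
pose V' q := V q (+) xsum (monoc^~ q) bl.
suff : V' p = false by rewrite /V'; case: (V p) (xsum _ _) => [] [].
have relV' r : r \in rels -> xsum V' r = false.
  move=> rr; rewrite /xsum big_split /= (relV r rr : \big[_/_]_(_ <- _) _ = _) /=.
  rewrite exchange_big /= big_seq big1 // => c /blf cf; exact: flag_rels.
apply: (@propagate_known N V' n _ _ _ _ p _ (prop p pps)); last by apply/eqP/sp.
  2: move=> r /mapP [r' rr' ->]; apply: oddpart_ok; split; last exact: relV'.
  2: exact: (allP sr).
have dsV d : d \in ds -> V' d.1 = false by move=> /blV e; rewrite /V' e addbb.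
elim: (ds) sd dsV => [|d ds' IH] /=; first by move=> _ _ q _; case: q.
case/andP=> /eqP s1 s2 dsV; apply: known_put => //; first last.
- by apply: dsV; rewrite mem_head.
- by apply: IH => // d' h; apply: dsV; rewrite inE h orbT.
Qed.

End FlagSpan.

Definition bit (U : eqType) (L : seq U) (h : seq bool) i := nth false h (index i L).

Lemma monoc_code (A B : eqType) (LA : seq A) (LB : seq B) (h : seq bool) (v : seq bool) w z :
  uniq LA -> uniq LB -> size h = size LA -> size v = size LB -> all (mem LA) w -> all (mem LB) z ->
  monoc (h ++ v) (code LA LB w z) =
  all (bit LA h) w && all (bit LB v) z.
Proof.
have aux (U : eqType) (L u : seq U) g : uniq L -> size g = size L -> all (mem L) u ->
   all2 (fun x y => x ==> y) [seq i \in u | i <- L] g = all (bit L g) u.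
  move=> uL sg /allP lu; pose G := bit L g; rewrite -/G.
  have -> : g = [seq G i | i <- L].
    apply: (@eq_from_nth _ false); rewrite ?size_map // => n; rewrite sg => nL.
    case: L uL sg lu @G nL => // i0 L uL sg lu G nL.
    by rewrite (nth_map i0) // /G /bit index_uniq.
  rewrite all2E !size_map eqxx /= zip_map all_map; apply/allP/allP => H i.
    by move=> iu; have := H i (lu i iu); rewrite /= iu.
  by move=> iL /=; apply/implyP; apply: H.
move=> uA uB sh sv lw lz; rewrite /monoc /code all2E !size_cat !size_map sh sv eqxx /=.
rewrite zip_cat ?size_map // all_cat; congr (_ && _).
  by rewrite -aux // all2E size_map sh eqxx.
by rewrite -aux // all2E size_map sv eqxx.
Qed.

(** * The two families of flags *)

Fixpoint bitvecs n : seq (seq bool) :=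
  if n is n'.+1 then [seq b :: v | b <- [:: false; true], v <- bitvecs n'] else [:: [::]].

Definition xor_over (r : seq nat) (F : nat -> bool) := foldr (fun i acc => F i (+) acc) false r.

(* A flag of the first kind is a plane [h] and a point [v] on it, one of the
   second kind is a plane [h] and a line [q] in it, in Plucker coordinates. *)
Definition on_point (h v : seq bool) := ~~ xor_over L4 (fun i => bit L4 h i && bit L4 v i).
Definition on_line (h q : seq bool) :=
  all (fun i => ~~ xor_over [seq j <- L4 | j != i] (fun j => bit L4 h j && bit pairs q (pr i j))) L4.
Definition plucker (q : seq bool) :=
  ~~ [&& bit pairs q (pr 0 1) & bit pairs q (pr 2 3)] (+)
     [&& bit pairs q (pr 0 2) & bit pairs q (pr 1 3)] (+)
     [&& bit pairs q (pr 0 3) & bit pairs q (pr 1 2)].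

Definition flags1 := [seq hv.1 ++ hv.2 | hv <- [seq (h, v) | h <- bitvecs 4, v <- bitvecs 4]
  & [&& has id hv.1, has id hv.2 & on_point hv.1 hv.2]].
Definition flags2 := [seq hq.1 ++ hq.2 | hq <- [seq (h, q) | h <- bitvecs 4, q <- bitvecs 6]
  & [&& has id hq.1, has id hq.2, plucker hq.2 & on_line hq.1 hq.2]].

Notation code1 := (code L4 L4).
Notation code2 := (code L4 pairs).

Definition ps1 s := [seq code1 w z | w <- subs 1 s L4, z <- subs 1 4 L4].
Definition rels1 s := [seq [seq code1 (i :: w) (i :: z) | i <- L4]
  | w <- subs (s != 1) s.-1 L4, z <- subs 1 4 L4].
Definition duals1 := duals flags1
  [seq code1 wz.1 wz.2 | wz <- [seq (w, z) | w <- subs 1 3 L4, z <- subs 1 4 L4]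
                       & head 0 wz.2 \notin wz.1].

Definition ps2 a b := [seq code2 w z | w <- subs 1 a L4, z <- subs 1 b pairs].
Definition rel_inc i w z := [seq code2 (j :: w) (pr i j :: z) | j <- L4 & j != i].
Definition rels2 a b :=
  [seq rel_inc wi.2 wi.1 z | wi <- [seq (w, i) | w <- subs (a != 2) a.-1 L4, i <- L4],
                             z <- subs 1 b.-1 pairs] ++
  [seq flatten [seq rel_inc i [:: m] (pr i m :: z) | m <- L4 & m != i] | i <- L4, z <- subs 1 b.-2 pairs] ++
  [seq [:: code2 w [:: pr 0 1, pr 2 3 & z]; code2 w [:: pr 0 2, pr 1 3 & z];
           code2 w [:: pr 0 3, pr 1 2 & z]] | w <- subs 1 a L4, z <- subs 1 b.-2 pairs].
Definition duals2 := duals flags2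
  (flatten [seq [seq code2 w z | w <- combs kl.1 L4, z <- combs kl.2 pairs]
           | kl <- [seq (k, l) | k <- [:: 1; 2], l <- [:: 1; 2; 3]]]).

Lemma duals1_check : dual_check flags1 duals1. Proof. by vm_compute. Qed.
Lemma duals2_check : dual_check flags2 duals2. Proof. by vm_compute. Qed.

Definition duals1_le s := [seq d <- duals1 | count id (take 4 d.1) <= s]%N.

Lemma span1_check s : s \in [:: 1; 2; 3; 4]%N -> span_check 8 (duals1_le s) (rels1 s) (ps1 s) 20.
Proof.
by rewrite !inE => /or4P [] /eqP ->; vm_compute.
Qed.

Lemma span2_check a b : a \in [:: 2; 3; 4]%N -> b \in [:: 3; 4; 5; 6]%N ->
  span_check 10 duals2 (rels2 a b) (ps2 a b) 20.
Proof.
by rewrite !inE => /or3P [] /eqP -> /or4P [] /eqP ->; vm_compute.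
Qed.

Lemma dual_check_filter flags ds (P : pred (seq bool)) :
  dual_check flags ds -> dual_check flags [seq d <- ds | P d.1].
Proof.
case/andP=> ud /allP chk; apply/andP; split.
  by rewrite -filter_map filter_uniq.
apply/allP => d; rewrite mem_filter => /andP [_ /chk /andP [-> /allP h]] /=.
by apply/allP => p; rewrite mem_filter => /andP [_ /h].
Qed.

Lemma bitvecs_size n v : v \in bitvecs n -> size v = n.
Proof. by elim: n v => [|n IH] v; [rewrite inE => /eqP ->|case/allpairsP=> [[b u] [_ /IH <- ->]]]. Qed.

Lemma flags1P c : c \in flags1 -> exists h v,
  [/\ c = h ++ v, size h = 4%N, size v = 4%N, on_point h v & has id h && has id v].
Proof.
case/mapP=> hv; rewrite mem_filter => /andP [/and3P [hh hw on]] /allpairsP [[h v] [sh sw e]] ->.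
rewrite e in hh hw on *; exists h, v.
by rewrite hh hw (bitvecs_size sh) (bitvecs_size sw).
Qed.

Lemma flags2P c : c \in flags2 -> exists h q,
  [/\ c = h ++ q, size h = 4%N, size q = 6%N, on_line h q & [&& has id h, has id q & plucker q]].
Proof.
case/mapP=> hq; rewrite mem_filter => /andP [/and4P [hh hw pl on]] /allpairsP [[h q] [sh sw e]] ->.
rewrite e in hh hw on pl *; exists h, q.
by rewrite hh hw pl (bitvecs_size sh) (bitvecs_size sw).
Qed.

Lemma xsum_map (U V : eqType) (F : U -> bool) (G : V -> U) r :
  xsum F (map G r) = xsum (F \o G) r.
Proof. by rewrite /xsum big_map. Qed.

Lemma xsum_flatten (U : eqType) (F : U -> bool) rs :
  (forall r, r \in rs -> xsum F r = false) -> xsum F (flatten rs) = false.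
Proof. by move=> h; rewrite /xsum big_flatten /= big_seq big1. Qed.

Lemma xor_overE r F K : \big[addb/false]_(i <- r) (F i && K) = xor_over r F && K.
Proof.
elim: r => [|i r IH]; first by rewrite big_nil.
by rewrite big_cons {}IH /=; case: (F i) (xor_over r F) K => [] [] [].
Qed.

Lemma flags1_rels s c r : c \in flags1 -> r \in rels1 s -> xsum (monoc c) r = false.
Proof.
move=> /flags1P [h [v [-> sh sv on _]]] /allpairsP [[w z] [/subsP [_ _ lw] /subsP [_ _ lz] ->]].
rewrite xsum_map /xsum big_seq.
rewrite (eq_bigr (fun i => (bit L4 h i && bit L4 v i) && (all (bit L4 h) w && all (bit L4 v) z))).
  by rewrite -big_seq xor_overE; move: on; rewrite /on_point => /negPf ->.
move=> i iL; rewrite -[LHS]/(monoc (h ++ v) (code1 (i :: w) (i :: z))).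
rewrite monoc_code //; try by apply/andP.
exact: andbACA.
Qed.

Lemma pr_mem i j : i \in L4 -> j \in L4 -> j != i -> pr i j \in pairs.
Proof.
rewrite !mem4 => i4 j4 ij; have [k [l q]] := q4_exists i4 j4 (contra_neq (@esym _ _ _) ij).
exact: pr_pairs q.
Qed.

Lemma rel_inc_flags h q i w z : size h = 4%N -> size q = 6%N -> on_line h q -> i \in L4 ->
  all (mem L4) w -> all (mem pairs) z -> xsum (monoc (h ++ q)) (rel_inc i w z) = false.
Proof.
move=> sh sq on iL lw lz; rewrite xsum_map /xsum big_seq.
rewrite (eq_bigr (fun j => (bit L4 h j && bit pairs q (pr i j)) && (all (bit L4 h) w && all (bit pairs q) z))).
  by rewrite -big_seq xor_overE; have /negPf -> := allP on i iL.
move=> j; rewrite mem_filter => /andP [ji jL].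
rewrite -[LHS]/(monoc (h ++ q) (code2 (j :: w) (pr i j :: z))).
have pz : all (mem pairs) (pr i j :: z) by apply/andP; split=> //; apply: pr_mem.
rewrite monoc_code //; last by apply/andP.
exact: andbACA.
Qed.

Lemma flags2_rels a b c r : c \in flags2 -> r \in rels2 a b -> xsum (monoc c) r = false.
Proof.
move=> /flags2P [h [q [-> sh sq on /and3P [_ _ pl]]]].
rewrite /rels2 mem_cat => /orP [|]; last rewrite mem_cat => /orP [|].
- case/allpairsP=> [[wi z] [/allpairsP [[w i] [/subsP [_ _ lw] iL ->]] /subsP [_ _ lz] ->]].
  exact: rel_inc_flags.
- case/allpairsP=> [[i z] [iL /subsP [_ _ lz] ->]]; apply: xsum_flatten => r' /mapP [m].
  rewrite mem_filter => /andP [mi mL] ->; apply: rel_inc_flags => //; first by apply/andP.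
  by apply/andP; split=> //; apply: pr_mem.
case/allpairsP=> [[w z] [/subsP [_ _ lw] /subsP [_ _ lz] ->]].
rewrite /xsum !big_cons big_nil !monoc_code //=; try by apply/and3P; split.
move: pl; rewrite /plucker; case: (bit pairs q _); case: (bit pairs q _); case: (bit pairs q _);
  case: (bit pairs q _); case: (bit pairs q _); case: (bit pairs q _); rewrite ?andbF //=;
  by case: (_ && _).
Qed.

Lemma filter_code (A B : eqType) (LA : seq A) (LB : seq B) w z :
  all (mem LA) w -> all (mem LB) z ->
  code LA LB w z = code LA LB (filter (mem w) LA) (filter (mem z) LB).
Proof.
move=> /allP lw /allP lz; apply: code_eq => i; rewrite mem_filter /=.
  by case: (boolP (i \in w)) => //= /lw.
by case: (boolP (i \in z)) => //= /lz.
Qed.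

Lemma filter_subs (U : eqType) (L w : seq U) n : uniq L -> (0 < size w)%N -> all (mem L) w ->
  (size w <= n)%N || (size L <= n)%N -> filter (mem w) L \in subs 1 n L.
Proof.
move=> uL w0 /allP lw hn; apply: mem_subs; first exact: filter_subseq.
apply/andP; split.
  case: w w0 lw {hn} => // i w _ lw; rewrite -has_predT; apply/hasP; exists i => //.
  by rewrite mem_filter; apply/andP; split; [exact: mem_head|exact: lw (mem_head _ _)].
case/orP: hn => hn; last by apply: leq_trans hn; rewrite size_filter count_size.
apply: leq_trans hn; apply: uniq_leq_size; first exact: filter_uniq.
by move=> i; rewrite mem_filter => /andP [].
Qed.

Theorem c1_span b s th : prim (dN b s) th -> (0 < s)%N -> (2 < b)%N ->
  exists2 bl, {subset bl <= flags1} & forall w z, size w = s -> size z = b.+2 ->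
    all (mem L4) w -> all (mem L4) z -> c1 th w z = xsum (monoc^~ (code1 w z)) bl.
Proof.
move=> pth s0 b2; pose s' := minn s 4.
have s'in : s' \in [:: 1; 2; 3; 4]%N by rewrite !inE /s'; lia.
have fset := c1_set pth.
have b0 : (0 < b.+2)%N by [].
have VE w z := setfun_code (w := w) (z := z) fset (iota_uniq 0 4) (iota_uniq 0 4) s0 b0.
set V := setfun L4 L4 s b.+2 (c1 th) in VE.
have [|bl blf h] := flag_span (dual_check_filter (fun m => count id (take 4 m) <= s')%N duals1_check)
    (@flags1_rels s') (V := V) (span1_check s'in).
  move=> r /allpairsP [[w z] [/subsP [w1 w2 lw] /subsP [z1 z2 lz] ->]].
  cbn [fst snd] in *.
  pose w' := pad s.-1 w; pose z' := pad b.+1 z.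
  have sw' : size w' = s.-1.
    rewrite /w' /s' in w1 w2 *; case: w w1 w2 {lw w'} => [|i w] w1 w2; last by apply: size_pad => //; lia.
    by move: w1 => /=; lia.
  have sz' : size z' = b.+1 by apply: size_pad; lia.
  have lw' : all (mem L4) w' by apply: all_pad.
  have lz' : all (mem L4) z' by apply: all_pad.
  have e i : i \in L4 -> V (code1 (i :: w) (i :: z)) = c1 th (i :: w') (i :: z').
    move=> iL; rewrite -VE /= ?sw' ?sz' ?prednK //; try by apply/andP.
    by congr V; apply: code_eq => j; rewrite !inE mem_pad.
  rewrite xsum_map /xsum /= !big_cons big_nil /= !e //.
  have pth' : prim (dN b (size w').+1) th by rewrite sw' prednK.
  have := c1_mix pth' sz' lw' lz' (isT : q4 0 1 2 3).
  by rewrite addbF !addbA.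
exists bl => // w z sw sz lw lz; rewrite -VE // (filter_code lw lz); apply: h.
apply/allpairsP; exists (filter (mem w) L4, filter (mem z) L4); split=> //.
  by apply: filter_subs; rewrite ?sw //; rewrite /s' /=; lia.
by apply: filter_subs; rewrite ?sz // orbT.
Qed.

Lemma q4_others i j k l : q4 i j k l -> perm_eq [seq m <- L4 | m != i] [:: j; k; l].
Proof. by elim/q4_ind: i j k l / . Qed.

Section C2Span.
Variables (a b : nat) (th : PR -> bool).
Hypotheses (ch : tp_chain a b th) (a1 : (1 < a)%N) (b2 : (2 < b)%N).

Let a0 : (0 < a)%N. Proof. by apply: leq_trans a1. Qed.
Let b0 : (0 < b)%N. Proof. by apply: leq_trans b2. Qed.
Let V := setfun L4 pairs a b (c2 th).

Let VE w z w' z' : size w = a -> size z = b -> all (mem L4) w -> all (mem pairs) z ->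
  w =i w' -> z =i z' -> V (code2 w' z') = c2 th w z.
Proof.
move=> sw sz lw lz ew ez; rewrite -(code_eq L4 pairs ew ez) /V.
by apply: setfun_code => // *; apply: (c2_set ch).
Qed.

Let rel_incE i j k l w z : q4 i j k l -> xsum V (rel_inc i w z) =
  V (code2 (j :: w) (pr i j :: z)) (+) V (code2 (k :: w) (pr i k :: z)) (+)
  V (code2 (l :: w) (pr i l :: z)).
Proof.
move=> q; rewrite xsum_map /xsum; set F := V \o _.
transitivity (\big[addb/false]_(m <- [:: j; k; l]) F m); first exact: (perm_big _ (q4_others q)).
by rewrite !big_cons big_nil addbF addbA.
Qed.

Let inc_ok i w z : i \in L4 -> (0 < size w <= a.-1)%N -> (0 < size z <= b.-1)%N ->
  all (mem L4) w -> all (mem pairs) z -> xsum V (rel_inc i w z) = false.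
Proof.
rewrite mem4 => /lt4_q4 [j [k [l q]]] /andP [w0 wa] /andP [z0 zb] lw lz; rewrite (rel_incE _ _ q).
have [i4 j4 k4 l4] := q4_lt q.
have [q1 q2] : q4 i k j l /\ q4 i l j k by move: q; clear; elim/q4_ind: i j k l / .
pose w' := pad a.-1 w; pose z' := pad b.-1 z.
have sw' : size w' = a.-1 by apply: size_pad.
have sz' : size z' = b.-1 by apply: size_pad.
have lw' : all (mem L4) w' by apply: all_pad.
have lz' : all (mem pairs) z' by apply: all_pad.
have e m p : (m < 4)%N -> p \in pairs -> V (code2 (m :: w) (p :: z)) = c2 th (m :: w') (p :: z').
  move=> m4 pp; apply: VE; rewrite /= ?sw' ?sz' ?prednK ?mem4 ?m4 ?pp // => c;
    by rewrite !inE mem_pad.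
rewrite !e ?(pr_pairs q) ?(pr_pairs q1) ?(pr_pairs q2) //.
by apply: (c2_inc ch q); rewrite ?sw' ?sz' ?prednK.
Qed.

Let inc2_ok i z : a = 2 -> i \in L4 -> (0 < size z <= b.-1)%N -> all (mem pairs) z ->
  xsum V (rel_inc i [::] z) = false.
Proof.
move=> a2; rewrite mem4 => /lt4_q4 [j [k [l q]]] /andP [z0 zb] lz; rewrite (rel_incE _ _ q).
have [i4 j4 k4 l4] := q4_lt q.
have [q1 q2] : q4 i k j l /\ q4 i l j k by move: q; clear; elim/q4_ind: i j k l / .
pose z' := pad b.-1 z; have sz' : size z' = b.-1 by apply: size_pad.
have lz' : all (mem pairs) z' by apply: all_pad.
have e m p : (m < 4)%N -> p \in pairs -> V (code2 [:: m] (p :: z)) = c2 th [:: m; m] (p :: z').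
  move=> m4 pp; apply: VE; rewrite /= ?sz' ?prednK ?mem4 ?m4 ?pp // => c.
    by rewrite !inE orbb.
  by rewrite !inE mem_pad.
rewrite !e ?(pr_pairs q) ?(pr_pairs q1) ?(pr_pairs q2) //.
by apply: (c2_inc2 ch q); rewrite ?sz' ?prednK.
Qed.

Let match_ok w z : (0 < size w <= a)%N -> (0 < size z <= b.-2)%N ->
  all (mem L4) w -> all (mem pairs) z ->
  xsum V [:: code2 w [:: pr 0 1, pr 2 3 & z]; code2 w [:: pr 0 2, pr 1 3 & z];
             code2 w [:: pr 0 3, pr 1 2 & z]] = false.
Proof.
move=> /andP [w0 wa] /andP [z0 zb] lw lz.
pose w' := pad a w; pose z' := pad b.-2 z.
have sw' : size w' = a by apply: size_pad.
have sz' : size z' = b.-2 by apply: size_pad.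
have lw' : all (mem L4) w' by apply: all_pad.
have lz' : all (mem pairs) z' by apply: all_pad.
have e p r : p \in pairs -> r \in pairs -> V (code2 w [:: p, r & z]) = c2 th w' [:: p, r & z'].
  move=> pp rp; apply: VE => //; last by move=> c; rewrite !inE mem_pad.
  - by rewrite /= sz'; lia.
  - by apply/and3P.
  - by move=> c; rewrite mem_pad.
rewrite /xsum !big_cons big_nil !e // addbF.
have sz2 : (size z').+2 = b by rewrite sz'; lia.
have := c2_match ch (isT : q4 3 0 1 2) sw' lw' sz2.
rewrite -[pr 3 2]/(pr 2 3) -[pr 3 1]/(pr 1 3) -[pr 3 0]/(pr 0 3).
have sw2 p r : p \in pairs -> r \in pairs -> c2 th w' [:: p, r & z'] = c2 th w' [:: r, p & z'].
  move=> pp rp; apply: (c2_perm ch) => //; first by apply/and3P.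
  by rewrite -[[:: p, r & z']]/([:: p] ++ [:: r] ++ z') perm_catCA.
rewrite (sw2 (pr 1 3) (pr 0 2)) //.
by move: (c2 _ _ _) (c2 _ _ _) (c2 _ _ _) => [] [] [].
Qed.

Theorem c2_span : exists2 bl, {subset bl <= flags2} & forall w z, size w = a -> size z = b ->
    all (mem L4) w -> all (mem pairs) z -> c2 th w z = xsum (monoc^~ (code2 w z)) bl.
Proof.
pose a' := minn a 4; pose b' := minn b 6.
have ain : a' \in [:: 2; 3; 4]%N by rewrite !inE /a'; lia.
have bin : b' \in [:: 3; 4; 5; 6]%N by rewrite !inE /b'; lia.
have [|bl blf h] := flag_span duals2_check (@flags2_rels a' b') (V := V) (span2_check ain bin).
  move=> r; rewrite /rels2 mem_cat => /orP [|]; last rewrite mem_cat => /orP [|].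
  - case/allpairsP=> [[wi z] [/allpairsP [[w i] [/subsP [w1 w2 lw] iL ->]] /subsP [z1 z2 lz] ->]].
    cbn [fst snd] in *; have zb : (0 < size z <= b.-1)%N by rewrite /b' in z2 *; lia.
    case: w w1 w2 lw => [|m w] w1 w2 lw; last first.
      by apply: inc_ok => //; rewrite /a' in w2 *; move: w2 => /=; lia.
    by apply: inc2_ok => //; move: w1; rewrite /a' /=; lia.
  - case/allpairsP=> [[i z] [iL /subsP [z1 z2 lz] ->]]; apply: xsum_flatten => r' /mapP [m].
    cbn [fst snd] in *; rewrite mem_filter => /andP [mi mL] ->; apply: inc_ok => //.
    + by move: a1; rewrite /=; lia.
    + by move: z2; rewrite /b' /=; lia.
    + by apply/andP.
    + by apply/andP; split=> //; apply: pr_mem.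
  case/allpairsP=> [[w z] [/subsP [w1 w2 lw] /subsP [z1 z2 lz] ->]]; cbn [fst snd] in *.
  by apply: match_ok => //; [move: w2; rewrite /a'; lia|move: z2; rewrite /b'; lia].
exists bl => // w z sw sz lw lz; rewrite -(VE sw sz lw lz (fun _ => erefl) (fun _ => erefl)).
rewrite (filter_code lw lz); apply: h.
apply/allpairsP; exists (filter (mem w) L4, filter (mem z) pairs); split=> //.
  by apply: filter_subs; rewrite ?sw //; rewrite /a' /=; lia.
by apply: filter_subs; rewrite ?sz //; rewrite /b' /=; lia.
Qed.

End C2Span.

(** * Coefficients of substituted words *)

Lemma F2_sqr (c : k) : c ^+ 2 = c.
Proof. by case: (F2_case c) => ->; apply: val_inj. Qed.

Definition half (e : 'X_{1..4}) : 'X_{1..4} := [multinom (e i)./2 | i < 4].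

Lemma coefX_sqr (u e : 'X_{1..4}) (F : P4) :
  ('X_[u] * F ^+ 2)@_e =
  if [forall i, odd (u i) == odd (e i)] then ('X_[half u] * F)@_(half e) else 0.
Proof.
elim/mpolyind: F => [|c m p _ _ IH].
  by rewrite expr0n !mulr0 !mcoeff0 if_same.
rewrite P4_sqrD mulrDr mcoeffD IH mulrDr mcoeffD exprZn F2_sqr -!scalerAr !mcoeffZ.
rewrite mpolyXn -!mpolyXD !mcoeffX.
case: ifP => [/forallP par|/negbT npar]; last first.
  rewrite (_ : (_ == e) = false) ?mulr0 ?addr0 //; apply/negbTE; apply: contra npar => /eqP <-.
  by apply/forallP => i; rewrite mnmDE mulmnE oddD oddM andbF addbF.
congr (c * (_ : bool)%:R + _); apply/eqP/eqP => [<-|/mnmP h]; apply/mnmP => i.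
  by rewrite !(mnmE, mnmDE, mulmnE); lia.
by have := h i; have := par i; rewrite !(mnmE, mnmDE, mulmnE); lia.
Qed.

Lemma coef_mul_sqr d (q F : P4) (u e : 'X_{1..4}) : q \is d.-homog -> (forall i, (u i <= 1)%N) ->
  (forall m, mdeg m = d -> (forall i, odd (m i) = odd (e i)) -> m = u) ->
  (forall i, odd (u i) = odd (e i)) ->
  (q * F ^+ 2)@_e = q@_u * F@_(half e).
Proof.
move=> /dhomogP hq u1 uniq_u pu.
rewrite {1}(mpolyE q) mulr_suml raddf_sum /=.
have hu : half u = 0%MM by apply/mnmP => i; rewrite !mnmE; have := u1 i; case: (u i) => [|[]].
have term m : m \in msupp q -> (q@_m *: 'X_[m] * F ^+ 2)@_e = q@_m * (m == u)%:R * F@_(half e).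
  move=> mq; rewrite -scalerAl mcoeffZ coefX_sqr -mulrA; congr (_ * _).
  case: eqP => [->|ne].
    rewrite (_ : [forall i, _]); last by apply/forallP => i; rewrite pu.
    by rewrite hu mpolyX0 !mul1r.
  case: ifP => [/forallP par|]; last by rewrite mul0r.
  by case: ne; apply: uniq_u; [exact: hq|move=> i; apply/eqP].
rewrite big_seq (eq_bigr _ term) -big_seq -mulr_suml; congr (_ * _).
rewrite [in RHS](mpolyE q) raddf_sum /=; apply: eq_bigr => m _.
by rewrite mcoeffZ mcoeffX.
Qed.

Lemma coef_mul_sqr0 d (q F : P4) (e : 'X_{1..4}) : q \is d.-homog ->
  (forall m, mdeg m = d -> ~ (forall i, odd (m i) = odd (e i))) -> (q * F ^+ 2)@_e = 0.
Proof.
move=> /dhomogP hq no; rewrite (mpolyE q) mulr_suml raddf_sum /= big_seq big1 // => m mq.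
rewrite -scalerAl mcoeffZ coefX_sqr; case: ifP => [/forallP par|]; last by rewrite mulr0.
by case: (no m (hq m mq)) => i; apply/eqP.
Qed.

Lemma mono4E a b c d (i : 'I_4) : mono4 a b c d i = nth 0%N [:: a; b; c; d] i.
Proof. by rewrite mnmE. Qed.

Lemma mnm4P (m m' : 'X_{1..4}) : (forall i, (i < 4)%N -> m (inord i) = m' (inord i)) -> m = m'.
Proof. by move=> h; apply/mnmP => i; rewrite -[i]inord_val; apply: h. Qed.

Lemma mono4_nth a b c d n : (n < 4)%N -> mono4 a b c d (inord n) = nth 0%N [:: a; b; c; d] n.
Proof. by move=> n4; rewrite mono4E inordK. Qed.

Lemma half_mono4 a b c d : half (mono4 a b c d) = mono4 a./2 b./2 c./2 d./2.
Proof.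
by apply: mnm4P => -[|[|[|[|]]]] // _; rewrite mnmE !mono4_nth.
Qed.

Lemma dO_half r : (dO r.+1)./2 = dO r. Proof. by rewrite /= uphalf_double. Qed.

Lemma mdeg4 (m : 'X_{1..4}) :
  mdeg m = (m (inord 0) + m (inord 1) + m (inord 2) + m (inord 3))%N.
Proof.
rewrite mdegE (eq_bigr (fun i : 'I_4 => m (inord i))); last by move=> i _; rewrite inord_val.
by rewrite -(big_mkord xpredT (fun i => m (inord i))) /index_iota !big_cons big_nil addn0 !addnA.
Qed.

Lemma tp_chain_of_c1 b s th : (1 < b)%N -> prim (dN b s) th ->
  (forall w z, size w = s -> letters w -> size z = b.+2 -> letters z -> c1 th w z = false) ->
  tp_chain s.+1 b th.
Proof.
case: b => // b b1; elim: s th => [|s IH] th pth h1.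
  have lin : forall i, (i < 4)%N -> forall g, th (x i * g ^+ 2) = false.
    apply: (@lin_vanish_words b); [exact: b1|by rewrite dO_dE|move=> z sz lz; exact: (h1 [::])].
  have e : dN b.+1 0 = (((dE b).*2.+1).+1.*2 + 3)%N by rewrite /=; lia.
  rewrite e in pth; split=> //; first by exists (dE b).*2.+1.
  move=> i i4; have := prim_T pth lin i4.
  by rewrite /= -doubleS.
have lin := dN_lin_vanish pth; have [y y0 e] := dN_odd b.+1 s.
have e2 : dN b.+1 s.+1 = (y.*2.+1.*2 + 3)%N by rewrite /= e; lia.
split=> //; first by exists y.*2; move: pth; rewrite e2.
move=> i i4; apply: IH => [|w z sw lw sz lz]; first exact: dN_prim_T.
by apply: (h1 (i :: w)); rewrite /= ?i4 ?sw.
Qed.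

Lemma gsubD g p q : gsub g (p + q) = gsub g p + gsub g q. Proof. exact: comp_mpolyD. Qed.
Lemma gsubM g p q : gsub g (p * q) = gsub g p * gsub g q. Proof. exact: rmorphM. Qed.
Lemma gsub1 g : gsub g 1 = 1. Proof. exact: comp_mpoly1. Qed.
Lemma gsubxx g p : gsub g (p ^+ 2) = gsub g p ^+ 2. Proof. by rewrite !expr2 gsubM. Qed.
Lemma gsub_px g i : gsub g (px i) = \sum_(j < 4) g (inord i) j *: 'X_j.
Proof. by rewrite /gsub /px comp_mpolyXU -tnth_nth tnth_mktuple. Qed.

Lemma endo_ext (F G : {rmorphism P4 -> P4}) : (forall i, (i < 4)%N -> F (px i) = G (px i)) -> F =1 G.
Proof.
move=> h p; rewrite (mpolyE p) !rmorph_sum; apply: eq_bigr => m _.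
have eX : F 'X_[m] = G 'X_[m] by rewrite monomialE !rmorphM !rmorphXn !h.
by case: (F2_case p@_m) => ->; rewrite ?scale0r ?scale1r ?rmorph0.
Qed.

Lemma gsub_Sq g p : gsub g (Sq p) = Sq (gsub g p).
Proof.
pose F : {rmorphism P4 -> P4} := comp_mpoly [tuple (\sum_(j < 4) g i j *: 'X_j : P4) | i < 4].
pose G : {rmorphism P4 -> P4} := comp_mpoly [tuple ('X_i + 'X_i ^+ 2 : P4) | i < 4].
apply: (endo_ext (F := (F \o G)%FUN) (G := (G \o F)%FUN)) => i i4 /=.
rewrite -[F _]/(gsub g (Sq (px i))) -[G _]/(Sq (gsub g (px i))).
rewrite Sqx gsubD gsubxx gsub_px; pose c j : k := g (inord i) j; rewrite -/(c _).
have sqS : (\sum_(j < 4) c j *: 'X_j : P4) ^+ 2 = \sum_(j < 4) c j *: 'X_j ^+ 2.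
  rewrite (big_morph (fun p : P4 => p ^+ 2) P4_sqrD (expr0n _ 2)).
  by apply: eq_bigr => j _; rewrite exprZn F2_sqr.
rewrite sqS (big_morph Sq SqD Sq0) -big_split; apply: eq_bigr => j _ /=.
rewrite -scalerDr /c; case: (F2_case (g (inord i) j)) => ->; rewrite ?scale0r ?Sq0 // !scale1r -pxE Sqx //.
Qed.

Lemma gsub_gsub g h p : gsub g (gsub h p) = gsub (h *m g) p.
Proof.
pose F h : {rmorphism P4 -> P4} := comp_mpoly [tuple (\sum_(j < 4) h i j *: 'X_j : P4) | i < 4].
apply: (endo_ext (F := (F g \o F h)%FUN) (G := F (h *m g))) => i i4 /=.
rewrite -[LHS]/(gsub g (gsub h (px i))) -[RHS]/(gsub (h *m g) (px i)) !gsub_px.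
have g0 : gsub g 0 = 0 by exact: comp_mpoly0.
have gZ c (p' : P4) : gsub g (c *: p') = c *: gsub g p' by exact: comp_mpolyZ.
rewrite (big_morph (gsub g) (gsubD g) g0).
rewrite [RHS](eq_bigr (fun j => \sum_l (h (inord i) l * g l j) *: 'X_j)); last first.
  by move=> j _; rewrite mxE scaler_suml.
rewrite exchange_big; apply: eq_bigr => l _ /=.
rewrite gZ -pxE gsub_px inord_val scaler_sumr; apply: eq_bigr => j _.
by rewrite scalerA.
Qed.

Lemma gsub_homog g d p : p \is d.-homog -> gsub g p \is d.-homog.
Proof.
have g0 : gsub g 0 = 0 by exact: comp_mpoly0.
have gZ c (p' : P4) : gsub g (c *: p') = c *: gsub g p' by exact: comp_mpolyZ.
have hx i m : gsub g (px i) ^+ m \is m.-homog.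
  rewrite -[m in m.-homog]mul1n; apply: dhomogMn; rewrite gsub_px.
  by apply: rpred_sum => j _; apply: rpredZ; rewrite dhomogX /= mdeg1.
move=> /dhomogP hp; rewrite (mpolyE p) (big_morph (gsub g) (gsubD g) g0) big_seq.
apply: rpred_sum => m /hp; rewrite /= mdeg4 => <-; rewrite gZ; apply: rpredZ.
rewrite monomialE !gsubM.
have gX q j : gsub g (q ^+ j) = gsub g q ^+ j by exact: rmorphXn.
by rewrite !gX; do 3!apply: dhomogM => //.
Qed.

(** * Coefficients at spikes are invariant under the Steenrod square *)

Definition even_in (i : 'I_4) (G : P4) := forall m, m \in msupp G -> ~~ odd (m i).

Lemma even_inM i F G : even_in i F -> even_in i G -> even_in i (F * G).
Proof.
move=> hF hG m /msuppM_le /allpairsP [[a b] /= [/hF ha /hG hb ->]].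
by rewrite mnmDE oddD (negPf ha) (negPf hb).
Qed.

Lemma even_inD i F G : even_in i F -> even_in i G -> even_in i (F + G).
Proof. by move=> hF hG m /msuppD_le; rewrite mem_cat => /orP [/hF|/hG]. Qed.

Lemma even_in_px (i j : nat) : (i < 4)%N -> (j < 4)%N -> i != j -> even_in (inord i) (px j).
Proof.
move=> i4 j4 ij m; rewrite msuppX inE => /eqP ->; rewrite mnm1E.
by rewrite (_ : (inord j == inord i) = false) //; apply/eqP => /(congr1 (@nat_of_ord 4));
  rewrite !inordK // => e; rewrite e eqxx in ij.
Qed.

Lemma even_in_sqr i F : even_in i (F ^+ 2).
Proof.
move=> m; rewrite mcoeff_msupp -[F ^+ 2]mul1r -mpolyX0 coefX_sqr; case: ifP; last by rewrite eqxx.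
by move/forallP/(_ i); rewrite mnm0E; case: (odd (m i)).
Qed.

Lemma even_in1 i : even_in i 1. Proof. by rewrite -(expr1n P4 2); apply: even_in_sqr. Qed.

Lemma coef_Sqx (i : nat) (b : bool) (G : P4) (e : 'X_{1..4}) : (i < 4)%N ->
  (b -> even_in (inord i) G) -> e (inord i) = 0%N \/ odd (e (inord i)) ->
  (Sq (px i ^+ b) * G)@_e = (px i ^+ b * G)@_e.
Proof.
case: b => i4 h ei; last by rewrite !expr0 Sq1.
rewrite !expr1 Sqx mulrDl mcoeffD; rewrite [X in _ + X](_ : _ = 0) ?addr0 //.
apply/eqP; rewrite mcoeff_eq0; apply/negP.
move/msuppM_le => /allpairsP [[a b] /= [ha /(h isT) hb ee]].
move: ha; rewrite /px mpolyXn msuppX inE => /eqP ea.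
by move: ei; rewrite ee ea mnmDE mulmnE mnm1E eqxx oddD (negPf hb) /=; lia.
Qed.

Lemma coef_rot (a0 a1 a2 a3 q : P4) e :
  (a0 * (a1 * (a2 * (a3 * q))))@_e = (a1 * (a2 * (a3 * (a0 * q))))@_e.
Proof.
have rot (R : comNzRingType) (y0 y1 y2 y3 y : R) :
  y0 * (y1 * (y2 * (y3 * y))) = y1 * (y2 * (y3 * (y0 * y))) by ring.
by rewrite (rot _ a0).
Qed.

Definition spike (e : 'X_{1..4}) := forall i, exists a, e i = dO a.

Lemma spike_par e i : spike e -> e i = 0%N \/ odd (e i).
Proof. by case/(_ i) => [[|a] ->]; [left|right; rewrite /= odd_double]. Qed.

Lemma spike_half e : spike e -> spike (half e).
Proof. by move=> h i; rewrite mnmE; case: (h i) => [[|a] ->]; [exists 0%N|exists a; rewrite dO_half]. Qed.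

Lemma mul4A (a0 a1 a2 a3 q : P4) : a0 * a1 * a2 * a3 * q = a0 * (a1 * (a2 * (a3 * q))).
Proof.
have assoc (R : comNzRingType) (y0 y1 y2 y3 y : R) :
  y0 * y1 * y2 * y3 * y = y0 * (y1 * (y2 * (y3 * y))) by ring.
exact: assoc.
Qed.

Lemma coef_Sq_linear (b0 b1 b2 b3 : bool) (q : P4) e : spike e ->
  (Sq (px 0 ^+ b0 * px 1 ^+ b1 * px 2 ^+ b2 * px 3 ^+ b3) * q ^+ 2)@_e =
  (px 0 ^+ b0 * px 1 ^+ b1 * px 2 ^+ b2 * px 3 ^+ b3 * q ^+ 2)@_e.
Proof.
move=> se; rewrite !SqM !mul4A.
have ev (i j : nat) (b : bool) : (i < 4)%N -> (j < 4)%N -> i != j -> even_in (inord i) (px j ^+ b).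
  by case: b => i4 j4 ij; rewrite ?expr0 ?expr1; [apply: even_in_px|apply: even_in1].
have evS (i j : nat) (b : bool) : (i < 4)%N -> (j < 4)%N -> i != j -> even_in (inord i) (Sq (px j ^+ b)).
  case: b => i4 j4 ij; rewrite ?expr0 ?expr1 ?Sq1; last exact: even_in1.
  by rewrite Sqx; apply: even_inD; [apply: even_in_px|apply: even_in_sqr].
have step i (b : bool) G (i4 : (i < 4)%N) (h : even_in (inord i) G) :
  (Sq (px i ^+ b) * G)@_e = (px i ^+ b * G)@_e := coef_Sqx i4 (fun=> h) (spike_par (inord i) se).
have ev3 i A B C : even_in i A -> even_in i B -> even_in i C -> even_in i (A * (B * (C * q ^+ 2))).
  by move=> hA hB hC; do 3!(apply: even_inM => //); exact: even_in_sqr.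
have s0 := step 0 b0 _ isT (ev3 _ _ _ _ (evS 0 1 b1 isT isT isT) (evS 0 2 b2 isT isT isT) (evS 0 3 b3 isT isT isT)).
apply: (etrans s0); apply: (etrans (coef_rot _ _ _ _ _ _)).
have s1 := step 1 b1 _ isT (ev3 _ _ _ _ (evS 1 2 b2 isT isT isT) (evS 1 3 b3 isT isT isT) (ev 1 0 b0 isT isT isT)).
apply: (etrans s1); apply: (etrans (coef_rot _ _ _ _ _ _)).
have s2 := step 2 b2 _ isT (ev3 _ _ _ _ (evS 2 3 b3 isT isT isT) (ev 2 0 b0 isT isT isT) (ev 2 1 b1 isT isT isT)).
apply: (etrans s2); apply: (etrans (coef_rot _ _ _ _ _ _)).
have s3 := step 3 b3 _ isT (ev3 _ _ _ _ (ev 3 0 b0 isT isT isT) (ev 3 1 b1 isT isT isT) (ev 3 2 b2 isT isT isT)).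
exact: (etrans s3 (coef_rot _ _ _ _ _ _)).
Qed.

Lemma spike_Sq e p : spike e -> (Sq p)@_e = p@_e.
Proof.
move=> se; rewrite (mpolyE p) (big_morph Sq SqD Sq0) !raddf_sum; apply: eq_bigr => m _ /=.
suff h : (Sq 'X_[m])@_e = ('X_[m] : P4)@_e.
  by case: (F2_case p@_m) => ->; rewrite ?scale0r ?Sq0 ?scale1r.
have [d] := ubnP (mdeg m); elim: d m e se {p} => // d IH m e se md.
have [m0|m0] := eqVneq m 0%MM; first by rewrite m0 mpolyX0 Sq1.
pose u := [multinom (odd (m i) : nat) | i < 4].
have em : m = (u + half m *+ 2)%MM.
  by apply/mnmP => i; rewrite mnmDE mulmnE !mnmE muln2 odd_double_half.
have lt_half : (mdeg (half m) < d)%N.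
  have := congr1 mdeg em; rewrite mdegD mdegMn; move: m0 md; rewrite -mdeg_eq0; lia.
have -> : 'X_[m] = 'X_[u] * 'X_[half m] ^+ 2 :> P4 by rewrite mpolyXn -mpolyXD -em.
rewrite SqM Sqxx; have -> : (Sq 'X_[u] * Sq 'X_[half m] ^+ 2)@_e = ('X_[u] * Sq 'X_[half m] ^+ 2)@_e.
  by rewrite monomialE !mnmE; apply: coef_Sq_linear.
rewrite !coefX_sqr; case: ifP => // /forallP pu.
have -> : half u = 0%MM by apply/mnmP => i; rewrite !mnmE; case: odd.
by rewrite mpolyX0 !mul1r; apply: IH => //; apply: spike_half.
Qed.

(** * The primitive functionals given by two spikes *)

Definition nz (c : k) : bool := c != 0.

Lemma nz0 : nz 0 = false. Proof. by rewrite /nz eqxx. Qed.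
Lemma nz1 : nz 1. Proof. by []. Qed.
Lemma nzD a b : nz (a + b) = nz a (+) nz b.
Proof. by case: (F2_case a) (F2_case b) => -> [] ->. Qed.
Lemma nzM a b : nz (a * b) = nz a && nz b.
Proof. by case: (F2_case a) (F2_case b) => -> [] ->. Qed.

Definition cof (e : 'X_{1..4}) (g : 'M[k]_4) (p : PR) : bool := nz (gsub g (toP p))@_e.

Lemma cof_prim e g : spike e -> prim (mdeg e) (cof e g).
Proof.
move=> se; split; last first.
  by move=> p; rewrite /cof /St ofPK gsub_Sq; apply: (congr1 nz (spike_Sq (gsub g (toP p)) se)).
split=> [p q|m nm]; rewrite /cof !ofPK; first by rewrite gsubD mcoeffD nzD.
rewrite (_ : _@_e = 0) ?nz0 //; apply/eqP; rewrite mcoeff_eq0; apply/negP => he.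
have /dhomogP h : gsub g 'X_[m] \is (mdeg m).-homog by apply: gsub_homog; rewrite dhomogX.
by have := h _ he; move: nm => /= /eqP nm e1; apply: nm.
Qed.

Lemma mono4_spike a b c d : spike (mono4 (dO a) (dO b) (dO c) (dO d)).
Proof.
move=> i; rewrite mono4E; case: i => -[|[|[|[|]]]] //= _;
  by [exists a|exists b|exists c|exists d].
Qed.

Lemma xor_ord4 (f : nat -> bool) :
  \big[addb/false]_(j < 4) f j = f 0 (+) f 1 (+) f 2 (+) f 3.
Proof. by rewrite -(big_mkord xpredT f) /index_iota !big_cons big_nil addbF !addbA. Qed.

Section Cof.
Variable g : 'M[k]_4.

Definition coefT i := nz (gsub g (pT i))@_(mono4 0 1 1 1).
Definition coefP (p : nat * nat) := nz (gsub g (px p.1 * px p.2))@_(mono4 0 0 1 1).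
Definition entry (i j : nat) := nz (g (inord i) (inord j)).

Let odd4 (m e : 'X_{1..4}) : (forall i, odd (m i) = odd (e i)) ->
  [/\ odd (m (inord 0)) = odd (e (inord 0)), odd (m (inord 1)) = odd (e (inord 1)),
   odd (m (inord 2)) = odd (e (inord 2)) & odd (m (inord 3)) = odd (e (inord 3))].
Proof. by move=> h; split; apply: h. Qed.

Lemma cof_T a b c i F : (i < 4)%N ->
  cof (mono4 0 (dO a.+1) (dO b.+1) (dO c.+1)) g (T i * F ^+ 2) =
  coefT i && cof (mono4 0 (dO a) (dO b) (dO c)) g F.
Proof.
move=> i4; rewrite /cof /coefT -nzM; congr nz.
have -> : toP (T i * F ^+ 2) = pT i * toP F ^+ 2 by rewrite !toPM ofPK.
rewrite gsubM gsubxx (@coef_mul_sqr 3 _ _ (mono4 0 1 1 1)).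
- by rewrite half_mono4 !dO_half.
- exact: gsub_homog (phomog_T i4).
- by move=> j; rewrite mono4E; case: j => -[|[|[|[|]]]].
- move=> m md /odd4 [e0 e1 e2 e3]; move: md; rewrite mdeg4 => md.
  apply: mnm4P => -[|[|[|[|]]]] // _; move: md e0 e1 e2 e3; rewrite !mono4_nth //=; lia.
- by move=> j; rewrite !mono4E; case: j => -[|[|[|[|]]]] //=; rewrite ?odd_double.
Qed.

Lemma cof_P b c p F :
  cof (mono4 0 0 (dO b.+1) (dO c.+1)) g (xp p * F ^+ 2) =
  coefP p && cof (mono4 0 0 (dO b) (dO c)) g F.
Proof.
rewrite /cof /coefP -nzM; congr nz.
have -> : toP (xp p * F ^+ 2) = px p.1 * px p.2 * toP F ^+ 2 by rewrite !toPM !ofPK.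
rewrite gsubM gsubxx (@coef_mul_sqr 2 _ _ (mono4 0 0 1 1)).
- by rewrite half_mono4 !dO_half.
- exact: gsub_homog (phomog_xx _ _).
- by move=> j; rewrite mono4E; case: j => -[|[|[|[|]]]].
- move=> m md /odd4 [e0 e1 e2 e3]; move: md; rewrite mdeg4 => md.
  apply: mnm4P => -[|[|[|[|]]]] // _; move: md e0 e1 e2 e3; rewrite !mono4_nth //=; lia.
- by move=> j; rewrite !mono4E; case: j => -[|[|[|[|]]]] //=; rewrite ?odd_double.
Qed.

Lemma cof_x0 a b c i F : cof (mono4 0 (dO a.+1) (dO b.+1) (dO c.+1)) g (x i * F ^+ 2) = false.
Proof.
rewrite /cof (_ : toP (x i * F ^+ 2) = px i * toP F ^+ 2); last by rewrite !toPM ofPK.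
rewrite gsubM gsubxx (@coef_mul_sqr0 1) ?nz0 //; first exact: gsub_homog (phomog_x i).
by move=> m md /odd4 [e0 e1 e2 e3]; move: md e0 e1 e2 e3; rewrite mdeg4 !mono4_nth //=; lia.
Qed.

Lemma cof_Tword w a b c F : all (mem L4) w ->
  cof (mono4 0 (dO (size w + a)) (dO (size w + b)) (dO (size w + c))) g (wt (map T w) F) =
  all coefT w && cof (mono4 0 (dO a) (dO b) (dO c)) g F.
Proof.
elim: w => [|i w IH]; first by [].
move=> /andP [iL lw]; have i4 : (i < 4)%N by rewrite -mem4.
rewrite -[size (i :: w)]/(size w).+1 !addSn -[wt _ _]/(T i * wt (map T w) F ^+ 2) (cof_T _ _ _ _ i4) (IH lw).
exact: andbA.
Qed.

Lemma cof_Pword z : cof (mono4 0 0 (dO (size z)) (dO (size z))) g (wp (map xp z)) = all coefP z.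
Proof.
elim: z => [|p z IH] /=; last by rewrite cof_P IH.
rewrite /cof toP1 gsub1 mcoeff1 (_ : _ == _) //; apply/eqP; apply: mnm4P => -[|[|[|[|]]]] // _.
all: by rewrite mono4_nth // mnm0E.
Qed.

(* At a pure power of the last variable, the coefficient of a form is its value
   at the point given by the last column of [g]. *)
Definition evp (p : PR) : bool := nz (toP p).@[fun i => g i (inord 3)].

Lemma evpM p q : evp (p * q) = evp p && evp q.
Proof. by rewrite /evp toPM mevalM nzM. Qed.

Lemma evp_sqr p : evp (p ^+ 2) = evp p.
Proof. by rewrite expr2 evpM andbb. Qed.

Lemma evp1 : evp 1. Proof. by rewrite /evp toP1 meval1. Qed.
Lemma evp_x i : evp (x i) = entry i 3. Proof. by rewrite /evp ofPK mevalXU. Qed.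

Lemma evp_wp ms : evp (wp ms) = all evp ms.
Proof. by elim: ms => [|m ms IH] /=; rewrite ?evp1 // evpM evp_sqr IH. Qed.

Lemma cof_evp d F : hmg d F -> cof (mono4 0 0 0 d) g F = evp F.
Proof.
rewrite /hmg /cof /evp; move: (toP F) => {}F hF; congr nz.
have -> : F.@[fun i => g i (inord 3)] = (gsub g F).@[fun i => (i == inord 3)%:R].
  rewrite /gsub comp_mpoly_meval; apply: meval_eq => i.
  rewrite tnth_map tnth_ord_tuple raddf_sum (bigD1 (inord 3)) //= mevalZ mevalXU eqxx mulr1.
  rewrite big1 ?addr0 // => j /negPf j3.
  by rewrite mevalZ mevalXU j3 mulr0.
have /dhomogP h := gsub_homog g hF.
rewrite mevalE [RHS](_ : _ = \sum_(m <- msupp (gsub g F)) (gsub g F)@_m * (m == mono4 0 0 0 d)%:R).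
  by rewrite {1}(mpolyE (gsub g F)) raddf_sum; apply: eq_bigr => m _; rewrite /= mcoeffZ mcoeffX.
rewrite big_seq [RHS]big_seq; apply: eq_bigr => m /h /= md; congr (_ * _).
have i3 (j : 'I_4) : (j == inord 3) = (val j == 3) by rewrite -(inj_eq val_inj) /= inordK.
rewrite (eq_bigr (fun j : 'I_4 => ((val j == 3) || (m (inord j) == 0)%N)%:R)); last first.
  by move=> j _; rewrite inord_val i3; case: eqP => _ /=; [rewrite expr1n|rewrite expr0n].
rewrite -natr_prod; congr (_%:R); move: md; rewrite mdeg4.
rewrite -(big_mkord xpredT (fun j => nat_of_bool ((j == 3) || (m (inord j) == 0)%N))).
rewrite /index_iota [iota 0 _]/= !big_cons big_nil /= => md.
case: (m =P _) => [->|ne]; first by rewrite !mono4_nth.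
suff : ~ [/\ m (inord 0) = 0, m (inord 1) = 0 & m (inord 2) = 0]%N.
  by do 3!(case: eqP => ? //); case.
case=> m0 m1 m2; case: ne; apply: mnm4P => -[|[|[|[|]]]] // _; rewrite mono4_nth //=; lia.
Qed.

Lemma coef_pxM (j : nat) F e : (j < 4)%N ->
  (px j * F)@_e = if (0 < e (inord j))%N then F@_(e - U_(inord j)) else 0.
Proof.
move=> j4; case: ifP => [e0|/negbT e0].
  have {1}-> : e = (U_(inord j) + (e - U_(inord j)))%MM.
    by apply/mnmP => i; rewrite mnmDE mnmBE mnm1E; case: eqP => [<-|_]; lia.
  by rewrite mulrC mcoeffMX.
apply/eqP; rewrite mcoeff_eq0; apply/negP => /msuppM_le /allpairsP [[a b] /= [ha _ ee]].
move: ha; rewrite msuppX inE => /eqP ea.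
by move: e0; rewrite ee ea mnmDE mnm1E eqxx.
Qed.

Lemma nz_linear (i a b c d : nat) F : nz (gsub g (px i) * F)@_(mono4 a b c d) =
  [&& (0 < a)%N, entry i 0 & nz F@_(mono4 a.-1 b c d)] (+)
  [&& (0 < b)%N, entry i 1 & nz F@_(mono4 a b.-1 c d)] (+)
  [&& (0 < c)%N, entry i 2 & nz F@_(mono4 a b c.-1 d)] (+)
  [&& (0 < d)%N, entry i 3 & nz F@_(mono4 a b c d.-1)].
Proof.
rewrite gsub_px mulr_suml raddf_sum (big_morph nz nzD nz0).
pose e := mono4 a b c d.
pose f j := [&& (0 < e (inord j))%N, entry i j & nz F@_(e - U_(inord j))].
rewrite (eq_bigr (fun j : 'I_4 => f j)); last first.
  move=> j _; rewrite -pxE -scalerAl /= mcoeffZ nzM coef_pxM // -/e /f /entry !inord_val.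
  by case: ifP => _ //=; rewrite nz0 andbF.
rewrite xor_ord4 /f.
have eU (j : nat) : (j < 4)%N -> (e - U_(inord j))%MM =
    mono4 (a - (j == 0)) (b - (j == 1)) (c - (j == 2)) (d - (j == 3)).
  move=> j4; apply: mnm4P => l l4; rewrite mnmBE /e !mono4_nth // mnm1E.
  rewrite -(inj_eq val_inj) /= !inordK //.
  by move: l l4 j j4 => [|[|[|[|]]]] // _ [|[|[|[|]]]].
rewrite (eU 0 isT) (eU 1 isT) (eU 2 isT) (eU 3 isT) !subn0 !subn1 /e.
by rewrite (mono4_nth a b c d (isT : 0 < 4)%N) (mono4_nth a b c d (isT : 1 < 4)%N)
  (mono4_nth a b c d (isT : 2 < 4)%N) (mono4_nth a b c d (isT : 3 < 4)%N).
Qed.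
End Cof.

Section Columns.
Variable g : 'M[k]_4.
Notation coefT := (coefT g).
Notation coefP := (coefP g).
Notation entry := (entry g).

Let coefs (F : P4) (Q : nat -> nat -> nat -> nat -> bool) :=
  forall a b c d, nz F@_(mono4 a b c d) = Q a b c d.

Let lin i (Q : nat -> nat -> nat -> nat -> bool) a b c d :=
  [&& (0 < a)%N, entry i 0 & Q a.-1 b c d] (+) [&& (0 < b)%N, entry i 1 & Q a b.-1 c d] (+)
  [&& (0 < c)%N, entry i 2 & Q a b c.-1 d] (+) [&& (0 < d)%N, entry i 3 & Q a b c d.-1].

Let coefs1 : exists2 u : P4, forall p, gsub g p = gsub g p * u &
  coefs u (fun a b c d => [&& a == 0, b == 0, c == 0 & d == 0]%N).
Proof.
exists 1 => [p|a b c d]; first by rewrite mulr1.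
rewrite mcoeff1; transitivity (mono4 a b c d == 0%MM); first by case: eqP.
by rewrite -mdeg_eq0 mdeg4 !mono4_nth //=; lia.
Qed.

Let gsubMM p q F : gsub g (p * q) * F = gsub g p * (gsub g q * F).
Proof. by rewrite gsubM mulrA. Qed.

Let coefs_lin F Q i : coefs F Q -> coefs (gsub g (px i) * F) (lin i Q).
Proof. by move=> h a b c d; rewrite nz_linear !h. Qed.

Lemma coefP_entry i j :
  coefP (i, j) = (entry i 2 && entry j 3) (+) (entry i 3 && entry j 2).
Proof.
have [u up /(coefs_lin j) /(coefs_lin i) h] := coefs1.
by rewrite /coefP up gsubMM h /lin /=;
  case: (entry i 2) (entry j 3) (entry i 3) (entry j 2) => [] [] [] [].
Qed.

Lemma coefT_entry i j k l : q4 i j k l ->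
  coefT i = (entry j 1 && coefP (k, l)) (+) (entry k 1 && coefP (j, l)) (+) (entry l 1 && coefP (j, k)).
Proof.
move=> q; rewrite /coefT (pT_q4 q) !coefP_entry.
have [u up /(coefs_lin l) /(coefs_lin k) /(coefs_lin j) h] := coefs1.
rewrite up !gsubMM h /lin /=.
case: (entry j 1) (entry j 2) (entry j 3) => [] [] [];
case: (entry k 1) (entry k 2) (entry k 3) => [] [] [];
by case: (entry l 1) (entry l 2) (entry l 3) => [] [] [].
Qed.
End Columns.

(** * The flag of an invertible matrix *)

Definition gcol g m := [seq entry g i m | i <- L4].
Definition minor c d (p : nat * nat) :=
  (bit L4 c p.1 && bit L4 d p.2) (+) (bit L4 d p.1 && bit L4 c p.2).
Definition qvec c d := [seq minor c d p | p <- pairs].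
Definition hvec b c d := [seq (let r := [seq j <- L4 | j != i] in
   let '(j, m, l) := (nth 0 r 0, nth 0 r 1, nth 0 r 2) in
   (bit L4 b j && minor c d (m, l)) (+) (bit L4 b m && minor c d (j, l))
   (+) (bit L4 b l && minor c d (j, m)))%N | i <- L4].

Definition plane g := hvec (gcol g 1) (gcol g 2) (gcol g 3).
Definition line g := qvec (gcol g 2) (gcol g 3).

Lemma bit_map (U : eqType) (L : seq U) f i : i \in L -> bit L (map f L) i = f i.
Proof.
case: L => // i0 L iL; rewrite /bit (nth_map i0) ?index_mem //.
by rewrite nth_index.
Qed.

Lemma bit_gcol g i m : i \in L4 -> bit L4 (gcol g m) i = entry g i m.
Proof. exact: bit_map. Qed.

Lemma coefP_line g p : p \in pairs -> coefP g p = bit pairs (line g) p.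
Proof.
move=> pp; rewrite bit_map // /minor; case: p pp => i j pp; rewrite coefP_entry /=.
have [i4 j4] : i \in L4 /\ j \in L4.
  by move: pp; rewrite /pairs !inE => /or3P [|| /or4P []] /eqP [-> ->].
by rewrite !bit_gcol.
Qed.

Lemma coefT_plane g i : i \in L4 -> coefT g i = bit L4 (plane g) i.
Proof.
move=> iL; rewrite bit_map //; move: iL; rewrite mem4.
case: i => [|[|[|[|//]]]] _; [rewrite (@coefT_entry g 0 1 2 3) //|rewrite (@coefT_entry g 1 0 2 3) //
  |rewrite (@coefT_entry g 2 0 1 3) //|rewrite (@coefT_entry g 3 0 1 2) //];
  by rewrite !coefP_entry /minor /= !bit_gcol.
Qed.

(* [cs] lists columns, [vs] coefficient vectors. *)
Definition indep (vs cs : seq (seq bool)) := all (fun a => has id a ==>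
  has (fun i => xor_over L4 (fun j => bit L4 (nth [::] cs j) i && bit L4 a j)) L4) vs.

Lemma xor_over4 f : xor_over L4 f = f 0%N (+) f 1%N (+) f 2 (+) f 3.
Proof. by rewrite /xor_over /= addbF !addbA. Qed.

Lemma nz_mul_tr (g : 'M[k]_4) (v : 'rV[k]_4) i : (i < 4)%N ->
  nz ((v *m g^T) 0 (inord i)) = xor_over L4 (fun j => entry g i j && nz (v 0 (inord j))).
Proof.
move=> i4; rewrite mxE (big_morph nz nzD nz0).
rewrite (eq_bigr (fun j : 'I_4 => entry g i j && nz (v 0 (inord j)))); last first.
  by move=> j _; rewrite mxE nzM andbC /entry !inord_val.
by rewrite (xor_ord4 (fun j => entry g i j && nz (v 0 (inord j)))) xor_over4.
Qed.

Definition cols g := [:: gcol g 0; gcol g 1; gcol g 2; gcol g 3].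

Lemma nth_cols g i j : i \in L4 -> j \in L4 -> bit L4 (nth [::] (cols g) j) i = entry g i j.
Proof. by move=> iL; rewrite mem4; case: j => [|[|[|[|]]]] // _; rewrite bit_gcol. Qed.

Lemma eq_xor_over r F G : {in r, F =1 G} -> xor_over r F = xor_over r G.
Proof.
elim: r => //= i r IH h; rewrite h ?mem_head // IH // => j jr.
by rewrite h // inE jr orbT.
Qed.

Lemma unit_indep g vs : g \in unitmx -> all (fun a => size a == 4) vs -> indep vs (cols g).
Proof.
move=> gu /allP sv; apply/allP => a /sv /eqP sa; apply/implyP => ha; apply: contraT => /hasPn no.
pose v : 'rV[k]_4 := \row_j (nth false a j)%:R.
have v0 : v *m g^T = 0.
  apply/rowP => i; rewrite [RHS]mxE -[i]inord_val; apply/eqP; rewrite -[_ == _]negbK -/(nz _).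
  rewrite nz_mul_tr //; have iL : (i : nat) \in L4 by rewrite mem4.
  rewrite (_ : xor_over _ _ = xor_over L4 (fun j => bit L4 (nth [::] (cols g) j) i && bit L4 a j)).
    exact: no.
  apply: eq_xor_over => j jL; rewrite nth_cols // mxE; move: jL; rewrite mem4 => j4.
  rewrite inordK //; congr (_ && _); rewrite /bit (_ : index j L4 = j); first by case: nth.
  by case: j j4 => [|[|[|[|]]]].
have {}v0 : v = 0 by have gT : g^T \in unitmx; [rewrite unitmx_tr|rewrite -(mulmxK gT v) v0 mul0mx].
case/hasP: ha => b /(nthP false) [j]; rewrite sa => j4 <- bj.
have := congr1 (fun w : 'rV[k]_4 => nz (w 0 (inord j))) v0.
by rewrite !mxE inordK // nz0; move: bj => /= ->.
Qed.

Definition mkmx (cs : seq (seq bool)) : 'M[k]_4 := \matrix_(i, j) (nth false (nth [::] cs j) i)%:R.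

Lemma entry_mkmx cs i j : (i < 4)%N -> (j < 4)%N -> entry (mkmx cs) i j = nth false (nth [::] cs j) i.
Proof. by move=> i4 j4; rewrite /entry mxE !inordK //; case: nth. Qed.

Lemma gcol_mkmx cs j : (j < 4)%N -> size (nth [::] cs j) = 4%N -> gcol (mkmx cs) j = nth [::] cs j.
Proof.
move=> j4 sc; apply: (@eq_from_nth _ false); rewrite ?size_map // => i i4.
by rewrite (nth_map 0%N) // nth_iota // entry_mkmx.
Qed.

Lemma mem_bitvecs v : v \in bitvecs (size v).
Proof. by elim: v => // b v IH; apply/allpairsP; exists (b, v); case: b. Qed.

Lemma mkmx_unit cs : size cs = 4%N -> indep (bitvecs 4) cs -> mkmx cs \in unitmx.
Proof.
move=> s4 /allP ind; rewrite -unitmx_tr -row_free_unit; apply: inj_row_free => v v0.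
pose a := [seq nz (v 0 (inord j)) | j <- L4].
have [ha|/hasPn no] := boolP (has id a); last first.
  apply/rowP => j; rewrite [RHS]mxE -[j]inord_val; apply/eqP; rewrite -[_ == _]negbK -/(nz _).
  apply: no; apply/mapP; exists (val j); last exact: erefl.
  by rewrite mem4 ltn_ord.
have := ind a (mem_bitvecs a); rewrite ha => /hasP [i]; rewrite mem4 => i4.
rewrite (_ : xor_over _ _ = xor_over L4 (fun j => entry (mkmx cs) i j && nz (v 0 (inord j)))).
  by rewrite -nz_mul_tr // v0 mxE nz0.
apply: eq_xor_over => j jL; rewrite bit_map //; move: jL; rewrite mem4 => j4.
rewrite entry_mkmx // /bit (_ : index i L4 = i) //.
by case: i i4 => [|[|[|[|]]]].
Qed.

(** * Every flag comes from an invertible matrix *)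

Definition flag1 g := plane g ++ gcol g 3.
Definition flag2 g := plane g ++ line g.

Definition good_flag h v q :=
  [&& has id h, has id v, on_point h v, has id q, plucker q & on_line h q].

Lemma good_flag_check : all (fun b => all (fun c => all (fun d =>
   let h := hvec b c d in let q := qvec c d in
   if has id h then good_flag h d q else ~~ indep [seq false :: a | a <- bitvecs 3] [:: [::]; b; c; d])
  (bitvecs 4)) (bitvecs 4)) (bitvecs 4).
Proof. by vm_compute. Qed.

(* Completes two points of the plane [h], the second one nonzero, to a frame of
   the plane and of the space. *)
Definition frame h c d :=
  [:: head [::] [seq a <- bitvecs 4 | ~~ on_point h a];
      head [::] [seq b <- bitvecs 4 | on_point h b && (b \notin [:: nseq 4 false; c; d; vxor c d])];
      c; d].
Definition frame1 f := let h := take 4 f in let d := drop 4 f in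
  frame h (head [::] [seq c <- bitvecs 4 | on_point h c && (c \notin [:: nseq 4 false; d])]) d.

Definition pencils := [seq (c, d) | c <- bitvecs 4, d <- bitvecs 4].
Definition spans := [seq qvec cd.1 cd.2 | cd <- pencils].
Definition frame2 f := let cd := nth ([::], [::]) pencils (index (drop 4 f) spans) in
  frame (take 4 f) cd.1 cd.2.

Definition frame_ok cs := indep (bitvecs 4) cs && all (fun c => size c == 4) cs.

Lemma frame1_check : all (fun f => let cs := frame1 f in
  frame_ok cs && (hvec (nth [::] cs 1) (nth [::] cs 2) (nth [::] cs 3) ++ nth [::] cs 3 == f)) flags1.
Proof. by vm_compute. Qed.

Lemma frame2_check : all (fun f => let cs := frame2 f in
  frame_ok cs && (hvec (nth [::] cs 1) (nth [::] cs 2) (nth [::] cs 3)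
    ++ qvec (nth [::] cs 2) (nth [::] cs 3) == f)) flags2.
Proof. by vm_compute. Qed.

Lemma unit_flags g : g \in unitmx -> flag1 g \in flags1 /\ flag2 g \in flags2.
Proof.
move=> gu; pose vs := [seq false :: a | a <- bitvecs 3].
have ind : indep vs [:: [::]; gcol g 1; gcol g 2; gcol g 3].
  have svs : all (fun a => size a == 4) vs by vm_compute.
  apply/allP => a avs; have := allP (unit_indep gu svs) a avs.
  case/mapP: avs => a' _ ->.
  pose F cs i := xor_over L4 (fun j => bit L4 (nth [::] cs j) i && bit L4 (false :: a') j).
  have e : F (cols g) =1 F [:: [::]; gcol g 1; gcol g 2; gcol g 3].
    by move=> i; rewrite /F !xor_over4 [bit L4 (false :: a') 0]/= !andbF.
  change (has id (false :: a') ==> has (F (cols g)) L4 ->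
    has id (false :: a') ==> has (F [:: [::]; gcol g 1; gcol g 2; gcol g 3]) L4).
  by rewrite (eq_has e).
have szh m : gcol g m \in bitvecs 4 by have := mem_bitvecs (gcol g m); rewrite size_map.
have := allP (allP (allP good_flag_check _ (szh 1%N)) _ (szh 2)) _ (szh 3).
rewrite ind -/(plane g) -/(line g) => /=; case: ifP => // _ /and5P [h0 v0 on q0 /andP [pl onl]].
have hb : plane g \in bitvecs 4 by have := mem_bitvecs (plane g); rewrite size_map.
have qb : line g \in bitvecs 6 by have := mem_bitvecs (line g); rewrite size_map.
split; apply/mapP.
  exists (plane g, gcol g 3) => //; rewrite mem_filter; apply/andP; split; first by apply/and3P.
  by apply/allpairsP; exists (plane g, gcol g 3); split; [exact: hb|exact: (szh 3)|].
exists (plane g, line g) => //; rewrite mem_filter; apply/andP; split; first by apply/and4P.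
by apply/allpairsP; exists (plane g, line g); split; [exact: hb|exact: qb|].
Qed.

Lemma frame_gcol cs j : frame_ok cs -> size cs = 4%N -> (j < 4)%N -> gcol (mkmx cs) j = nth [::] cs j.
Proof.
move=> /andP [_ /allP sc] s4 j4; apply: gcol_mkmx => //; apply/eqP/sc.
by rewrite mem_nth ?s4.
Qed.

Lemma flags1_unit f : f \in flags1 -> exists2 g, g \in unitmx & flag1 g = f.
Proof.
move=> ff; have /andP [ok /eqP e] := allP frame1_check f ff.
exists (mkmx (frame1 f)); first by apply: mkmx_unit; [|case/andP: ok].
by rewrite /flag1 /plane !(frame_gcol ok).
Qed.

Lemma flags2_unit f : f \in flags2 -> exists2 g, g \in unitmx & flag2 g = f.
Proof.
move=> ff; have /andP [ok /eqP e] := allP frame2_check f ff.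
exists (mkmx (frame2 f)); first by apply: mkmx_unit; [|case/andP: ok].
by rewrite /flag2 /plane /line !(frame_gcol ok).
Qed.

(** * The two spikes *)

Definition eA b s := mono4 0 (dO s.+1) (dO (s + b.+1)) (dO (s + b.+1)).
Definition eB b s := mono4 0 (dO s) (dO s) (dO (s + b.+2)).

Lemma mdeg_eB b s : mdeg (eB b s) = dN b s.
Proof.
rewrite mdeg4 !mono4_nth //=; elim: s => [|s IH]; first by rewrite !add0n dO_dE.
by rewrite addSn /= -IH; lia.
Qed.

Lemma mdeg_eA b s : mdeg (eA b s) = dN b s.
Proof.
rewrite mdeg4 !mono4_nth //=; elim: s => [|s IH]; last by rewrite addSn /= -IH /=; lia.
by rewrite -dO_dE add0n /=; lia.
Qed.

Lemma eA_prim b s g : prim (dN b s) (cof (eA b s) g).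
Proof. rewrite -mdeg_eA; exact: cof_prim (mono4_spike 0 _ _ _). Qed.

Lemma eB_prim b s g : prim (dN b s) (cof (eB b s) g).
Proof. rewrite -mdeg_eB; exact: cof_prim (mono4_spike 0 _ _ _). Qed.

Lemma hmg_wx z : hmg (dO (size z)) (wp (map x z)).
Proof.
elim: z => [|i z IH] /=; first exact: hmg1.
by rewrite -add1n -addnn expr2; apply: hmgM (homog_x i) (hmgM IH IH).
Qed.

Lemma hmg_wxp z : hmg (dE (size z)) (wp (map xp z)).
Proof.
elim: z => [|p z IH] /=; first exact: hmg1.
by rewrite doubleS -(addn2 _.*2) addnC -addnn expr2; apply: hmgM (homog_xx p.1 p.2) (hmgM IH IH).
Qed.

Lemma all_coefT g w : all (mem L4) w -> all (coefT g) w = all (bit L4 (plane g)) w.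
Proof. by move=> /allP lw; apply: eq_in_all => i /lw iL; rewrite coefT_plane. Qed.

Section Values.
Variables (b s : nat) (g : 'M[k]_4).
Let al := cof (eA b s) g.
Let be := cof (eB b s) g.

Lemma alpha_c1 w z : size w = s -> all (mem L4) w -> (0 < size z)%N -> c1 al w z = false.
Proof.
move=> sw lw; case: z => // i z _; rewrite c1E /al /eA -sw -addn1 cof_Tword //.
by rewrite -[wp _]/(x i * wp (map x z) ^+ 2) cof_x0 andbF.
Qed.

Lemma alpha_c2 w z : size w = s.+1 -> all (mem L4) w -> size z = b -> all (mem pairs) z ->
  c2 al w z = monoc (flag2 g) (code2 w z).
Proof.
move=> sw lw sz lz; rewrite monoc_code ?size_map //.
have e : eA b s = mono4 0 (dO (size w + 0)) (dO (size w + size z)) (dO (size w + size z)).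
  by rewrite /eA sw sz addn0 addSnnS.
rewrite c2E /al e cof_Tword // cof_Pword all_coefT //; congr (_ && _).
by apply: eq_in_all => p /(allP lz) pp; rewrite coefP_line.
Qed.

Lemma beta_Tword w F : size w = s -> all (mem L4) w -> hmg (dO b.+2) F ->
  be (wt (map T w) F) = all (bit L4 (plane g)) w && evp g F.
Proof.
move=> sw lw hF; have e : eB b s = mono4 0 (dO (size w + 0)) (dO (size w + 0)) (dO (size w + b.+2)).
  by rewrite /eB sw addn0.
by rewrite /be e cof_Tword // all_coefT // (cof_evp g hF).
Qed.

Lemma evp_letters w : all (mem L4) w -> all (evp g) (map x w) = all (bit L4 (gcol g 3)) w.
Proof.
move=> /allP lw; rewrite all_map; apply: eq_in_all => i /lw iL /=.
by rewrite evp_x bit_gcol.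
Qed.

Lemma beta_c1 w z : size w = s -> all (mem L4) w -> size z = b.+2 -> all (mem L4) z ->
  c1 be w z = monoc (flag1 g) (code1 w z).
Proof.
move=> sw lw sz lz; rewrite monoc_code ?size_map // c1E beta_Tword //.
  by rewrite evp_wp evp_letters.
by rewrite -sz; apply: hmg_wx.
Qed.

Definition point_letters i (z : seq (nat * nat)) :=
  [seq j <- L4 | j != i] ++ flatten [seq [:: p.1; p.2] | p <- z].

Lemma evp_T i : i \in L4 -> evp g (T i) = all (bit L4 (gcol g 3)) [seq j <- L4 | j != i].
Proof.
rewrite mem4; case: i => [|[|[|[|//]]]] _;
  [rewrite (@T_q4 0 1 2 3) //|rewrite (@T_q4 1 0 2 3) //|rewrite (@T_q4 2 0 1 3) //|rewrite (@T_q4 3 0 1 2) //];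
  rewrite !evpM !evp_x -!bit_gcol // -andbA; move: (bit L4 (gcol g 3)) => f; by rewrite /= andbT.
Qed.

Lemma pairs_mem p : p \in pairs -> p.1 \in L4 /\ p.2 \in L4.
Proof. by rewrite /pairs !inE => /or3P [|| /or4P []] /eqP ->. Qed.

Lemma point_letters_mem i z : all (mem pairs) z -> all (mem L4) (point_letters i z).
Proof.
move=> /allP lz; apply/allP => j; rewrite mem_cat => /orP [|/flattenP [u /mapP [p /lz /pairs_mem [h1 h2] ->]]].
  by rewrite mem_filter => /andP [].
by rewrite mem_seq2 => /orP [] /eqP ->.
Qed.

Lemma beta_c2 w i z : size w = s -> all (mem L4) (rcons w i) -> size z = b -> all (mem pairs) z ->
  c2 be (rcons w i) z = monoc (flag1 g) (code1 w (point_letters i z)).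
Proof.
move=> sw; rewrite all_rcons => /andP [iL lw] sz lz.
rewrite monoc_code ?size_map ?point_letters_mem // c2E -cats1 map_cat wt_cat.
rewrite -[wt (map T [:: i]) _]/(T i * wp (map xp z) ^+ 2) beta_Tword //; last first.
  have i4 : (i < 4)%N by rewrite -mem4.
  have -> : dO b.+2 = (3 + (dE (size z) + dE (size z)))%N by rewrite dO_dE /= sz -addnn; lia.
  by rewrite expr2; apply: hmgM (homog_T i4) (hmgM (hmg_wxp z) (hmg_wxp z)).
congr (_ && _); rewrite evpM evp_sqr evp_wp evp_T // /point_letters all_cat; congr (_ && _).
elim: z {sz} lz => //= p z IH /andP [pp lz]; have [h1 h2] := pairs_mem pp.
by rewrite /xp evpM !evp_x -!bit_gcol // IH // andbA.
Qed.
End Values.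

(** * Generation of the primitives by translates of two spikes *)

Section Sums.
Variable (I : eqType).
Implicit Types (F : I -> PR -> bool) (r : seq I).

Definition xsumf F r (p : PR) : bool := xsum (F^~ p) r.

Lemma prim_sum n F r : (forall i, i \in r -> prim n (F i)) -> prim n (xsumf F r).
Proof.
elim: r => [|i r IH] h.
  by split=> [|p]; [split=> [p q|m _]|]; rewrite /xsumf /xsum !big_nil.
have e : (fun p => F i p (+) xsumf F r p) =1 xsumf F (i :: r).
  by move=> p; rewrite /xsumf /xsum big_cons.
have [h1 h2] := prim_xor (h i (mem_head _ _)) (IH (fun j jr => h j (mem_behead (s := i :: r) jr))).
by split=> [|p]; [apply: hfun_eq e h1|rewrite -!e].
Qed.
End Sums.

Lemma realize (f : 'M[k]_4 -> seq bool) (flags bl : seq (seq bool)) :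
  (forall c, c \in flags -> exists2 g, g \in unitmx & f g = c) -> {subset bl <= flags} ->
  exists2 gs, all (fun g => g \in unitmx) gs & map f gs = bl.
Proof.
move=> h; elim: bl => [|c bl IH] sub; first by exists [::].
have [|gs gu <-] := IH; first by move=> d db; apply: sub; rewrite inE db orbT.
have [g ug <-] := h c (sub c (mem_head _ _)).
by exists (g :: gs) => //=; rewrite ug.
Qed.

Section Generation.
Variables (b s : nat).
Hypotheses (s0 : (0 < s)%N) (b2 : (2 < b)%N).
Notation al := (cof (eA b s)).
Notation be := (cof (eB b s)).
Notation units := (all (fun g : 'M[k]_4 => g \in unitmx)).

Lemma prim_c1_zero th : prim (dN b s) th ->
  (forall w z, size w = s -> letters w -> size z = b.+2 -> letters z -> c1 th w z = false) ->
  exists2 gs, units gs & th =1 xsumf al gs.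
Proof.
move=> pth h1; have b1 : (1 < b)%N by apply: ltnW.
have [bl blf h2] := c2_span (tp_chain_of_c1 b1 pth h1) (s0 : (1 < s.+1)%N) b2.
have [gs gu egs] := realize flags2_unit blf.
exists gs => // p; have pal : prim (dN b s) (xsumf al gs) by apply: prim_sum => g _; apply: eA_prim.
have h := word_inj b1 (prim_xor pth pal).
suff : th p (+) xsumf al gs p = false by case: (th p) (xsumf _ _ _) => [] [].
apply: h => w z sw lw sz lz; have lw4 : all (mem L4) w by rewrite -letters4.
  have -> : c1 (fun p => th p (+) xsumf al gs p) w z = c1 th w z (+) xsum (fun g => c1 (al g) w z) gs by [].
  rewrite h1 // /xsum big1 // => g _; apply: alpha_c1 => //; by rewrite sz.
have -> : c2 (fun p => th p (+) xsumf al gs p) w z = c2 th w z (+) xsum (fun g => c2 (al g) w z) gs by [].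
rewrite h2 // -egs xsum_map /xsum -big_split big1 //= => g _.
by rewrite alpha_c2 // addbb.
Qed.

Lemma beta_sum_c1 gs w z : size w = s -> letters w -> size z = b.+2 -> letters z ->
  c1 (xsumf be gs) w z = xsum (monoc^~ (code1 w z)) (map flag1 gs).
Proof.
rewrite !letters4 => sw lw sz lz; rewrite xsum_map.
by apply: eq_bigr => g _; apply: beta_c1.
Qed.

Lemma prim_generated th : prim (dN b s) th -> exists gs hs,
  [/\ units gs, units hs & forall p, th p = xsumf be gs p (+) xsumf al hs p].
Proof.
move=> pth; have [bl blf h1] := c1_span pth s0 b2.
have [gs gu egs] := realize flags1_unit blf.
have pbe : prim (dN b s) (xsumf be gs) by apply: prim_sum => g _; apply: eB_prim.
have [w z sw lw sz lz|hs hu e] := prim_c1_zero (prim_xor pth pbe).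
  have -> : c1 (fun p => th p (+) xsumf be gs p) w z = c1 th w z (+) c1 (xsumf be gs) w z by [].
  by rewrite beta_sum_c1 // egs h1 ?addbb // -letters4.
exists gs, hs; split=> // p; rewrite -e.
by case: (th p) (xsumf _ _ _) => [] [].
Qed.

Definition planes_at v := [seq f <- flags1 | drop 4 f == v].

Lemma planes_at_check : let r := planes_at [:: true; false; false; false] in odd (size r) &&
  all (fun c => ~~ xfold (monoc^~ c) r) [seq code1 w z | w <- subs 1 2 L4, z <- subs 1 4 L4].
Proof. by vm_compute. Qed.

(* The sum over the planes through a point of a monomial of degree less than 3
   vanishes. *)
Lemma beta_sum_alpha : (s <= 2)%N -> exists gs hs,
  [/\ units gs, odd (size gs), units hs & xsumf be gs =1 xsumf al hs].
Proof.
move=> s2; pose r := planes_at [:: true; false; false; false].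
have /andP [odd_r /allP chk] := planes_at_check.
have [c|gs gu egs] := realize flags1_unit (bl := r); first by rewrite mem_filter => /andP [].
have pbe : prim (dN b s) (xsumf be gs) by apply: prim_sum => g _; apply: eB_prim.
have [w z sw lw sz lz|hs hu e] := prim_c1_zero pbe.
  rewrite beta_sum_c1 // egs -xfoldE; apply/negbTE; rewrite !letters4 in lw lz.
  rewrite (filter_code lw lz); apply: chk; apply/allpairsP.
  exists (filter (mem w) L4, filter (mem z) L4); split=> //.
    by apply: filter_subs => //; rewrite sw ?s0 ?s2.
  by apply: filter_subs => //; rewrite sz //= orbT.
by exists gs, hs; rewrite -(size_map flag1) egs.
Qed.

Let combine (I : eqType) (ms : seq I) (va vb : 'M[k]_4 -> I -> bool) :
  (forall m, m \in ms -> exists q, forall g, al g q = va g m /\ be g q = vb g m) ->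
  exists q, forall g, al g q = xfold (va g) ms /\ be g q = xfold (vb g) ms.
Proof.
elim: ms => [|m ms IH] h.
  by exists 0 => g; rewrite (hfun0 (eA_prim b s g).1) (hfun0 (eB_prim b s g).1).
have [|q1 h1] := IH; first by move=> m' mm; apply: h; rewrite inE mm orbT.
have [q2 h2] := h m (mem_head _ _); exists (q2 + q1) => g.
rewrite (hfunD _ _ (eA_prim b s g).1) (hfunD _ _ (eB_prim b s g).1) /=.
by rewrite !(h1 g).1 !(h1 g).2 !(h2 g).1 !(h2 g).2.
Qed.

(* The coefficient of a word monomial in the constant 1 is the number of flags
   dual to it. *)
Definition ones1 := let ks := [seq d.1 | d <- duals1 & odd (size d.2)] in
  [seq wz <- [seq (w, z) | w <- subs 1 3 L4, z <- subs 1 4 L4] | code1 wz.1 wz.2 \in ks].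
Definition ones2 := let ks := [seq d.1 | d <- duals2 & odd (size d.2)] in
  [seq wz <- [seq (w, z) | w <- subs 1 2 L4, z <- subs 1 3 pairs] | code2 wz.1 wz.2 \in ks].

Lemma ones1_check : all (fun c => xfold (fun wz => monoc c (code1 wz.1 wz.2)) ones1) flags1.
Proof. by vm_compute. Qed.
Lemma ones2_check : all (fun c => xfold (fun wz => monoc c (code2 wz.1 wz.2)) ones2) flags2.
Proof. by vm_compute. Qed.

Lemma code_pad (A B : eqType) (LA : seq A) (LB : seq B) m n w z :
  code LA LB (pad m w) (pad n z) = code LA LB w z.
Proof. by apply: code_eq => i; rewrite mem_pad. Qed.

Lemma beta_one : (2 < s)%N -> exists q, forall g, g \in unitmx -> be g q /\ al g q = false.
Proof.
move=> s2; have [wz|q h] := @combine _ ones1 (fun=> xpred0) (fun g wz => monoc (flag1 g) (code1 wz.1 wz.2)).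
  rewrite mem_filter => /andP [_ /allpairsP [[w z] [/subsP [w0 ws lw] /subsP [z0 zs lz] ->]]]; cbn [fst snd].
  exists (wp (map T (pad s w) ++ map x (pad b.+2 z))) => g.
  have sw : size (pad s w) = s by apply: size_pad => //; apply: leq_trans s2.
  have sz : size (pad b.+2 z) = b.+2 by apply: size_pad => //; apply: leq_trans zs _; rewrite ltnW.
  have lw' := all_pad s lw; have lz' := all_pad b.+2 lz.
  split; first by apply: alpha_c1 => //; rewrite sz.
  by rewrite -(code_pad _ _ s b.+2); apply: beta_c1.
exists q => g gu; have [-> ->] := h g; have [f1 _] := unit_flags gu.
split; first exact: (allP ones1_check _ f1).
by elim: ones1 => //= _ r ->.
Qed.

Lemma alpha_one : exists q, forall g, g \in unitmx -> al g q /\ be g q = false.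
Proof.
have [wz|q h] := @combine _ ones2 (fun g wz => monoc (flag2 g) (code2 wz.1 wz.2)) (fun=> xpred0).
  rewrite mem_filter => /andP [_ /allpairsP [[w z] [/subsP [w0 ws lw] /subsP [z0 zs lz] ->]]]; cbn [fst snd].
  have sw : size (pad s.+1 w) = s.+1 by apply: size_pad => //; apply: leq_trans ws _.
  have sz : size (pad b z) = b by apply: size_pad => //; apply: leq_trans zs _.
  have lw' := all_pad s.+1 lw; have lz' := all_pad b lz.
  pose t := pad b z; rewrite -(code_pad _ _ s.+1 b) -/t in sz lz' *.
  have := lw'; have := sw; case/lastP: (pad s.+1 w) => // u i; rewrite size_rcons => -[su] lui.
  have [iL lu] : i \in L4 /\ all (mem L4) u by move: lui; rewrite all_rcons => /andP [].
  pose r := pad b.+2 (filter (mem (point_letters i t)) L4).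
  have lp := point_letters_mem i lz'.
  have sr : size r = b.+2.
    rewrite /r size_pad // size_filter.
      rewrite -has_count; apply/hasP; exists (i == 0%N : nat); first by case: (i == 0%N).
      by rewrite /= mem_cat mem_filter; case: i {lui iL lp r} => [|i].
    by apply: leq_trans (count_size _ _) _; rewrite ltnS ltnW.
  exists (wp (map T (rcons u i) ++ map xp t) + wp (map T u ++ map x r)) => g.
  rewrite (hfunD _ _ (eA_prim b s g).1) (hfunD _ _ (eB_prim b s g).1).
  have lr : all (mem L4) r by apply: all_pad; apply/allP => j; rewrite mem_filter => /andP [].
  rewrite -[al g (wp (_ ++ map xp _))]/(c2 (al g) (rcons u i) t) alpha_c2 ?size_rcons ?su //.
  rewrite -[al g _]/(c1 (al g) u r) alpha_c1 ?sr // addbF; split=> //.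
  rewrite -[be g (wp (_ ++ map xp _))]/(c2 (be g) (rcons u i) t) beta_c2 //.
  rewrite -[be g _]/(c1 (be g) u r) beta_c1 //.
  have -> : code1 u r = code1 u (point_letters i t); last exact: addbb.
  apply: code_eq => // j; rewrite mem_pad mem_filter /=.
  by case: (boolP (j \in point_letters i t)) => // h'; exact: (allP lp j h').
exists q => g gu; have [-> ->] := h g; have [_ f2] := unit_flags gu.
split; first exact: (allP ones2_check _ f2).
by elim: ones2 => //= _ r ->.
Qed.
End Generation.

(** * Row vectors as functionals *)

Section Rows.
Variable n : nat.
Notation N := (Nmon n).
Implicit Types (u v : 'rV[k]_N) (p q : P4).

Definition mo (j : 'I_N) : 'X_{1..4} := monv (enum_val j).

Lemma mdeg_mo j : mdeg (mo j) = n.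
Proof. exact/eqP/(valP (enum_val j)). Qed.

Lemma mo_inj : injective mo.
Proof. by move=> i j h; apply: enum_val_inj; apply/val_inj/val_inj. Qed.

Lemma mo_surj m : mdeg m = n -> exists j, mo j = m.
Proof.
move=> dm; have lt : (mdeg m < n.+1)%N by rewrite dm.
have e : mdeg (BMultinom lt) == n by rewrite /= dm.
by exists (enum_rank (exist _ (BMultinom lt) e : mon n)); rewrite /mo enum_rankK.
Qed.

Definition evr u p : k := \sum_j u 0 j * p@_(mo j).
Definition rfun u : PR -> bool := fun p : PR => nz (evr u (toP p)).

Lemma evr_addr u p q : evr u (p + q) = evr u p + evr u q.
Proof. by rewrite -big_split; apply: eq_bigr => j _; rewrite mcoeffD mulrDr. Qed.

Lemma evr_addl u v p : evr (u + v) p = evr u p + evr v p.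
Proof. by rewrite -big_split; apply: eq_bigr => j _; rewrite mxE mulrDl. Qed.

Lemma evr0 u : evr u 0 = 0.
Proof. by apply: big1 => j _; rewrite mcoeff0 mulr0. Qed.

Lemma evr0l p : evr 0 p = 0.
Proof. by apply: big1 => j _; rewrite mxE mul0r. Qed.

Lemma evrZ u (c : k) p : evr u (c *: p) = c * evr u p.
Proof. by rewrite /evr mulr_sumr; apply: eq_bigr => j _; rewrite mcoeffZ mulrCA. Qed.

Lemma evr_X0 u m : mdeg m != n -> evr u 'X_[m] = 0.
Proof.
move=> nm; apply: big1 => j _; rewrite mcoeffX; case: eqP => [e|_]; last exact: mulr0.
by move: nm; rewrite e mdeg_mo eqxx.
Qed.

Lemma evr_mo u j : evr u 'X_[mo j] = u 0 j.
Proof.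
rewrite /evr (bigD1 j) //= mcoeffX eqxx mulr1 big1 ?addr0 // => i ij.
by rewrite mcoeffX (inj_eq mo_inj) eq_sym (negPf ij) mulr0.
Qed.

Lemma evr_ext u (f : P4 -> k) : {morph f : p q / p + q} -> (forall c p, f (c *: p) = c * f p) ->
  (forall m, f 'X_[m] = evr u 'X_[m]) -> forall p, f p = evr u p.
Proof.
move=> fD fZ fX p; have f0 : f 0 = 0 by rewrite -(scale0r (0 : P4)) fZ mul0r.
rewrite (mpolyE p) (big_morph f fD f0) (big_morph (evr u) (evr_addr u) (evr0 u)).
by apply: eq_bigr => m _; rewrite fZ evrZ fX.
Qed.

Lemma rfun_inj u v : rfun u =1 rfun v -> u = v.
Proof.
move=> h; apply/rowP => j; have := h (ofP 'X_[mo j]); rewrite /rfun ofPK !evr_mo.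
by case: (F2_case (u 0 j)) (F2_case (v 0 j)) => -> [] ->; rewrite ?nz0 ?nz1.
Qed.

Lemma rfunD u v (r : PR) : rfun (u + v) r = rfun u r (+) rfun v r.
Proof. by rewrite /rfun evr_addl nzD. Qed.

Lemma SqMxE u (j : 'I_#|{: 'X_{1..4 < n}}|) : (u *m SqMx n) 0 j = evr u (Sq 'X_[bmv (enum_val j)]).
Proof. by rewrite mxE; apply: eq_bigr => i _; rewrite mxE. Qed.

Lemma PrimMxP u : (u <= PrimMx n)%MS <-> prim n (rfun u).
Proof.
split=> [/sub_kermxP S0|[_ Su]].
  split.
    split=> [p q|m nm]; rewrite /rfun !ofPK; first by rewrite evr_addr nzD.
    by rewrite evr_X0 // nz0.
  move=> p; rewrite /rfun /St ofPK; congr nz; move: (toP p) => {}p.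
  have SqZ c (r : P4) : Sq (c *: r) = c *: Sq r by exact: comp_mpolyZ.
  apply: (evr_ext (f := fun p => evr u (Sq p))) => [r r'|c r|m].
  - by rewrite SqD evr_addr.
  - by rewrite SqZ evrZ.
  have [lt|ge] := ltnP (mdeg m) n; last first.
    by apply: eq_bigr => j _; rewrite Sq_low ?mdeg_mo // mcoeffX.
  rewrite evr_X0 ?(ltn_eqF lt) //.
  have := SqMxE u (enum_rank (BMultinom lt)); rewrite S0 mxE enum_rankK => ->.
  by [].
apply/sub_kermxP/rowP => j; rewrite SqMxE mxE; apply/eqP; rewrite -[_ == _]negbK -/(nz _).
have := Su (ofP 'X_[bmv (enum_val j)]); rewrite /rfun /St !ofPK => ->.
rewrite evr_X0 ?nz0 //; have := bmdeg (enum_val j); rewrite /bmv /= => lt.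
by rewrite ltn_eqF.
Qed.

Lemma evr_GMx u g p : evr (u *m GMx n g) p = evr u (gsub g p).
Proof.
have gZ c (r : P4) : gsub g (c *: r) = c *: gsub g r by exact: comp_mpolyZ.
symmetry; apply: (evr_ext (f := fun p => evr u (gsub g p))) => [r r'|c r|m].
- by rewrite gsubD evr_addr.
- by rewrite gZ evrZ.
have [e|ne] := eqVneq (mdeg m) n.
  by have [j <-] := mo_surj e; rewrite evr_mo mxE; apply: eq_bigr => i _; rewrite mxE.
rewrite evr_X0 //; apply: big1 => j _.
rewrite (_ : _@_(mo j) = 0) ?mulr0 //; apply/eqP; rewrite mcoeff_eq0; apply/negP => he.
have /dhomogP h : gsub g 'X_[m] \is (mdeg m).-homog by apply: gsub_homog; rewrite dhomogX.
by have := h _ he; rewrite /= mdeg_mo => e; rewrite e eqxx in ne.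
Qed.

Lemma evr_dualmon e p : mdeg e = n -> evr (dualmon n e) p = p@_e.
Proof.
move=> /mo_surj [i <-]; rewrite /evr (bigD1 i) //= mxE eqxx mul1r big1 ?addr0 // => j ji.
by rewrite mxE (inj_eq mo_inj) (negPf ji) mul0r.
Qed.

Lemma rfun_dualmon e g : mdeg e = n -> rfun (dualmon n e *m GMx n g) =1 cof e g.
Proof. by move=> de p; rewrite /rfun evr_GMx evr_dualmon. Qed.

Lemma mul_GMx u g h : u *m GMx n g *m GMx n h = u *m GMx n (h *m g).
Proof.
apply: rfun_inj => p; rewrite /rfun; move: (toP p) => q.
have e : evr (u *m GMx n g *m GMx n h) q = evr (u *m GMx n (h *m g)) q.
  apply: etrans (evr_GMx (u *m GMx n g) h q) _; apply: etrans (evr_GMx u g (gsub h q)) _.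
  apply: etrans (esym (evr_GMx u (h *m g) q)).
  exact: (congr1 (evr u) (gsub_gsub g h q)).
exact: (congr1 nz e).
Qed.

Lemma gsub_id p : gsub 1%:M p = p.
Proof.
pose F : {rmorphism P4 -> P4} := comp_mpoly [tuple (\sum_(j < 4) (1%:M : 'M[k]_4) i j *: 'X_j : P4) | i < 4].
apply: (endo_ext (F := F) (G := idfun)) => i i4; rewrite -[F _]/(gsub 1%:M (px i)) gsub_px.
rewrite (bigD1 (inord i)) //= mxE eqxx scale1r big1 ?addr0 // => j ji.
by rewrite mxE eq_sym (negPf ji) scale0r.
Qed.

Lemma mul_GMx1 u : u *m GMx n 1%:M = u.
Proof.
apply: rfun_inj => p; rewrite /rfun; move: (toP p) => q.
have e : evr (u *m GMx n 1%:M) q = evr u q.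
  by rewrite evr_GMx; exact: (congr1 (evr _) (gsub_id _)).
exact: (congr1 nz e).
Qed.

Lemma sub_CoinvKer u g : (u <= PrimMx n)%MS -> g \in unitmx -> (u *m (GMx n g - 1%:M) <= CoinvKer n)%MS.
Proof.
move=> pu gu; apply: (sumsmx_sup g) => //.
by rewrite genmxE; apply: submxMr.
Qed.

End Rows.

(** * The coinvariants *)

Lemma rank_complement (F : fieldType) r m N (M : 'M[F]_(r, N)) (C : 'M_(m, N)) (Q : 'M_(N, r)) :
  M *m Q = 1%:M -> C *m Q = 0 -> \rank (M + C)%MS = (r + \rank C)%N.
Proof.
move=> MQ CQ; rewrite mxrank_disjoint_sum.
  congr (_ + _)%N; apply/eqP; rewrite eqn_leq rank_leq_row -{1}(mxrank1 F r) -MQ; exact: mxrankM_maxl.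
apply/eqP; rewrite -submx0; apply/rV_subP => v; rewrite sub_capmx => /andP [/submxP [w ->] /submxP [y e]].
have w0 : w = 0 by rewrite -[w]mulmx1 -MQ mulmxA e -mulmxA CQ mulmx0.
by rewrite w0 mul0mx sub0mx.
Qed.

Lemma prim_ext n th th' : th =1 th' -> prim n th -> prim n th'.
Proof. by move=> e [h1 h2]; split=> [|p]; [apply: hfun_eq e h1|rewrite -!e]. Qed.

Section Coinvariants.
Variables (b s : nat).
Hypotheses (s0 : (0 < s)%N) (b2 : (2 < b)%N).
Notation n := (dN b s).
Notation A := (dualmon n (eA b s)).
Notation B := (dualmon n (eB b s)).
Notation units := (all (fun g : 'M[k]_4 => g \in unitmx)).
Notation tr u g := (u *m GMx n g).
Implicit Type u : 'rV[k]_(Nmon n).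

Lemma rfun_sum (gs : seq 'M[k]_4) (u : 'M[k]_4 -> 'rV[k]_(Nmon n)) (p : PR) :
  rfun (\sum_(g <- gs) u g) p = xsumf (fun g => rfun (u g)) gs p.
Proof.
elim: gs => [|g gs IH]; rewrite /xsumf /xsum ?big_nil ?big_cons.
  by rewrite /rfun evr0l nz0.
by rewrite rfunD; congr (_ (+) _).
Qed.

Lemma tr_prim g : (tr A g <= PrimMx n)%MS /\ (tr B g <= PrimMx n)%MS.
Proof.
split; apply/PrimMxP.
  by apply: prim_ext (eA_prim b s g) => p; rewrite rfun_dualmon ?mdeg_eA.
by apply: prim_ext (eB_prim b s g) => p; rewrite rfun_dualmon ?mdeg_eB.
Qed.

Lemma alpha_beta_prim : (A <= PrimMx n)%MS /\ (B <= PrimMx n)%MS.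
Proof. by have := tr_prim 1%:M; rewrite !mul_GMx1. Qed.

Lemma PrimMx_decomp u : (u <= PrimMx n)%MS -> exists gs hs, [/\ units gs, units hs &
  u = \sum_(g <- gs) tr B g + \sum_(g <- hs) tr A g].
Proof.
move=> /PrimMxP pu; have [gs [hs [gu hu e]]] := prim_generated s0 b2 pu.
exists gs, hs; split=> //; apply: rfun_inj => p; rewrite rfunD !rfun_sum e.
congr (_ (+) _); apply: eq_bigr => g _; symmetry; apply: rfun_dualmon.
  exact: mdeg_eB.
exact: mdeg_eA.
Qed.

Lemma tr_PrimMx u g : g \in unitmx -> (u <= PrimMx n)%MS -> (tr u g <= PrimMx n)%MS.
Proof.
move=> gu /PrimMx_decomp [gs [hs [_ _ ->]]]; rewrite mulmxDl !mulmx_suml.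
by apply: addmx_sub; apply: summx_sub => h _; rewrite mul_GMx; case: (tr_prim (g *m h)).
Qed.

Lemma CoinvKer_prim : (CoinvKer n <= PrimMx n)%MS.
Proof.
apply/sumsmx_subP => g gu; rewrite genmxE; apply/row_subP => i; rewrite row_mul mulmxBr mulmx1.
by rewrite addmx_sub ?eqmx_opp ?tr_PrimMx ?row_sub.
Qed.

Lemma tr_coinv u g : (u <= PrimMx n)%MS -> g \in unitmx -> (tr u g <= u + CoinvKer n)%MS.
Proof.
move=> pu gu; rewrite (_ : tr u g = u + u *m (GMx n g - 1%:M)); last first.
  by rewrite mulmxBr mulmx1 addrC subrK.
by apply: addmx_sub_adds => //; apply: sub_CoinvKer.
Qed.

Lemma PrimMx_span : (PrimMx n <= A + B + CoinvKer n)%MS.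
Proof.
have [pA pB] := alpha_beta_prim.
apply/row_subP => i; have /PrimMx_decomp [gs [hs [/allP gu /allP hu ->]]] := row_sub i (PrimMx n).
apply: addmx_sub; rewrite big_seq; apply: summx_sub => g.
  by move=> /gu ug; apply: submx_trans (tr_coinv pB ug) _; apply: addsmxS => //; apply: addsmxSr.
by move=> /hu ug; apply: submx_trans (tr_coinv pA ug) _; apply: addsmxS => //; apply: addsmxSl.
Qed.

Lemma sub_beta : (s <= 2)%N -> (B <= A + CoinvKer n)%MS.
Proof.
move=> s2; have [pA pB] := alpha_beta_prim.
have [gs [hs [/allP gu odd_gs /allP hu e]]] := beta_sum_alpha s0 b2 s2.
have eBA : \sum_(g <- gs) tr B g = \sum_(g <- hs) tr A g.
  apply: rfun_inj => p; rewrite !rfun_sum; have := e p.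
  have rB g : rfun (tr B g) p = cof (eB b s) g p by apply: rfun_dualmon; apply: mdeg_eB.
  have rA g : rfun (tr A g) p = cof (eA b s) g p by apply: rfun_dualmon; apply: mdeg_eA.
  by rewrite /xsumf /xsum (eq_bigr _ (fun g _ => rB g)) (eq_bigr _ (fun g _ => rA g)).
have eB : B = \sum_(g <- hs) tr A g - \sum_(g <- gs) B *m (GMx n g - 1%:M).
  rewrite -eBA -sumrB.
  rewrite (eq_bigr (fun=> B)) => [|g _]; last by rewrite mulmxBr mulmx1 opprB addrC subrK.
  have two (u : 'rV[k]_(Nmon n)) : u + u = 0.
    by apply/rowP => j; rewrite !mxE; case: (F2_case (u 0 j)) => ->; apply: val_inj.
  rewrite big_const_seq count_predT iter_addr_0 -(odd_double_half (size gs)) odd_gs.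
  by rewrite mulrS -muln2 mulnC mulrnA mulr2n two mul0rn addr0.
rewrite eB; apply: addmx_sub; rewrite ?eqmx_opp big_seq; apply: summx_sub => g.
  by move=> /hu; apply: tr_coinv.
by move=> /gu ug; apply: submx_trans (addsmxSr _ _); apply: sub_CoinvKer.
Qed.

Lemma tr_sum u g (r : seq 'M[k]_4) :
  tr (\sum_(h <- r) tr u h) g = \sum_(h <- map (mulmx g) r) tr u h.
Proof. by rewrite big_map mulmx_suml; apply: eq_bigr => h _; apply: mul_GMx. Qed.

Section Detector.
Variables (q : PR) (va vb : bool).
Hypothesis hq : forall g, g \in unitmx -> cof (eA b s) g q = va /\ cof (eB b s) g q = vb.

Definition detector : 'cV[k]_(Nmon n) := \col_j (toP q)@_(mo j).

Lemma mul_detector u : (u *m detector) 0 0 = evr u (toP q).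
Proof. by rewrite mxE; apply: eq_bigr => j _; rewrite mxE. Qed.

Lemma detector_dualmon : nz ((A *m detector) 0 0) = va /\ nz ((B *m detector) 0 0) = vb.
Proof.
have [h1 h2] := hq (unitmx1 _ _).
rewrite !mul_detector -/(rfun A q) -/(rfun B q) -h1 -h2.
split; rewrite -[in LHS](mul_GMx1 (dualmon n _)); apply: rfun_dualmon; [exact: mdeg_eA|exact: mdeg_eB].
Qed.

Lemma rfun_translates gs hs : units gs -> units hs ->
  rfun (\sum_(g <- gs) tr B g + \sum_(g <- hs) tr A g) q = xsum (fun=> vb) gs (+) xsum (fun=> va) hs.
Proof.
move=> /allP gu /allP hu; rewrite rfunD 2!rfun_sum /xsumf /xsum.
congr (_ (+) _); rewrite big_seq [RHS]big_seq; apply: eq_bigr => h.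
  by move=> /gu uh; rewrite rfun_dualmon ?mdeg_eB // (hq uh).2.
by move=> /hu uh; rewrite rfun_dualmon ?mdeg_eA // (hq uh).1.
Qed.

Lemma CoinvKer_detector : CoinvKer n *m detector = 0.
Proof.
apply/sub_kermxP; apply/sumsmx_subP => g gu; rewrite genmxE; apply/row_subP => i.
rewrite row_mul; move: (row_sub i (PrimMx n)); move: (row i _) => u pu.
apply/sub_kermxP; rewrite mulmxBr mulmx1 mulmxBl.
have inv : nz ((tr u g *m detector) 0 0) = nz ((u *m detector) 0 0).
  rewrite !mul_detector -/(rfun (tr u g) q) -/(rfun u q).
  have [gs [hs [ugs uhs ->]]] := PrimMx_decomp pu.
  have um r : units r -> units (map (mulmx g) r).
    by rewrite all_map; apply: sub_all => h uh /=; rewrite unitmx_mul gu.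
  have -> : tr (\sum_(h <- gs) tr B h + \sum_(h <- hs) tr A h) g =
    \sum_(h <- map (mulmx g) gs) tr B h + \sum_(h <- map (mulmx g) hs) tr A h.
    rewrite mulmxDl; exact: (congr2 +%R (tr_sum _ _ _) (tr_sum _ _ _)).
  rewrite (rfun_translates (um _ ugs) (um _ uhs)) (rfun_translates ugs uhs).
  by rewrite /xsum !big_map.
apply/matrixP => i' j'; rewrite !ord1 [RHS]mxE [LHS]mxE [X in _ + X]mxE; move: inv.
by case: (F2_case ((tr u g *m detector) 0 0)) => ->; case: (F2_case ((u *m detector) 0 0)) => ->;
  rewrite ?nz0 ?nz1 // subrr.
Qed.
End Detector.

Lemma F2_1 (c : k) : nz c -> c = 1.
Proof. by case: (F2_case c) => ->; rewrite ?nz0. Qed.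

Lemma F2_0 (c : k) : nz c = false -> c = 0.
Proof. by case: (F2_case c) => ->; rewrite ?nz1. Qed.

Lemma coinv_dim1 : (s <= 2)%N -> coinv_dim n = 1%N.
Proof.
move=> s2; have [q hq] := alpha_one s0 b2; have [pA pB] := alpha_beta_prim.
have [dA _] := detector_dualmon hq.
have rk : \rank (A + CoinvKer n)%MS = (1 + \rank (CoinvKer n))%N.
  apply: (rank_complement (Q := detector q)); last exact: CoinvKer_detector hq.
  by apply/matrixP => i j; rewrite !ord1 (F2_1 dA) mxE eqxx.
have e : (PrimMx n :=: A + CoinvKer n)%MS.
  apply/eqmxP/andP; split; last by rewrite addsmx_sub pA CoinvKer_prim.
  apply: submx_trans PrimMx_span _; rewrite !addsmx_sub addsmxSl addsmxSr sub_beta //.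
by rewrite /coinv_dim e rk addnK.
Qed.

Lemma coinv_dim2 : (2 < s)%N -> coinv_dim n = 2%N.
Proof.
move=> s3; have [q hq] := alpha_one s0 b2; have [q' hq'] := beta_one b2 s3.
have {}hq' g : g \in unitmx -> cof (eA b s) g q' = false /\ cof (eB b s) g q' = true by case/hq'.
have [pA pB] := alpha_beta_prim.
have [dA dB] := detector_dualmon hq; have [dA' dB'] := detector_dualmon hq'.
have eAB : (col_mx A B :=: A + B)%MS by apply: eqmx_sym; apply: addsmxE.
have rk : \rank (col_mx A B + CoinvKer n)%MS = (2 + \rank (CoinvKer n))%N.
  apply: (@rank_complement _ (1 + 1) _ _ _ _ (row_mx (detector q) (detector q'))).
    rewrite mul_col_row -[1%:M]/(1%:M : 'M_(1 + 1)) scalar_mx_block.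
    congr block_mx; apply/matrixP => i j; rewrite !ord1 [RHS]mxE.
    - exact: F2_1 dA. - exact: F2_0 dA'. - exact: F2_0 dB. - exact: F2_1 dB'.
  by rewrite mul_mx_row (CoinvKer_detector hq) (CoinvKer_detector hq') row_mx0.
have e : (PrimMx n :=: col_mx A B + CoinvKer n)%MS.
  apply/eqmxP/andP; split; last by rewrite addsmx_sub eAB addsmx_sub pA pB CoinvKer_prim.
  by apply: submx_trans PrimMx_span _; rewrite addsmx_sub -eAB addsmxSl addsmxSr.
by rewrite /coinv_dim e rk addnK.
Qed.

End Coinvariants.

Lemma dO_exp r : dO r = (2 ^ r - 1)%N.
Proof. by elim: r => // r; rewrite /= expnS; have := expn_gt0 2 r; lia. Qed.

Lemma dN_exp b s : dN b s = (2 ^ (s + b.+1 + 1) + 2 ^ (s + 1) - 3)%N.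
Proof.
elim: s => [|s IH]; last first.
  rewrite /= IH !addSn !expnS; have := expn_gt0 2 (s + b.+1 + 1); have : (2 <= 2 ^ (s + 1))%N.
    by rewrite addn1 expnS; have := expn_gt0 2 s; lia.
  rewrite addn1 expnS; lia.
rewrite -dO_dE dO_exp !add0n addn1 !expnS; have := expn_gt0 2 b; lia.
Qed.

Theorem theorem2p1p8 (s t : nat) (hs : (0 < s)%N) (ht : (4 <= t)%N) :
  let n := (2 ^ (s + t + 1) + 2 ^ (s + 1) - 3)%N in
  let alpha := dualmon n (mono4 0 (2 ^ (s + 1) - 1) (2 ^ (s + t) - 1) (2 ^ (s + t) - 1)) in
  let beta := dualmon n (mono4 0 (2 ^ s - 1) (2 ^ s - 1) (2 ^ (s + t + 1) - 1)) in
  ((s <= 2)%N ->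
     coinv_dim n = 1%N /\ (alpha <= PrimMx n)%MS
     /\ (PrimMx n <= alpha + CoinvKer n)%MS) /\
  ((3 <= s)%N ->
     coinv_dim n = 2%N /\ (alpha <= PrimMx n)%MS /\ (beta <= PrimMx n)%MS
     /\ (PrimMx n <= alpha + beta + CoinvKer n)%MS).
Proof.
case: t ht => // b hb; have b2 : (2 < b)%N by [].
have hn : (2 ^ (s + b.+1 + 1) + 2 ^ (s + 1) - 3)%N = dN b s by rewrite dN_exp.
have hA : mono4 0 (2 ^ (s + 1) - 1) (2 ^ (s + b.+1) - 1) (2 ^ (s + b.+1) - 1) = eA b s.
  by rewrite /eA !dO_exp addn1.
have hB : mono4 0 (2 ^ s - 1) (2 ^ s - 1) (2 ^ (s + b.+1 + 1) - 1) = eB b s.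
  by rewrite /eB !dO_exp addn1 !addnS.
rewrite hn hA hB => n alpha beta.
have [pA pB] := alpha_beta_prim b s; have span := PrimMx_span hs b2.
split=> h; last by split; [exact: coinv_dim2|].
split; first exact: coinv_dim1.
split=> //; apply: submx_trans span _.
by rewrite !addsmx_sub addsmxSl addsmxSr sub_beta.
Qed.
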